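(* Let $p$ be a prime and let $f_1,f_2\in\mathbb{Z}_p[x_0,\dots,x_4]$ be independent random homogeneous polynomials of degree $2$, each sampled from the uniform distribution. Then the expected number of $p$-adic lines on $Z(f_1,f_2)\subset\mathbb{Q}_p\mathrm{P}^4$ (the intersection of two random quadrics) is $1$.
   Context: $\mathbb{Z}_p$ carries the Haar probability measure; a $\mathbb{Z}_p$-valued random variable is uniform if its law is this measure. The uniform distribution on homogeneous polynomials of degree $2$ in $x_0,\dots,x_4$ with coefficients in $\mathbb{Z}_p$ is the law of $f=\sum_{|\alpha|=2}\xi_\alpha x_0^{\alpha_0}\cdots x_4^{\alpha_4}$ with $\{\xi_\alpha\}_{|\alpha|=2}$ i.i.d. uniform in $\mathbb{Z}_p$. $Z(f_1,f_2)$ is the common zero set in the projective space over $\mathbb{Q}_p$. A $p$-adic line is $P(L)\subset\mathbb{Q}_p\mathrm{P}^4$ with $L\subset\mathbb{Q}_p^5$ a $2$-dimensional linear subspace; it lies on $Z(f_1,f_2)$ if $f_1|_L=f_2|_L=0$. *)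

(* Defs.v *)
From HB Require Import structures.
From mathcomp Require Import all_boot all_order all_algebra fraction finmap.
(* The notations of mpoly clash with those of MathComp-Analysis. *)
From mathcomp Require Import -(notations) mpoly.
From mathcomp Require Import all_classical all_reals all_analysis.

Set Implicit Arguments.
Unset Strict Implicit.
Unset Printing Implicit Defensive.
Import Order.TTheory GRing.Theory Num.Theory.
Local Open Scope classical_set_scope.
Local Open Scope ring_scope.

(* Z_p is the inverse limit of the rings Z/p^n. A point x is the sequence of
   its residues, x n being the representative in [0, p^n) of x mod p^n; the
   range of x n is enforced by the compatibility condition itself. *)
Definition coherent (p : nat) (x : nat -> int) : Prop :=
  forall n, x n = (x n.+1 %% (p ^ n)%N)%Z.

Record padic_int (p : nat) (p_pr : prime p) := PadicInt {
  residue :> nat -> int;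
  _ : `[< coherent p residue >] }.

Section padic_int.
Context (p : nat) (p_pr : prime p).
Local Notation Zp := (padic_int p_pr).
Implicit Types x y z : Zp.

HB.instance Definition _ := [isSub for @residue p p_pr].
HB.instance Definition _ := [Choice of Zp by <:].

Lemma residueP x : coherent p x.
Proof. exact/asboolP/(valP x). Qed.

Lemma padic_int_eqP x y : (forall n, x n = y n) -> x = y.
Proof. by move=> xy; apply/val_inj/funext. Qed.

Lemma residue_modz x n : (x n %% (p ^ n)%N)%Z = x n.
Proof. by rewrite (residueP x n) modz_mod. Qed.

Lemma modz_dvdm (m d e : int) : (d %| e)%Z -> ((m %% e)%Z = m %[mod d])%Z.
Proof.
by move=> /dvdzP[q ->]; rewrite [in RHS](divz_eq m (q * d)) mulrA modzMDl.
Qed.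

Lemma modz_expS (a : int) n :
  ((a %% (p ^ n.+1)%N)%Z %% (p ^ n)%N)%Z = (a %% (p ^ n)%N)%Z.
Proof. by rewrite modz_dvdm// dvdzE/= dvdn_exp2l. Qed.

Lemma reduce_coherent (F : nat -> int) :
  (forall n, F n = F n.+1 %[mod (p ^ n)%N])%Z ->
  `[< coherent p (fun n => (F n %% (p ^ n)%N)%Z) >].
Proof. by move=> HF; apply/asboolP => n; rewrite modz_expS. Qed.

Definition padic_reduce F HF : Zp := PadicInt p_pr (@reduce_coherent F HF).

Lemma padic_int_subproof (k : int) n : (k = k %[mod (p ^ n)%N])%Z.
Proof. by []. Qed.

Definition padic_of_int (k : int) : Zp := padic_reduce (padic_int_subproof k).

Lemma padic_add_subproof x y n :
  (x n + y n = x n.+1 + y n.+1 %[mod (p ^ n)%N])%Z.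
Proof. by rewrite (residueP x n) (residueP y n) modzDm. Qed.

Definition padic_add x y : Zp := padic_reduce (padic_add_subproof x y).

Lemma padic_opp_subproof x n : (- x n = - x n.+1 %[mod (p ^ n)%N])%Z.
Proof. by rewrite (residueP x n) modzNm. Qed.

Definition padic_opp x : Zp := padic_reduce (padic_opp_subproof x).

Lemma padic_mul_subproof x y n :
  (x n * y n = x n.+1 * y n.+1 %[mod (p ^ n)%N])%Z.
Proof. by rewrite (residueP x n) (residueP y n) modzMm. Qed.

Definition padic_mul x y : Zp := padic_reduce (padic_mul_subproof x y).

Fact padic_addA : associative padic_add.
Proof.
by move=> x y z; apply: padic_int_eqP => n /=; rewrite modzDml modzDmr addrA.
Qed.

Fact padic_addC : commutative padic_add.
Proof. by move=> x y; apply: padic_int_eqP => n /=; rewrite addrC. Qed.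

Fact padic_add0 : left_id (padic_of_int 0) padic_add.
Proof.
by move=> x; apply: padic_int_eqP => n /=; rewrite modzDml add0r residue_modz.
Qed.

Fact padic_addN : left_inverse (padic_of_int 0) padic_opp padic_add.
Proof.
by move=> x; apply: padic_int_eqP => n /=; rewrite modzDml addNr.
Qed.

HB.instance Definition _ := GRing.isZmodule.Build Zp
  padic_addA padic_addC padic_add0 padic_addN.

Fact padic_mulA : associative padic_mul.
Proof.
by move=> x y z; apply: padic_int_eqP => n /=; rewrite modzMml modzMmr mulrA.
Qed.

Fact padic_mulC : commutative padic_mul.
Proof. by move=> x y; apply: padic_int_eqP => n /=; rewrite mulrC. Qed.

Fact padic_mul1 : left_id (padic_of_int 1) padic_mul.
Proof.
by move=> x; apply: padic_int_eqP => n /=; rewrite modzMml mul1r residue_modz.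
Qed.

Fact padic_mulD : left_distributive padic_mul padic_add.
Proof.
move=> x y z; apply: padic_int_eqP => n /=.
by rewrite modzMml modzDml modzDmr mulrDl.
Qed.

Fact padic_1neq0 : padic_of_int 1 != 0.
Proof.
apply/negP => /eqP/(congr1 (fun x : Zp => x 1%N))/=.
by rewrite expn1 mod0z modz_small//= ltz_nat prime_gt1.
Qed.

HB.instance Definition _ := GRing.Zmodule_isComNzRing.Build Zp
  padic_mulA padic_mulC padic_mul1 padic_mulD padic_1neq0.

Definition padic_unit : pred Zp := fun x => `[< exists y, y * x = 1 >].

Definition padic_inv x : Zp := xget x [set y | y * x = 1].

Fact padic_mulVr : {in padic_unit, left_inverse 1 padic_inv *%R}.
Proof. by move=> x /asboolP[y yx]; rewrite /padic_inv; case: xgetP => [z _|/(_ y)]. Qed.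

Fact padic_unitP x y : y * x = 1 -> padic_unit x.
Proof. by move=> yx; apply/asboolP; exists y. Qed.

Fact padic_inv_out : {in [predC padic_unit], padic_inv =1 id}.
Proof.
move=> x /asboolPn xN; rewrite /padic_inv; case: xgetP => [z _ zx|//].
by case: xN; exists z.
Qed.

HB.instance Definition _ := GRing.ComNzRing_hasMulInverse.Build Zp
  padic_mulVr padic_unitP padic_inv_out.

Lemma residue_le x n k : (n <= k)%N -> (x k %% (p ^ n)%N)%Z = x n.
Proof.
move=> /subnK <-; elim: (k - n)%N => [|m IH]; first exact: residue_modz.
rewrite -IH addSn (residueP x (m + n)) modz_dvdm// dvdzE/=.
by rewrite dvdn_exp2l// leq_addl.
Qed.

Lemma residue_neq0 x : x != 0 -> exists n, x n != 0.
Proof.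
apply: contra_neqP => /forallNP x0; apply: padic_int_eqP => n /=.
by rewrite mod0z; have /negP/negPn/eqP := x0 n.
Qed.

Lemma logn_residue x n k : x n != 0 -> (n <= k)%N ->
  (0 < `|x k|)%N && (logn p `|x k| < n)%N.
Proof.
move=> xn nk; have : ~~ (p ^ n %| `|x k|)%N.
  apply: contra xn => xk; rewrite -(residue_le x nk); apply/eqP/dvdz_mod0P.
  by rewrite dvdzE.
have [->|xk] := posnP `|x k|%N; first by rewrite dvdn0.
by rewrite pfactor_dvdn// -ltnNge.
Qed.

Fact padic_integral : GRing.integral_domain_axiom Zp.
Proof.
move=> x y /eqP xy0; apply: contraTT xy0; rewrite negb_or.
move=> /andP[/residue_neq0[m xm] /residue_neq0[n yn]].
have /andP[x0 lx] := logn_residue xm (leq_addr n m).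
have /andP[y0 ly] := logn_residue yn (leq_addl m n).
apply/negP => /eqP/(congr1 (fun z : Zp => z (m + n)%N))/=.
rewrite mod0z => /dvdz_mod0P; rewrite dvdzE/= abszM.
rewrite pfactor_dvdn ?muln_gt0 ?x0// lognM// leqNgt.
by rewrite -addnS leq_add// ltnW.
Qed.

HB.instance Definition _ :=
  GRing.ComUnitRing_isIntegral.Build Zp padic_integral.

(* The p-adic topology: the ball of radius p^-n around x consists of the
   points with the same residue as x mod p^n. *)
Definition padic_open (A : set Zp) : Prop :=
  forall x, A x -> exists n, forall y, y n = x n -> A y.

Fact padic_openT : padic_open setT.
Proof. by move=> x _; exists 0%N. Qed.

Fact padic_openI : setI_closed padic_open.
Proof.
move=> A B oA oB x [/oA[m mA] /oB[n nB]]; exists (m + n)%N => y yx; split.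
  by apply: mA; rewrite -!(residue_le _ (leq_addr n m)) yx.
by apply: nB; rewrite -!(residue_le _ (leq_addl m n)) yx.
Qed.

Fact padic_open_bigU (I : Type) (f : I -> set Zp) :
  (forall i, padic_open (f i)) -> padic_open (\bigcup_i f i).
Proof.
move=> of_ x [i _ /of_[n nf]]; exists n => y /nf fy.
by exists i.
Qed.

HB.instance Definition _ := isPointed.Build Zp 0.
HB.instance Definition _ := isOpenTopological.Build Zp
  padic_openT padic_openI padic_open_bigU.

Definition padic_display := sigma_display (@open Zp).

(* Z_p carries its Borel sigma-algebra. *)
HB.instance Definition _ := @isMeasurable.Build padic_display Zp
  <<s @open Zp >> (@sigma_algebra0 _ setT (@open Zp))
  (@sigma_algebraC Zp (@open Zp)) (@sigma_algebra_bigcup _ setT (@open Zp)).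

(* Q_p is the fraction field of Z_p. *)
Definition padic := {fraction Zp}.
HB.instance Definition _ := GRing.Field.on padic.

(* The homogeneous polynomials of degree d in n variables over Z_p carry the
   product sigma-algebra, that is, the one generated by the coefficients. *)
Definition quantic (n d : nat) := dhomog n Zp d.
HB.instance Definition _ n d := GRing.Lmodule.on (quantic n d).
HB.instance Definition _ n d := isPointed.Build (quantic n d) 0.

Definition monomial (n d : nat) := {m : multinom n | mdeg m == d}.
HB.instance Definition _ n d := Choice.on (monomial n d).

Definition form_coef n d (m : monomial n d) (f : quantic n d) : Zp :=
  mcoeff (val m) (val f).

Definition coef_events n d : set (set (quantic n d)) :=
  \bigcup_m preimage_set_system setT (@form_coef n d m) measurable.

Definition form_display n d := sigma_display (@coef_events n d).

HB.instance Definition _ n d := @isMeasurable.Build (form_display n d)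
  (quantic n d) <<s @coef_events n d >>
  (@sigma_algebra0 _ setT (@coef_events n d))
  (@sigma_algebraC (quantic n d) (@coef_events n d))
  (@sigma_algebra_bigcup _ setT (@coef_events n d)).

Fact measurable_form_coef n d m : measurable_fun setT (@form_coef n d m).
Proof.
by move=> _ A mA; apply: sub_sigma_algebra; exists m => //; exists A.
Qed.

HB.instance Definition _ n d m := isMeasurableFun.Build _ _ _ _
  (@form_coef n d m) (@measurable_form_coef n d m).

Definition form_eval n d (f : quantic n d) (v : 'rV[padic]_n) : padic :=
  meval (fun i => v 0 i) (map_mpoly (@tofrac Zp) (val f)).

(* The lines P(L) on Z(f, g), each represented by its plane L; Leibniz equality
   in {vspace _} is equality of subspaces, so every line occurs once. *)
Definition lines_on n d e (f : quantic n d) (g : quantic n e) :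
    set {vspace 'rV[padic]_n} :=
  [set L | \dim L = 2%N /\
    forall v, v \in L -> form_eval f v = 0 /\ form_eval g v = 0].

End padic_int.

Arguments quantic {p} p_pr n d.

Section probability.
Context d (T : measurableType d) (R : realType) (P : probability T R).
Local Open Scope ereal_scope.

Definition independent_pair d1 d2 (T1 : measurableType d1)
    (T2 : measurableType d2) (X : {RV P >-> T1}) (Y : {RV P >-> T2}) : Prop :=
  forall A B, measurable A -> measurable B ->
    P (X @^-1` A `&` Y @^-1` B) = P (X @^-1` A) * P (Y @^-1` B).

Definition mutually_independent (I : choiceType) d1 (T1 : measurableType d1)
    (X : I -> {RV P >-> T1}) : Prop :=
  forall (J : {fset I}) (A : I -> set T1), (forall i, measurable (A i)) ->
    P (\bigcap_(i in [set` J]) X i @^-1` A i) =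
    \prod_(i <- J) P (X i @^-1` A i).

Context (p : nat) (p_pr : prime p).

(* A probability is the Haar measure of Z_p iff it is translation invariant;
   the normalization is part of the type. *)
Definition haar_probability (mu : probability (padic_int p_pr) R) : Prop :=
  forall (a : padic_int p_pr) (A : set (padic_int p_pr)),
    measurable A -> mu [set (a + x)%R | x in A] = mu A.

Definition padic_uniform (X : {RV P >-> padic_int p_pr}) : Prop :=
  haar_probability (distribution P X).

Definition coef_rv n e (f : {RV P >-> quantic p_pr n e}) (m : monomial n e) :
    {RV P >-> padic_int p_pr} :=
  [the {mfun T >-> padic_int p_pr} of form_coef m \o f].

(* homogeneity being built into quantic, only the i.i.d. coefficients remain *)
Definition uniform_form n e (f : {RV P >-> quantic p_pr n e}) : Prop :=
  (forall m, padic_uniform (coef_rv f m)) /\ mutually_independent (coef_rv f).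

End probability.

(* Main.v *)
From HB Require Import structures.
From mathcomp Require Import all_boot all_order all_algebra.
From mathcomp Require Import finmap perm.
From mathcomp Require Import -(notations) mpoly.
From mathcomp Require Import ring lra zify.
From mathcomp Require Import all_classical all_reals all_analysis
  measurable_realfun.
Require Import Defs.

(* A plane of Q_p^5 has a unique basis that is a reduced echelon 2 x 5 matrix
   over Z_p, whose pivot columns carry the lexicographically first 2 x 2 minor of
   maximal absolute value. The number of lines is therefore the increasing limit,
   as n grows, of the number of classes mod p^n of such matrices that contain a
   line of the intersection. The group GL_5(Z_p) acts on the two forms without changing
   their law, so that all these classes are hit with the same probability,
   namely the one that the two forms vanish on the row space of some matrix
   (1 | p^n Y). Up to quadratic terms this is an affine equation in Y whose
   linear part p^n J and constant term are independent, J being a random 6 x 6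
   matrix; as the quadratic terms can be absorbed in Y (Hensel), the probability
   is p^(-6n) (E|det J| + O(p^(-n))).
   Now det J = w1 w2 - w0 w3, where w is the vector of the maximal minors of a
   uniform 3 x 4 matrix. The mean over an orbit of GL_4 replaces |w0 w3 - w1 w2|
   by a multiple of |w3|^2, whatever the GL_4-invariant law of w; the multiple is
   found to be 1 by taking w uniform. Hence, with q = 1/p, E|det J| is the mean
   (1 - q)(1 - q^2) / ((1 - q^4)(1 - q^5)) of |det K|^2 for a uniform 3 x 3
   matrix K. This is the inverse of the volume
   1 + q + 2q^2 + 2q^3 + 2q^4 + q^5 + q^6 of the Grassmannian of planes, which
   is the number of classes mod p^n divided by p^(6n). *)

Set Implicit Arguments.
Unset Strict Implicit.
Unset Printing Implicit Defensive.
Import Order.TTheory GRing.Theory Num.Theory.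
Import numFieldNormedType.Exports.
Local Open Scope ring_scope.

(** * Means over finite types *)

Section average.
Context {F : realFieldType}.

(** No integral over Z_p is computed: every mean is an average over finitely many matrices over
    Z/p^m, and the forms enter only through residues of their coefficients, which are equally
    likely. The price is a truncated absolute value, multiplicative only up to q^m, whence
    identities with error terms. Two precisions are kept apart: n is the size of a class of planes,
    m the precision at which the equations are tested. For a fixed class m goes to infinity first,
    zeros modulo all powers of p giving a zero in Z_p by compactness; then n grows. The error for
    one class is relative to p^(-6n), so it survives summation over about p^(6n) classes. That E|det
    J| is computable rests on two facts. First, det J is an SL_3-invariant of a 3 x 4 matrix, which
    forces it to be a quadratic form in the maximal minors. Second, for uniform w the value w0 w3 -
    w1 w2 is a uniform 2 x 2 determinant, and its mean absolute value (1 - q)/(1 - q^2) times (1 -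
    q^2)/(1 - q^3) telescopes to the mean (1 - q)/(1 - q^3) of |w3|^2. *)

Definition avg (T : finType) (f : T -> F) : F := (\sum_x f x) / #|T|%:R.

Lemma eq_avg (T : finType) (f g : T -> F) : f =1 g -> avg f = avg g.
Proof. by move=> fg; congr (_ / _); apply: eq_bigr => x _. Qed.

Lemma avg_bij (T T' : finType) (h : T -> T') (f : T' -> F) :
  bijective h -> avg (fun x => f (h x)) = avg f.
Proof.
move=> hb; rewrite /avg (bij_eq_card hb) [in RHS](reindex h)//.
exact: onW_bij.
Qed.

Lemma avg_pair (T1 T2 : finType) (f : T1 -> T2 -> F) :
  avg (fun z : T1 * T2 => f z.1 z.2) = avg (fun x => avg (f x)).
Proof.
rewrite /avg card_prod natrM invfM mulrA (mulrAC _ _^-1) -pair_bigA mulr_suml.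
by rewrite mulr_suml; under eq_bigr do rewrite mulrAC.
Qed.

Lemma avg_swap (T1 T2 : finType) (f : T1 -> T2 -> F) :
  avg (fun x => avg (f x)) = avg (fun y => avg (fun x => f x y)).
Proof.
rewrite /avg -!mulr_suml exchange_big /=.
by rewrite -!mulrA (mulrC #|T1|%:R^-1).
Qed.

Lemma avg_cst (T : finType) (t : T) (c : F) : avg (fun _ : T => c) = c.
Proof.
rewrite /avg sumr_const -[c *+ _]mulr_natr -mulrA divff ?mulr1//.
rewrite pnatr_eq0 -lt0n.
by apply/card_gt0P; exists t.
Qed.

Lemma avgD (T : finType) (f g : T -> F) :
  avg (fun x => f x + g x) = avg f + avg g.
Proof. by rewrite /avg big_split/= mulrDl. Qed.

Lemma avgN (T : finType) (f : T -> F) : avg (fun x => - f x) = - avg f.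
Proof. by rewrite /avg sumrN mulNr. Qed.

Lemma avgB (T : finType) (f g : T -> F) :
  avg (fun x => f x - g x) = avg f - avg g.
Proof. by rewrite avgD avgN. Qed.

Lemma avgMr (T : finType) (f : T -> F) c : avg (fun x => f x * c) = avg f * c.
Proof. by rewrite /avg -mulr_suml mulrAC. Qed.

Lemma avgMl (T : finType) (f : T -> F) c : avg (fun x => c * f x) = c * avg f.
Proof. by rewrite /avg -mulr_sumr mulrA. Qed.

Lemma avg_sumn (T : finType) (n : nat) (f : nat -> T -> F) :
  avg (fun x => \sum_(i < n) f i x) = \sum_(i < n) avg (f i).
Proof. by rewrite /avg exchange_big /= mulr_suml. Qed.

Lemma le_avg (T : finType) (f g : T -> F) :
  (forall x, f x <= g x) -> avg f <= avg g.
Proof. by move=> fg; rewrite ler_wpM2r ?invr_ge0 ?ler0n// ler_sum. Qed.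

Lemma avg_ge0 (T : finType) (f : T -> F) : (forall x, 0 <= f x) -> 0 <= avg f.
Proof. by move=> f0; rewrite divr_ge0 ?ler0n// sumr_ge0. Qed.

Lemma avg_dist (T : finType) (f g : T -> F) e : 0 <= e ->
  (forall x, `|f x - g x| <= e) -> `|avg f - avg g| <= e.
Proof.
move=> e0 fg; rewrite -avgB (le_trans (y := avg (fun _ : T => e)))//.
  rewrite /avg normrM normfV normr_nat ler_wpM2r ?invr_ge0 ?ler0n//.
  by rewrite (le_trans (ler_norm_sum _ _ _))// ler_sum.
(* For empty T the mean of the constant e is 0, not e, and [0 <= e] is used. *)
have [/eqP T0|] := posnP #|T|; last by case/card_gt0P => t _; rewrite avg_cst.
by rewrite /avg (eqP T0) invr0 mulr0.
Qed.

Lemma avg_le1 (T : finType) (f : T -> F) : (forall x, f x <= 1) -> avg f <= 1.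
Proof.
move=> f1; have [/eqP T0|] := posnP #|T|.
  by rewrite /avg (eqP T0) invr0 mulr0.
by case/card_gt0P => t _; rewrite -[leRHS](avg_cst t) le_avg.
Qed.

Lemma avg_indic (T : finType) (A : pred T) :
  avg (fun x => (A x)%:R) = #|A|%:R / #|T|%:R.
Proof.
rewrite /avg -sum1_card natr_sum [in RHS]big_mkcond; congr (_ / _).
by apply: eq_bigr => x _; rewrite unfold_in; case: (A x).
Qed.

End average.

(** * Valuation on Z/p^m *)

Section Zpm.
Context (p : nat) (p_pr : prime p) (m : nat) (m_gt0 : (0 < m)%N).
Local Notation R := 'Z_(p ^ m).
Implicit Types x y : R.

Lemma Zpm_gt1 : (1 < p ^ m)%N.
Proof. by rewrite -(expn0 p) ltn_exp2l ?prime_gt1. Qed.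

Lemma card_Zpm : #|R| = (p ^ m)%N.
Proof. by rewrite card_ord Zp_cast// Zpm_gt1. Qed.

(* The p-adic valuation, truncated: [vz 0 = m]. *)
Definition vz (x : R) : nat := logn p (gcdn x (p ^ m)).

Lemma vz_nat (a : nat) : vz a%:R = logn p (gcdn a (p ^ m)).
Proof. by rewrite /vz val_Zp_nat ?Zpm_gt1// gcdn_modl. Qed.

Lemma gcd_exp (a : nat) : (0 < a)%N ->
  logn p (gcdn a (p ^ m)) = minn (logn p a) m.
Proof.
move=> a0; rewrite logn_gcd//; last by rewrite expn_gt0 prime_gt0.
by rewrite pfactorK.
Qed.

Lemma vz_le x : (vz x <= m)%N.
Proof.
rewrite /vz; have [->|] := posnP x; first by rewrite gcd0n pfactorK.
by move=> /gcd_exp->; rewrite geq_minr.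
Qed.

Lemma vzM x y : vz (x * y) = minn (vz x + vz y) m.
Proof.
have -> : x * y = (x * y)%N%:R by rewrite natrM !natr_Zp.
rewrite vz_nat; have [x0|x0] := posnP x.
  have -> : vz x = m by rewrite /vz x0 gcd0n pfactorK.
  by rewrite x0 mul0n gcd0n pfactorK//; lia.
have [y0|y0] := posnP y.
  have -> : vz y = m by rewrite /vz y0 gcd0n pfactorK.
  by rewrite y0 muln0 gcd0n pfactorK//; lia.
rewrite gcd_exp ?muln_gt0 ?x0// lognM// /vz !gcd_exp//.
by move: (logn p x) (logn p y) => a b; lia.
Qed.

Lemma vz_eq0 x : (vz x == 0%N) = (x \is a GRing.unit).
Proof.
rewrite -[x]natr_Zp unitZpE ?Zpm_gt1// vz_nat coprime_pexpl//.
have [->|x0] := posnP x.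
  by rewrite gcd0n pfactorK// gtn_eqF// /coprime gcdn0 gtn_eqF// prime_gt1.
rewrite gcd_exp// prime_coprime// -[p in (p %| _)%N]expn1 pfactor_dvdn//.
by rewrite -eqn0Ngt; apply/eqP/eqP; lia.
Qed.

Lemma vz_pX t : vz (p%:R ^+ t) = minn t m.
Proof.
by rewrite -natrX vz_nat gcd_exp ?expn_gt0 ?prime_gt0// pfactorK.
Qed.

Lemma vzP x : exists2 u : R, u \is a GRing.unit & x = p%:R ^+ (vz x) * u.
Proof.
have [x0|x0] := posnP x.
  exists 1; rewrite ?unitr1// mulr1 [vz x](_ : _ = m).
    by rewrite -natrX pchar_Zp ?Zpm_gt1//; apply/val_inj.
  by rewrite /vz x0 gcd0n pfactorK.
have xpm : (x < p ^ m)%N by rewrite -[X in (_ < X)%N]Zp_cast ?Zpm_gt1.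
have lx : (logn p x < m)%N.
  by rewrite -(ltn_exp2l _ _ (prime_gt1 p_pr)) (leq_ltn_trans _ xpm)// dvdn_leq// pfactor_dvdnn.
have [k kp xk] := pfactor_coprime p_pr x0.
exists k%:R.
  by rewrite unitZpE ?Zpm_gt1// coprime_pexpl.
rewrite /vz gcd_exp// (minn_idPl (ltnW lx)) -natrX -natrM mulnC -xk.
by rewrite natr_Zp.
Qed.

Lemma vz_unitMl (u x : R) : u \is a GRing.unit -> vz (u * x) = vz x.
Proof.
by rewrite -vz_eq0 => /eqP u0; rewrite vzM u0 add0n; apply/minn_idPl/vz_le.
Qed.

Lemma dvd_vz t x : (t <= m)%N ->
  [exists y : R, x == p%:R ^+ t * y] = (t <= vz x)%N.
Proof.
move=> tm; apply/existsP/idP => [[y /eqP->]|tx].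
  by rewrite vzM vz_pX; lia.
have [u _ ->] := vzP x.
by exists (p%:R ^+ (vz x - t) * u); rewrite mulrA -exprD subnKC.
Qed.

Lemma pXm0 : p%:R ^+ m = 0 :> R.
Proof. by rewrite -natrX pchar_Zp ?Zpm_gt1. Qed.

Lemma card_dvd t : (t <= m)%N ->
  #|[pred x : R | (t <= vz x)%N]| = (p ^ (m - t))%N.
Proof.
move=> tm.
have nt : (p ^ m = p ^ t * p ^ (m - t))%N by rewrite -expnD subnKC.
have pt0 : (0 < p ^ t)%N by rewrite expn_gt0 prime_gt0.
pose h (i : 'I_(p ^ (m - t))) : R := (p ^ t * i)%:R.
have vh i : val (h i) = (p ^ t * i)%N.
  by rewrite /h [LHS]val_Zp_nat ?Zpm_gt1// modn_small// nt ltn_pmul2l.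
rewrite -[RHS]card_ord -(@card_imset _ _ h); last first.
  move=> i j /(congr1 val); rewrite !vh => /eqP.
  by rewrite eqn_pmul2l// => /eqP ij; apply/val_inj.
apply: eq_card => x; rewrite !inE -dvd_vz//; apply/existsP/imsetP.
  move=> [y /eqP xy].
  have yl : (y %% p ^ (m - t) < p ^ (m - t))%N by rewrite ltn_mod expn_gt0 prime_gt0.
  exists (Ordinal yl) => //; apply/val_inj; rewrite vh/= xy.
  rewrite -[y in LHS]natr_Zp -natrX -natrM [LHS]val_Zp_nat ?Zpm_gt1//.
  by rewrite muln_modr -nt.
by move=> [i _ ->]; exists (i : nat)%:R; rewrite /h natrM natrX.
Qed.

End Zpm.

Section matrix_bijections.
Context (R : Type).

Lemma row_mx_bij a b c :
  bijective (fun z : 'M[R]_(a, b) * 'M[R]_(a, c) => row_mx z.1 z.2).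
Proof.
exists (fun A : 'M[_]_(a, b + c) => (lsubmx A, rsubmx A)) => [[x y]|x] /=.
  by rewrite row_mxKl row_mxKr.
by rewrite hsubmxK.
Qed.

Lemma col_mx_bij a b c :
  bijective (fun z : 'M[R]_(a, c) * 'M[R]_(b, c) => col_mx z.1 z.2).
Proof.
exists (fun A : 'M[_]_(a + b, c) => (usubmx A, dsubmx A)) => [[x y]|x] /=.
  by rewrite col_mxKu col_mxKd.
by rewrite vsubmxK.
Qed.

End matrix_bijections.

Lemma mulmx_bij (R : comUnitRingType) k l (g : 'M[R]_k) : g \in unitmx ->
  bijective (fun A : 'M[R]_(k, l) => g *m A).
Proof. by move=> gu; exists (mulmx (invmx g)) => A; rewrite ?mulKmx ?mulKVmx. Qed.

Lemma mulmxr_bij (R : comUnitRingType) k l (g : 'M[R]_k) : g \in unitmx ->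
  bijective (fun A : 'M[R]_(l, k) => A *m g).
Proof.
by move=> gu; exists (mulmxr (invmx g)) => A /=; rewrite ?mulmxK ?mulmxKV.
Qed.

Section unimodular_orbits.
Context {F : realFieldType} (p : nat) (p_pr : prime p) (m : nat)
  (m_gt0 : (0 < m)%N).
Local Notation R := 'Z_(p ^ m).
Local Notation q := (p%:R^-1 : F).
Local Notation vz := (@vz p m).

Lemma q_gt0 : 0 < q.
Proof. by rewrite invr_gt0 ltr0n prime_gt0. Qed.

Lemma q_le_half : q <= 2^-1.
Proof. by rewrite lef_pV2 ?posrE ?ltr0n ?prime_gt0// ler_nat prime_gt1. Qed.

Lemma q_lt1 : q < 1.
Proof. by rewrite (le_lt_trans q_le_half)//; lra. Qed.

Lemma qX_gt0 n : 0 < q ^+ n. Proof. by rewrite exprn_gt0// q_gt0. Qed.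

Lemma qX_le1 n : q ^+ n <= 1.
Proof. by rewrite exprn_ile1// ?ltW ?q_gt0 ?q_lt1. Qed.

Lemma qX_le a b : (a <= b)%N -> q ^+ b <= q ^+ a.
Proof. by move=> ab; rewrite ler_wiXn2l// ?ltW ?q_gt0 ?q_lt1. Qed.

(* [zabs 0] is [q ^+ m], not 0. *)
Definition zabs (x : R) : F := q ^+ vz x.

Lemma zabs_ge0 x : 0 <= zabs x. Proof. exact/ltW/qX_gt0. Qed.

Lemma zabs_unitMl (u x : R) : u \is a GRing.unit -> zabs (u * x) = zabs x.
Proof. by move=> uu; rewrite /zabs vz_unitMl. Qed.

Lemma zabs_unit (u : R) : u \is a GRing.unit -> zabs u = 1.
Proof. by rewrite -(vz_eq0 p_pr m_gt0) /zabs => /eqP ->; rewrite expr0. Qed.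

Lemma zabsN x : zabs (- x) = zabs x.
Proof. by rewrite -mulN1r zabs_unitMl// unitrN1. Qed.

(** Below the truncation the two terms agree; beyond it both are at most q^m. This failure of
    multiplicativity is the main source of the errors [q ^+ m]. *)
Lemma zabs_pXM t (x : R) : `|zabs (p%:R ^+ t * x) - q ^+ t * zabs x| <= q ^+ m.
Proof.
rewrite /zabs (vzM p_pr m_gt0) (vz_pX p_pr m_gt0) -exprD.
have [tm|tm] := leqP (t + vz x) m.
  have -> : minn (minn t m + vz x) m = (t + vz x)%N by lia.
  by rewrite subrr normr0 ltW ?qX_gt0.
have -> : minn (minn t m + vz x) m = m by lia.
have h := qX_le (ltnW tm); have h0 := qX_gt0 (t + vz x).
by rewrite ger0_norm; lra.
Qed.

Section orbit.
Context (k : nat).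
Local Notation cV := ('cV[R]_k.+1).
Implicit Type w : cV.

Definition content w : nat := vz (w [arg min_(i < ord0) vz (w i 0%R)] 0).

Lemma content_le w i : (content w <= vz (w i 0%R))%N.
Proof. by rewrite /content; case: arg_minnP => // j _; exact. Qed.

Lemma le_contentP w j : (j <= content w)%N = [forall i, (j <= vz (w i 0%R))%N].
Proof.
apply/idP/forallP => [jw i|]; last exact.
exact: leq_trans jw (content_le w i).
Qed.

Definition e0 : cV := delta_mx 0 0.

(** Dividing w by p^t, t its content, leaves a vector with a unit u at i0, and the identity with
    column i0 replaced by that vector has determinant u. Hence the content is a complete invariant
    of GL-orbits. *)
Lemma content_orbit w :
  exists2 g : 'M[R]_k.+1, g \in unitmx & w = p%:R ^+ content w *: (g *m e0).
Proof.
rewrite /content; case: arg_minnP => // i0 _ /(_ _ isT) wmin.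
set t := vz _.
have [u uu wi0] := vzP p_pr m_gt0 (w i0 0).
have /fin_all_exists[f wf] (i : 'I_k.+1) : exists y : R, w i 0 = p%:R ^+ t * y.
  have := wmin i; rewrite -/t -(dvd_vz p_pr m_gt0) ?(vz_le p_pr)//.
  by move=> /existsP[y /eqP]; exists y.
(* For w = 0 the quotients [f i] are arbitrary, so the unit [u] is put at i0 to keep v
   unimodular. *)
pose v : cV := \col_i (if i == i0 then u else f i).
have -> : w = p%:R ^+ t *: v.
  apply/matrixP => i j; rewrite (ord1 j) !mxE; case: eqP => [->|_]; first exact: wi0.
  exact: wf.
pose A : 'M[R]_k.+1 := \matrix_(i, j) (if j == i0 then v i 0 else (i == j)%:R).
have detA : \det A = u.
  rewrite (expand_det_row _ i0) (bigD1 i0)//= big1 ?addr0 => [|j ji0]; last first.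
    by rewrite !mxE (negbTE ji0) eq_sym (negbTE ji0) mul0r.
  rewrite !mxE !eqxx /cofactor -signr_odd addnn odd_double mul1r.
  rewrite (_ : row' _ _ = 1%:M) ?det1 ?mulr1//.
  apply/matrixP => i j; rewrite !mxE eq_sym (negbTE (neq_lift _ _)).
  by rewrite (inj_eq lift_inj).
exists (A *m tperm_mx 0 i0).
  by rewrite unitmx_mul unitmxE detA uu unitmx_perm.
congr (_ *: _); apply/matrixP => i j; rewrite (ord1 j) -mulmxA.
rewrite (_ : tperm_mx 0 i0 *m e0 = delta_mx i0 0); last first.
  apply/matrixP => a b; rewrite (ord1 b) -colE !mxE eqxx andbT.
  by rewrite (can2_eq (tpermK _ _) (tpermK _ _)) tpermL.
rewrite -colE !mxE.
by rewrite eqxx.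
Qed.

End orbit.
End unimodular_orbits.

(** * Means over GL_k and determinants *)

Section group_average.
Context {F : realFieldType} (p : nat) (p_pr : prime p) (m : nat)
  (m_gt0 : (0 < m)%N).
Local Notation R := 'Z_(p ^ m).
Local Notation q := (p%:R^-1 : F).
Local Notation zabs := (@zabs F p m).

Definition GLtype k := {h : 'M[R]_k.+1 | h \in unitmx}.

Lemma GLtype1 k : GLtype k. Proof. by exists 1%:M; exact: unitmx1. Qed.

Definition orbit_mean k (phi : 'cV[R]_k.+1 -> F) : F :=
  avg (fun h : GLtype k => phi (val h *m e0 p m k)).

(* W is p^t times a vector of the orbit of e0, t being its content: averaging
   over GL makes the factor q^(s t) of phi (W) separate. *)
Lemma avg_radial k s (phi : 'cV[R]_k.+1 -> F) (X : finType)
    (W : X -> 'cV[R]_k.+1) :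
  (forall t w, `|phi (p%:R ^+ t *: w) - q ^+ (s * t) * phi w| <= q ^+ m) ->
  (forall h : 'M[R]_k.+1, h \in unitmx ->
     avg (fun x => phi (h *m W x)) = avg (fun x => phi (W x))) ->
  `|avg (fun x => phi (W x)) -
    avg (fun x => q ^+ (s * content (W x))) * orbit_mean phi| <= q ^+ m.
Proof.
move=> homog inv.
have -> : avg (fun x => phi (W x)) =
    avg (fun x => avg (fun h : GLtype k => phi (val h *m W x))).
  rewrite avg_swap -[LHS](avg_cst (GLtype1 k)); apply: eq_avg => h.
  by rewrite inv// (valP h).
rewrite -avgMr; apply: avg_dist => [|x]; first exact/ltW/qX_gt0.
have [g gu Wx] := content_orbit p_pr m_gt0 (W x).
set t := content _.
rewrite /orbit_mean -avgMl.
have hgb : bijective (fun h : GLtype k => (exist _ (val h *m g)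
    (etrans (unitmx_mul _ _) (introT andP (conj (valP h) gu))) : GLtype k)).
  have gVu : invmx g \in unitmx by rewrite unitmx_inv.
  exists (fun h : GLtype k => (exist _ (val h *m invmx g)
    (etrans (unitmx_mul _ _) (introT andP (conj (valP h) gVu))) : GLtype k)) => h.
    by apply/val_inj; rewrite /= mulmxK.
  by apply/val_inj; rewrite /= mulmxKV.
rewrite -(avg_bij (fun h : GLtype k => _ * phi (val h *m e0 p m k)) hgb)/=.
apply: avg_dist => [|h]; first exact/ltW/qX_gt0.
by rewrite [in phi (_ *m W x)]Wx -scalemxAr mulmxA.
Qed.

Definition det_mean s k : F := avg (fun K : 'M[R]_k => zabs (\det K ^+ s)).

Definition content_mean s k : F :=
  avg (fun v : 'cV[R]_k.+1 => q ^+ (s * content v)).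

Lemma det_mean0 s : det_mean s 0 = 1.
Proof.
rewrite /det_mean -[RHS](avg_cst (0 : 'M[R]_0)); apply: eq_avg => K.
by rewrite det_mx00 expr1n zabs_unit// unitr1.
Qed.

(** The first column is p^t g e0, t being its content. Multiplying by the inverse of g keeps the
    other columns uniform and makes the matrix block triangular with corner p^t, so that q^(s t)
    separates from the determinant of a uniform k x k block. *)
Lemma det_meanS s k :
  `|det_mean s k.+1 - content_mean s k * det_mean s k| <= q ^+ m.
Proof.
rewrite /det_mean -(avg_bij _ (row_mx_bij R k.+1 1 k))/=.
rewrite (avg_pair (fun (v : 'cV[R]_k.+1) K => zabs (\det (row_mx v K : 'M[_]_(1 + k)) ^+ s))).
rewrite -avgMr; apply: avg_dist => [|v]; first exact/ltW/qX_gt0.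
have [g gu vE] := content_orbit p_pr m_gt0 v.
set t := content v in vE *.
have -> : avg (fun K : 'M[_]_(k.+1, k) => zabs (\det (row_mx v K : 'M[_]_(1 + k)) ^+ s)) =
    avg (fun K : 'M[R]_k => zabs (p%:R ^+ (s * t) * \det K ^+ s)).
  rewrite -(avg_bij _ (mulmx_bij k gu)) -(avg_bij _ (col_mx_bij R 1 k k))/=.
  rewrite (avg_pair (fun (r : 'rV_k) K => zabs (\det (row_mx v (g *m col_mx r K) : 'M[_]_(1 + k)) ^+ s))).
  rewrite -[RHS](avg_cst (0 : 'rV[R]_k)); apply: eq_avg => r; apply: eq_avg => K.
  have -> : row_mx v (g *m col_mx r K) =
      g *m (block_mx ((p%:R ^+ t)%:M : 'M[_]_1) r 0 K : 'M[_]_(1 + k)).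
    rewrite vE scalemxAr -mul_mx_row; congr (_ *m _).
    rewrite block_mxEh; congr row_mx; apply/matrixP => i j.
    rewrite (ord1 j) [RHS]mxE; case: splitP => i' ii'.
      rewrite !mxE (ord1 i') mulr1n.
      by rewrite (_ : i = 0) ?eqxx ?mulr1//; apply/val_inj; rewrite /= ii' (ord1 i').
    rewrite !mxE (_ : (i == 0) = false) ?mulr0//.
    by apply/negbTE/eqP => i0; rewrite i0 in ii'.
  rewrite det_mulmx det_ublock det_scalar1 !exprMn -exprM (mulnC t).
  by rewrite zabs_unitMl// unitrX// -unitmxE.
rewrite -avgMl; apply: avg_dist => [|K]; first exact/ltW/qX_gt0.
exact: zabs_pXM.
Qed.

End group_average.

Section content_mean.
Context {F : realFieldType} (p : nat) (p_pr : prime p) (m : nat)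
  (m_gt0 : (0 < m)%N).
Local Notation R := 'Z_(p ^ m).
Local Notation q := (p%:R^-1 : F).

Lemma avg_dvd_cV k j : (j <= m)%N ->
  avg (fun v : 'cV[R]_k => ([forall i, (j <= vz (v i 0%R))%N])%:R : F) =
  q ^+ (k * j).
Proof.
move=> jm.
pose h (f : {ffun 'I_k -> R}) : 'cV[R]_k := \col_i f i.
have hb : bijective h.
  by exists (fun v : 'cV[R]_k => [ffun i => v i 0]) => [f|v];
    [apply/ffunP => i; rewrite ffunE mxE
    |apply/matrixP => i i'; rewrite mxE ffunE (ord1 i')].
rewrite -(avg_bij _ hb) avg_indic.
have -> : #|[pred f | [forall i, (j <= vz (h f i 0%R))%N]]| =
    (#|[pred x : R | (j <= vz x)%N]| ^ k)%N.
  rewrite -[in RHS](card_ord k) -card_ffun_on; apply: eq_card => f.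
  by rewrite !inE; apply: eq_forallb => i; rewrite mxE.
rewrite card_dvd// card_ffun card_Zpm// card_ord !natrX -!exprM.
have p0 : p%:R != 0 :> F by rewrite pnatr_eq0 -lt0n prime_gt0.
rewrite exprVn -[in RHS](mulKf (expf_neq0 (m * k) p0) (_ ^- _)).
rewrite mulrC; congr (_ * _).
rewrite -[in RHS](subnK jm) mulnDl exprD (mulnC k) mulfK ?expf_neq0//.
Qed.

(** Summation by parts: the mean is expressed by the probabilities that the content exceeds j, which
    factor over the coordinates. *)
Lemma content_meanE s k : @content_mean F p m s k =
  1 - \sum_(j < m) (q ^+ (s * j) - q ^+ (s * j.+1)) * q ^+ (k.+1 * j.+1).
Proof.
have H (c : nat) : (c <= m)%N -> q ^+ (s * c) =
    1 - \sum_(j < m) (q ^+ (s * j) - q ^+ (s * j.+1)) * (j.+1 <= c)%N%:R.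
  move=> cm.
  have -> : \sum_(j < m) (q ^+ (s * j) - q ^+ (s * j.+1)) * (j < c)%N%:R =
      \sum_(j < c) (q ^+ (s * j) - q ^+ (s * j.+1)).
    rewrite (big_ord_widen_cond _ xpredT (fun j => q ^+ (s * j) - q ^+ (s * j.+1)) cm).
    rewrite [RHS]big_mkcond; apply: eq_bigr => j _.
    by case: (j < c)%N; rewrite ?mulr1 ?mulr0.
  elim: c {cm} => [|c IH]; first by rewrite big_ord0 muln0 expr0 subr0.
  by rewrite big_ord_recr/= opprD addrA -IH; ring.
transitivity (avg (fun v : 'cV[R]_k.+1 => 1 - \sum_(j < m)
    (q ^+ (s * j) - q ^+ (s * j.+1)) * ([forall i, (j.+1 <= vz (v i 0%R))%N])%:R)).
  apply: eq_avg => v; rewrite H; last by rewrite /content vz_le.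
  by congr (_ - _); apply: eq_bigr => j _; rewrite le_contentP.
rewrite avgB (avg_cst (0 : 'cV_k.+1)); congr (_ - _).
rewrite (avg_sumn _ (fun j (v : 'cV[R]_k.+1) => (q ^+ (s * j) - q ^+ (s * j.+1)) *
  ([forall i, (j < vz (v i 0%R))%N])%:R)).
by apply: eq_bigr => j _; rewrite avgMl avg_dvd_cV.
Qed.

Let x_lt1 s k : 1 - q ^+ (k.+1 + s) >= 2^-1.
Proof.
have : q ^+ (k.+1 + s) <= q ^+ 1 by apply: qX_le.
by have := @q_le_half F p p_pr; rewrite expr1; lra.
Qed.

(** The sum in [content_meanE] is geometric. The first term is the mean of |v|^s for the maximum
    norm on Z_p^(k+1), the second the effect of truncating at m. *)
Lemma content_mean_closed s k : @content_mean F p m s k =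
  (1 - q ^+ k.+1) / (1 - q ^+ (k.+1 + s)) +
  (1 - q ^+ s) * q ^+ k.+1 / (1 - q ^+ (k.+1 + s)) * q ^+ (k.+1 + s) ^+ m.
Proof.
have x1 : 1 - q ^+ (k.+1 + s) != 0 by rewrite gt_eqF//; have := x_lt1 s k; lra.
rewrite content_meanE.
have -> : \sum_(j < m) (q ^+ (s * j) - q ^+ (s * j.+1)) * q ^+ (k.+1 * j.+1) =
    (1 - q ^+ s) * q ^+ k.+1 * \sum_(j < m) q ^+ (k.+1 + s) ^+ j.
  rewrite mulr_sumr; apply: eq_bigr => j _.
  by rewrite -!exprM mulnDl !mulnS !exprD; ring.
have -> : \sum_(j < m) q ^+ (k.+1 + s) ^+ j =
    (1 - q ^+ (k.+1 + s) ^+ m) / (1 - q ^+ (k.+1 + s)).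
  apply: (mulIf x1); rewrite mulfVK// -[1 - _ ^+ m]opprB subrX1 -mulNr opprB mulrC.
  by [].
move: (_ ^+ m) => y; move: x1; rewrite exprD.
by move: (q ^+ k.+1) (q ^+ s) => a b x1; field.
Qed.

Lemma content_mean_approx s k :
  `|@content_mean F p m s k - (1 - q ^+ k.+1) / (1 - q ^+ (k.+1 + s))| <=
  2 * q ^+ m.
Proof.
rewrite content_mean_closed addrC addKr.
have xm : q ^+ (k.+1 + s) ^+ m <= q ^+ m.
  by rewrite -exprM qX_le// leq_pmull// addSn.
have := x_lt1 s k.
set y := 1 - q ^+ (k.+1 + s) => hy.
have y0 : 0 < y by lra.
have x0 : 0 <= q ^+ (k.+1 + s) ^+ m by rewrite exprn_ge0// ltW ?qX_gt0.
have hs := @qX_le1 F p p_pr s; have hs0 := @qX_gt0 F p p_pr s.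
have hk := @qX_le1 F p p_pr k.+1; have hk0 := @qX_gt0 F p p_pr k.+1.
have yV : y^-1 <= 2 by rewrite -[2]invrK lef_pV2 ?posrE//; lra.
have yV0 : 0 < y^-1 by rewrite invr_gt0.
move: (q ^+ s) (q ^+ k.+1) hs hs0 hk hk0 => a b ? ? ? ?.
have ab0 : 0 <= (1 - a) * b by rewrite mulr_ge0//; lra.
have ab1 : (1 - a) * b <= 1 by rewrite mulr_ile1//; lra.
have aby : 0 <= (1 - a) * b * y^-1 by rewrite mulr_ge0// ltW.
rewrite ger0_norm; last exact: mulr_ge0.
by rewrite ler_pM// -[2]mul1r ler_pM// ltW.
Qed.

End content_mean.

Section approx.
Context {F : realFieldType} (p : nat) (p_pr : prime p).
Local Notation q := (p%:R^-1 : F).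

Definition approx (a : nat -> F) (l : F) : Prop :=
  exists2 C, 0 <= C & forall m, (0 < m)%N -> `|a m - l| <= C * q ^+ m.

Lemma approx_trans (a b : nat -> F) l C : 0 <= C ->
  (forall m, (0 < m)%N -> `|a m - b m| <= C * q ^+ m) -> approx b l -> approx a l.
Proof.
move=> C0 ab [D D0 bl]; exists (C + D); first exact: addr_ge0.
move=> m m0; rewrite mulrDl (le_trans _ (lerD (ab m m0) (bl m m0)))//.
by rewrite (le_trans _ (ler_normD _ _))// addrA subrK.
Qed.

Lemma approxM (a b : nat -> F) k l : approx a k -> approx b l ->
  approx (fun m => a m * b m) (k * l).
Proof.
move=> [C C0 ak] [D D0 bl]; exists ((C + `|k|) * D + C * `|l|).
  by rewrite addr_ge0// mulr_ge0// addr_ge0.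
move=> m m0; have q0 := @qX_gt0 F p p_pr m.
have -> : a m * b m - k * l = a m * (b m - l) + (a m - k) * l by ring.
rewrite (le_trans (ler_normD _ _))// !normrM mulrDl lerD//; last first.
  by rewrite mulrAC ler_wpM2r// ak.
rewrite -mulrA ler_pM// ?bl// -[a m](subrK k).
rewrite (le_trans (ler_normD _ _))// lerD// (le_trans (ak _ m0))//.
by rewrite ler_piMr// qX_le1.
Qed.

Lemma content_mean_lim s k :
  approx (fun m => @content_mean F p m s k)
    ((1 - q ^+ k.+1) / (1 - q ^+ (k.+1 + s))).
Proof. by exists 2 => // m m0; exact: content_mean_approx. Qed.

(** The product is Igusa's local zeta function of the determinant, one factor for each step of
    [det_meanS]. *)
Lemma det_mean_lim s k : approx (fun m => @det_mean F p m s k)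
  (\prod_(i < k) ((1 - q ^+ i.+1) / (1 - q ^+ (i.+1 + s)))).
Proof.
elim: k => [|k IH].
  rewrite big_ord0; exists 0 => // m m0.
  by rewrite det_mean0// subrr normr0 mul0r.
rewrite big_ord_recr/= mulrC.
apply: (approx_trans ler01 _ (approxM (content_mean_lim s k) IH)) => m m0.
by rewrite mul1r det_meanS.
Qed.

End approx.

(** * Maximal minors and the quadratic form w0 w3 - w1 w2 *)

Section maximal_minors.
Context (R : comPzRingType).

(** The generalized cross product of the rows of T: the cofactors of a row appended to T, signs
    included, so that [mul_minors] holds without further signs. *)
Definition minors k (T : 'M[R]_(k, k + 1)) : 'cV[R]_(k + 1) :=
  \col_i \det (col_mx T (delta_mx 0 i)).

Lemma mul_minors k (T : 'M[R]_(k, k + 1)) (y : 'rV[R]_(k + 1)) :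
  y *m minors T = (\det (col_mx T y))%:M.
Proof.
apply/matrixP => i j; rewrite !ord1 !mxE mulr1n.
rewrite (expand_det_row _ (rshift k 0)).
apply: eq_bigr => l _; rewrite col_mxEd mxE; congr (_ * _).
rewrite (expand_det_row _ (rshift k 0)) (bigD1 l)//= big1 ?addr0 => [|l' ll'].
  rewrite col_mxEd mxE !eqxx mul1r /cofactor; congr (_ * \det _).
  apply/matrixP => a b; rewrite !mxE; case: splitP => a' /=.
    by [].
  have ak : (a < k)%N by rewrite (leq_trans (ltn_ord a))// addn1.
  by rewrite /bump addn0 leqNgt ak add0n => e; move: ak; rewrite e -ltn_subRL subnn.
by rewrite col_mxEd mxE (negbTE ll') andbF mul0r.
Qed.

(** Both sides agree after pairing with any row y, since appending y h to T h multiplies the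
    determinant of T with y appended by det h. For invertible h this makes the law of the minors of
    a uniform T invariant under h, up to units. *)
Lemma minors_mulmx k (T : 'M[R]_(k, k + 1)) (h : 'M[R]_(k + 1)) :
  h *m minors (T *m h) = \det h *: minors T.
Proof.
apply/row_matrixP => i; rewrite row_mul mul_minors.
have -> : row i h = delta_mx 0 i *m h by rewrite -rowE.
rewrite -mul_col_mx det_mulmx mulrC rowE linearZ/= mul_minors.
by rewrite scale_scalar_mx.
Qed.

Lemma minors_row_mx k (K : 'M[R]_k) (t : 'cV[R]_k) :
  minors (row_mx K t) (rshift k 0) 0 = \det K.
Proof.
rewrite mxE (_ : delta_mx 0 (rshift k 0) = row_mx 0 1%:M :> 'rV_(k + 1)).
  by rewrite -/(block_mx K t 0 1%:M) det_ublock det1 mulr1.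
apply/matrixP => i j; rewrite !mxE (ord1 i) eqxx/=.
case: splitP => l jl; rewrite !mxE; last first.
  by rewrite !ord1 (_ : j = rshift k 0) ?eqxx//; apply/val_inj; rewrite /= jl (ord1 l).
by rewrite -val_eqE /= jl addn0 (ltn_eqF (ltn_ord l)).
Qed.

End maximal_minors.

Lemma det_mx22 (R : comPzRingType) (A : 'M[R]_2) :
  \det A = A 0 0 * A 1 1 - A 0 1 * A 1 0.
Proof.
rewrite (expand_det_row _ 0) !big_ord_recl big_ord0 addr0 /cofactor !det_mx11 !mxE.
rewrite /= expr0 mul1r expr1 mulN1r mulrN.
by congr (_ * A _ _ - A _ _ * A _ _); apply/val_inj.
Qed.

Definition ix (i : nat) : 'I_(3 + 1) := inord i.

Lemma ixK i : (i < 4)%N -> ix i = i :> nat.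
Proof. by move=> i4; rewrite /ix [LHS]inordK. Qed.

(** The determinant of the 2 x 2 matrix with rows (w0, w1) and (w2, w3). *)
Definition quad (R : comPzRingType) (w : 'cV[R]_(3 + 1)) : R :=
  w (ix 0) 0 * w (ix 3) 0 - w (ix 1) 0 * w (ix 2) 0.

Lemma quad_scale (R : comPzRingType) (a : R) w : quad (a *: w) = a ^+ 2 * quad w.
Proof. by rewrite /quad !mxE; ring. Qed.

Section pfaffian.
Context {F : realFieldType} (p : nat) (p_pr : prime p) (m : nat)
  (m_gt0 : (0 < m)%N).
Local Notation R := 'Z_(p ^ m).
Local Notation q := (p%:R^-1 : F).
Local Notation zabs := (@zabs F p m).

Lemma avg_minors_inv (phi : 'cV[R]_(3 + 1) -> F) (h : 'M[R]_(3 + 1)) :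
  (forall u w, u \is a GRing.unit -> phi (u *: w) = phi w) -> h \in unitmx ->
  avg (fun T : 'M[R]_(3, 3 + 1) => phi (h *m minors T)) =
  avg (fun T => phi (minors T)).
Proof.
move=> phiu hu.
rewrite -(avg_bij (fun T : 'M[R]_(3, 3 + 1) => phi (h *m minors T))
  (mulmxr_bij 3 hu)).
by apply: eq_avg => T; rewrite minors_mulmx phiu// -unitmxE.
Qed.

Lemma avg_quad :
  avg (fun w : 'cV[R]_(3 + 1) => zabs (quad w)) = @det_mean F p m 1 2.
Proof.
pose h (A : 'M[R]_2) : 'cV[R]_(3 + 1) := \col_i A (inord (i %/ 2)) (inord (i %% 2)).
have hE A (i j : 'I_2) : h A (ix (2 * i + j)) 0 = A i j.
  rewrite !mxE ixK; last by case: i j => [[|[]]] // ? [[|[]]].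
  by congr (A _ _); apply/val_inj; rewrite /= inordK; case: i j => [[|[]]] // ? [[|[]]].
have hb : bijective h.
  exists (fun w : 'cV[R]_(3 + 1) => \matrix_(i, j) w (ix (2 * i + j)) 0) => [A|w].
    by apply/matrixP => i j; rewrite mxE hE.
  apply/matrixP => i j; rewrite !mxE (ord1 j); congr (w _ _).
  by apply/val_inj; case: i => [[|[|[|[|]]]]] // ?; rewrite /= ixK !inordK.
rewrite -(avg_bij _ hb); apply: eq_avg => A; rewrite expr1 det_mx22.
by rewrite -!hE.
Qed.

Lemma avg_last k (f : R -> F) :
  avg (fun w : 'cV[R]_(k + 1) => f (w (rshift k 0) 0)) = avg f.
Proof.
rewrite -(avg_bij _ (col_mx_bij R k 1 1))/=.
rewrite -[RHS](avg_cst (0 : 'cV[R]_k)).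
rewrite (avg_pair (fun (x : 'cV[R]_k) y => f (col_mx x y (rshift k 0) 0))).
apply: eq_avg => x; rewrite -[RHS](avg_bij _ (h := fun y : 'cV[R]_1 => y 0 0)).
  by apply: eq_avg => y; rewrite col_mxEd.
by exists (fun y => y%:M) => [y|y]; rewrite ?mxE ?mulr1n//; apply/matrixP => i j; rewrite !ord1 !mxE mulr1n.
Qed.

Definition minors_mean : F :=
  avg (fun T : 'M[R]_(3, 3 + 1) => zabs (quad (minors T))).

(* [quad w] and the square of the last coordinate of w have the same degree; the
   ratio of their orbit means is read off a uniform w. *)
Lemma minors_mean_dist : 2^-1 <= @content_mean F p m 2 3 ->
  `|minors_mean - @det_mean F p m 2 3| <=
  2 * `|@det_mean F p m 1 2 - @det_mean F p m 2 1| + 6 * q ^+ m.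
Proof.
move=> mu2.
pose phi1 (w : 'cV[R]_(3 + 1)) := zabs (quad w).
pose phi2 (w : 'cV[R]_(3 + 1)) := zabs (w (rshift 3 0) 0 ^+ 2).
have hom1 t w : `|phi1 (p%:R ^+ t *: w) - q ^+ (2 * t) * phi1 w| <= q ^+ m.
  by rewrite /phi1 quad_scale -exprM mulnC zabs_pXM.
have hom2 t w : `|phi2 (p%:R ^+ t *: w) - q ^+ (2 * t) * phi2 w| <= q ^+ m.
  by rewrite /phi2 mxE exprMn -exprM mulnC zabs_pXM.
have u1 u w : u \is a GRing.unit -> phi1 (u *: w) = phi1 w.
  by move=> uu; rewrite /phi1 quad_scale zabs_unitMl// unitrX.
have u2 u w : u \is a GRing.unit -> phi2 (u *: w) = phi2 w.
  by move=> uu; rewrite /phi2 mxE exprMn zabs_unitMl// unitrX.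
have inv phi (h : 'M[R]_(3 + 1)) : h \in unitmx ->
    avg (fun x : 'cV[R]_(3 + 1) => phi (h *m x)) = avg phi :> F.
  by move=> hu; rewrite (avg_bij phi (mulmx_bij 1 hu)).
(* In A1 and A2 the vector w consists of minors, in B1 and B2 it is uniform; the orbit means of phi1
   and phi2 are the same in both pairs. B1 and B2 show that they are close, after division by a
   content mean that is at least 1/2, and A1 and A2 transfer this to the minors. *)
have A1 := @avg_radial F p p_pr m m_gt0 3 2 phi1 _ _ hom1
  (fun h hu => avg_minors_inv u1 hu).
have A2 := @avg_radial F p p_pr m m_gt0 3 2 phi2 _ _ hom2
  (fun h hu => avg_minors_inv u2 hu).
have B1 := @avg_radial F p p_pr m m_gt0 3 2 phi1 _ id hom1 (@inv phi1).
have B2 := @avg_radial F p p_pr m m_gt0 3 2 phi2 _ id hom2 (@inv phi2).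
rewrite avg_quad in B1.
rewrite (avg_last 3 (fun x => zabs (x ^+ 2))) in B2.
have E : avg (fun x : R => zabs (x ^+ 2)) = @det_mean F p m 2 1.
  rewrite -(avg_bij _ (h := fun y : 'cV[R]_1 => y 0 0)).
    by apply: eq_avg => y; rewrite det_mx11.
  by exists (fun y => y%:M) => [y|y]; rewrite ?mxE ?mulr1n//; apply/matrixP => i j; rewrite !ord1 !mxE mulr1n.
rewrite E -/(@content_mean F p m 2 3) in B2.
rewrite -/(@content_mean F p m 2 3) in B1.
have D : avg (fun T : 'M[R]_(3, 3 + 1) => phi2 (minors T)) = @det_mean F p m 2 3.
  rewrite -(avg_bij _ (row_mx_bij R 3 3 1)).
  rewrite (avg_pair (fun (K : 'M[_]_3) t => phi2 (minors (row_mx K t)))).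
  apply: eq_avg => K; rewrite -[RHS](avg_cst (0 : 'cV[R]_3)); apply: eq_avg => t.
  by rewrite /phi2 minors_row_mx.
rewrite D in A2; rewrite -/minors_mean in A1.
move: A1 A2 B1 B2.
set c := avg _; have c0 : 0 <= c by apply: avg_ge0 => x; exact/ltW/qX_gt0.
have c1 : c <= 1 by apply: avg_le1 => x; exact: qX_le1.
clearbody c.
move: (orbit_mean phi1) (orbit_mean phi2) mu2 (q ^+ m) => a1 a2.
move: (@content_mean F p m 2 3) minors_mean (@det_mean F p m 2 3) (@det_mean F p m 1 2) (@det_mean F p m 2 1).
move=> mu M d23 d12 d21 mu2 e A1 A2 B1 B2.
have H : `|a1 - a2| <= 2 * (`|d12 - d21| + 2 * e).
  have : `|mu * (a1 - a2)| <= `|d12 - d21| + 2 * e.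
    have -> : mu * (a1 - a2) = (d12 - d21) - (d12 - mu * a1) + (d21 - mu * a2) by ring.
    rewrite (le_trans (ler_normD _ _))// (le_trans (lerD (ler_normB _ _) B2))//; lra.
  rewrite normrM ger0_norm; last lra.
  move=> h; have := ler_wpM2r (normr_ge0 (a1 - a2)) mu2; lra.
have -> : M - d23 = (M - c * a1) - (d23 - c * a2) + c * (a1 - a2) by ring.
rewrite (le_trans (ler_normD _ _))// (le_trans (lerD (ler_normB _ _) (lexx _)))//.
rewrite normrM (ger0_norm c0).
have := ler_wpM2r (normr_ge0 (a1 - a2)) c1; lra.
Qed.

End pfaffian.

Lemma minors_mean_lim (F : realFieldType) (p : nat) (p_pr : prime p) :
  approx p (@minors_mean F p)
   ((1 - p%:R^-1) * (1 - p%:R^-1 ^+ 2) / ((1 - p%:R^-1 ^+ 4) * (1 - p%:R^-1 ^+ 5)) : F).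
Proof.
have [C1 C10 d12] := det_mean_lim (F := F) p_pr 1 2.
have [C2 C20 d21] := det_mean_lim (F := F) p_pr 2 1.
have := det_mean_lim (F := F) p_pr 2 3.
have nz k : 1 - (p%:R^-1 : F) ^+ k.+1 != 0.
  rewrite gt_eqF// subr_gt0 (le_lt_trans (y := p%:R^-1 ^+ 1))//.
    exact: qX_le.
  by rewrite expr1 q_lt1.
rewrite !big_ord_recr !big_ord0/= !mul1r in d12 d21 *.
(* The limits of the two means compared in [minors_mean_dist] coincide, so that its bound becomes
   O(q^m). *)
have e : (1 - p%:R^-1 ^+ 1) / (1 - p%:R^-1 ^+ (1 + 1)) * ((1 - p%:R^-1 ^+ 2) / (1 - p%:R^-1 ^+ (2 + 1))) =
   (1 - p%:R^-1 ^+ 1) / (1 - p%:R^-1 ^+ (1 + 2)) :> F.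
  by rewrite mulrA mulfVK// nz.
rewrite e in d12.
have -> : (1 - p%:R^-1) * (1 - p%:R^-1 ^+ 2) / ((1 - p%:R^-1 ^+ 4) * (1 - p%:R^-1 ^+ 5)) =
   (1 - p%:R^-1 ^+ 1) / (1 - p%:R^-1 ^+ (1 + 2)) * ((1 - p%:R^-1 ^+ 2) / (1 - p%:R^-1 ^+ (2 + 2))) *
   ((1 - p%:R^-1 ^+ 3) / (1 - p%:R^-1 ^+ (3 + 2))) :> F.
  rewrite (_ : 1 + 2 = 3)%N// (_ : 2 + 2 = 4)%N// (_ : 3 + 2 = 5)%N//.
  rewrite expr1; have := nz 2; have := nz 3; have := nz 4.
  move: (1 - _ ^+ 5) (1 - _ ^+ 4) (1 - _ ^+ 3) (1 - _ ^+ 2) (1 - _^-1).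
  by move=> x y z a b x0 y0 z0; field; rewrite x0 y0 z0.
apply: (@approx_trans _ _ _ _ _ (2 * (C1 + C2) + 6)).
  by rewrite addr_ge0// mulr_ge0// addr_ge0.
(* The content mean is at least its main term (1 - q^4) / (1 - q^6), where the powers of q are at
   most 1/2. *)
move=> m m0; have mu2 : 2^-1 <= @content_mean F p m 2 3.
  rewrite content_mean_closed//.
  have qX (k : nat) : 0 < (p%:R^-1 : F) ^+ k.+1 <= 2^-1.
    rewrite qX_gt0//= (le_trans (y := p%:R^-1 ^+ 1))//; first exact: qX_le.
    by rewrite expr1 q_le_half.
  have /andP[a0 a1] := qX 5; have /andP[b0 b1] := qX 3; have /andP[c0 c1] := qX 1.
  rewrite -[2^-1]addr0 lerD//.
    rewrite ler_pdivlMr ?subr_gt0; first by rewrite (_ : 4 + 2 = 6)%N//; lra.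
    by rewrite (_ : 4 + 2 = 6)%N//; lra.
  apply: mulr_ge0; last by rewrite exprn_ge0// ltW ?qX_gt0.
  rewrite (_ : 4 + 2 = 6)%N//; apply: mulr_ge0; last by rewrite invr_ge0; lra.
  by apply: mulr_ge0; [lra|exact: ltW].
rewrite (le_trans (minors_mean_dist p_pr m0 mu2))// [leRHS]mulrDl lerD2r -mulrA ler_pM2l//.
set b := (1 - _ ^+ 1) / _ in d12 d21.
have := lerD (d12 m m0) (d21 m m0); rewrite -mulrDl; apply: le_trans.
by rewrite -[X in _ <= _ + X]normrN (le_trans _ (ler_normD _ _))// opprB addrA subrK.
Qed.

Lemma avg_prod (F : realFieldType) (I T : finType) (f : I -> T -> F) :
  avg (fun g : {ffun I -> T} => \prod_i f i (g i)) = \prod_i avg (f i).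
Proof.
rewrite /avg -bigA_distr_bigA prodf_div; congr (_ / _).
by rewrite prodr_const card_ffun natrX.
Qed.

Lemma matrix_ffun_bij (T : Type) a b :
  bijective (fun g : {ffun 'I_a * 'I_b -> T} => \matrix_(i, j) g (i, j)).
Proof.
exists (fun A : 'M[_]_(a, b) => [ffun ij => A ij.1 ij.2]) => [g|A].
  by apply/ffunP => -[i j]; rewrite ffunE mxE.
by apply/matrixP => i j; rewrite mxE ffunE.
Qed.

Lemma avg_prod_mx (F : realFieldType) (T : finType) a b
    (f : 'I_a -> 'I_b -> T -> F) :
  avg (fun A : 'M[T]_(a, b) => \prod_i \prod_j f i j (A i j)) =
  \prod_i \prod_j avg (f i j).
Proof.
rewrite -(avg_bij _ (matrix_ffun_bij T a b)) pair_bigA/=.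
rewrite -(avg_prod (fun ij => f ij.1 ij.2)); apply: eq_avg => g.
by rewrite pair_bigA/=; apply: eq_bigr => -[i j] _; rewrite mxE.
Qed.

Lemma natr_forall (F : comPzSemiRingType) (I : finType) (P : pred I) :
  ([forall i, P i])%:R = \prod_i (P i)%:R :> F.
Proof.
have [/forallP h|] := boolP [forall i, P i].
  by rewrite big1// => i _; rewrite h.
rewrite negb_forall => /existsP[i /negbTE Pi].
by rewrite (bigD1 i)//= Pi mul0r.
Qed.

Lemma mulr_shuffle (S : comPzRingType) (a b x u : S) :
  a * (x * (a * b * u)) = a * a * (x * u * b).
Proof. by ring. Qed.

(** * Images of linear and perturbed linear maps *)

Section lattice_index.
Context {F : realFieldType} (p : nat) (p_pr : prime p) (m : nat)
  (m_gt0 : (0 < m)%N).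
Local Notation R := 'Z_(p ^ m).
Local Notation q := (p%:R^-1 : F).
Local Notation zabs := (@zabs F p m).
Local Notation vz := (@vz p m).

Lemma avg_dvd c : (c <= m)%N -> avg (fun x : R => (c <= vz x)%N%:R : F) = q ^+ c.
Proof.
move=> cm; rewrite avg_indic (card_dvd p_pr m_gt0 cm) card_Zpm// !natrX.
have p0 : p%:R != 0 :> F by rewrite pnatr_eq0 -lt0n prime_gt0.
by rewrite -[in X in _ / X](subnK cm) exprD invfM mulrA divff ?mul1r ?exprVn// expf_neq0.
Qed.

Lemma avg_dvd_rV k (c : 'I_k -> nat) : (forall i, (c i <= m)%N) ->
  avg (fun z : 'rV[R]_k => ([forall i, (c i <= vz (z 0%R i))%N])%:R : F) =
  \prod_i q ^+ c i.
Proof.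
move=> cm; under eq_bigr do rewrite -avg_dvd//.
have := avg_prod_mx (fun (_ : 'I_1) i (x : R) => (c i <= vz x)%N%:R : F).
rewrite big_ord1 => <-; apply: eq_avg => z.
by rewrite big_ord1 natr_forall.
Qed.

(** Z/p^m is not a domain: the entries are lifted to integers, where the Smith form is taken and
    then reduced. *)
Lemma smith k (J : 'M[R]_k) :
  exists2 L : 'M[R]_k, L \in unitmx & exists2 U : 'M[R]_k, U \in unitmx &
  exists d : 'rV[R]_k, J = L *m diag_mx d *m U.
Proof.
pose f := (intr : int -> R).
have -> : J = map_mx f (map_mx (fun x : R => (x : nat)%:Z) J).
  by apply/matrixP => i j; rewrite !mxE /f -pmulrn natr_Zp.
have funit (A : 'M[int]_k) : A \in unitmx -> map_mx f A \in unitmx.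
  by rewrite !unitmxE det_map_mx => /(rmorph_unit (f : {rmorphism int -> R})).
have [L Lu [U Uu [d _ ->]]] := int_Smith_normal_form (map_mx (fun x : R => (x : nat)%:Z) J).
exists (map_mx f L); first exact: funit.
exists (map_mx f U); first exact: funit.
exists (\row_i f d`_i); rewrite !map_mxM; congr (_ *m _ *m _).
by apply/matrixP => i j; rewrite !mxE rmorphMn/=.
Qed.

Lemma vz_prod k (d : 'I_k -> R) :
  vz (\prod_i d i) = minn (\sum_i vz (d i)) m.
Proof.
apply: (big_rec2 (fun x a => vz x = minn a m)) => [|i a x _ xa].
  by rewrite min0n; apply/eqP; rewrite (vz_eq0 p_pr m_gt0) unitr1.
by rewrite (vzM p_pr m_gt0) xa; lia.
Qed.

Lemma diag_mulmx k (d y : 'rV[R]_k) i : (y *m diag_mx d) 0 i = y 0 i * d 0 i.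
Proof.
rewrite mxE (bigD1 i)//= !mxE eqxx mulr1n big1 ?addr0// => j ji.
by rewrite mxE (negbTE ji) mulr0n mulr0.
Qed.

Lemma vz_det_smith k (L U : 'M[R]_k) (d : 'rV[R]_k) :
  L \in unitmx -> U \in unitmx ->
  vz (\det (L *m diag_mx d *m U)) = minn (\sum_i vz (d 0%R i)) m.
Proof.
move=> Lu Uu; rewrite !det_mulmx mulrC mulrA (vz_unitMl p_pr m_gt0).
  by rewrite det_diag vz_prod.
by rewrite unitrM -!unitmxE Uu.
Qed.

(** In Smith coordinates the image is a box, whose proportion is the product of the q^(v_i), v_i the
    valuations of the diagonal entries. Below the truncation the v_i add up exactly to the valuation
    of the determinant. *)
Lemma avg_image k (J : 'M[R]_k) : (vz (\det J) < m)%N ->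
  avg (fun z : 'rV[R]_k => [exists y : 'rV[R]_k, z == y *m J]%:R : F) =
  zabs (\det J).
Proof.
have [L Lu [U Uu [d ->]]] := smith J.
rewrite /zabs vz_det_smith// => dm.
have -> : minn (\sum_i vz (d 0%R i)) m = (\sum_i vz (d 0%R i))%N by lia.
rewrite expr_sum -(avg_dvd_rV (c := fun i => vz (d 0 i))); last by move=> i; rewrite vz_le.
rewrite -(avg_bij _ (mulmxr_bij 1 Uu)); apply: eq_avg => z.
congr (nat_of_bool _)%:R; apply/existsP/forallP => [[y]|dz].
  rewrite mulmxA (inj_eq (bij_inj (mulmxr_bij 1 Uu))) mulmxA => /eqP -> i.
  by rewrite diag_mulmx (vzM p_pr m_gt0) leq_min leq_addl vz_le.
have /fin_all_exists[y yz] i : exists x, z 0 i = x * d 0 i.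
  have := dz i; have [u uu ud] := vzP p_pr m_gt0 (d 0 i).
  rewrite -(dvd_vz p_pr m_gt0) ?(vz_le p_pr)// => /existsP[x /eqP zx].
  by exists (x * u^-1); rewrite zx [in RHS]ud mulrACA mulVr// mulr1 mulrC.
exists ((\row_i y i) *m invmx L).
rewrite mulmxA (inj_eq (bij_inj (mulmxr_bij 1 Uu))) mulmxA mulmxKV//.
by apply/eqP/rowP => i; rewrite yz diag_mulmx mxE.
Qed.

(** The case of a nearly singular J. In Smith coordinates, entry i of z is divisible by p^(n +
    min(v_i, n)). The minima add up to at least n: one v_i >= n suffices for this, and otherwise
    they are the v_i themselves. *)
Lemma avg_image_le k n (J : 'M[R]_k) (A : pred 'rV[R]_k) :
  (n <= vz (\det J))%N -> (2 * n <= m)%N ->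
  (forall z, A z -> exists y y' : 'rV[R]_k,
    z = p%:R ^+ n *: (y *m J) + p%:R ^+ (2 * n) *: y') ->
  avg (fun z => (A z)%:R : F) <= q ^+ (k * n) * q ^+ n.
Proof.
have [L Lu [U Uu [d ->]]] := smith J.
rewrite vz_det_smith// => nd nm hA.
pose c i := (n + minn (vz (d 0%R i)) n)%N.
have cm i : (c i <= m)%N by rewrite /c; lia.
rewrite (le_trans (y := avg (fun z : 'rV[R]_k =>
    ([forall i, (c i <= vz (z 0%R i))%N])%:R)))//.
  rewrite -(avg_bij _ (mulmxr_bij 1 Uu)); apply: le_avg => z.
  rewrite ler_nat; case: (boolP (A _)) => // /hA[y [y' zy]].
  rewrite lt0b; apply/forallP => i.
  have {zy} -> : z = p%:R ^+ n *: (y *m L *m diag_mx d) +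
      p%:R ^+ (2 * n) *: (y' *m invmx U).
    apply: (bij_inj (mulmxr_bij 1 Uu)); rewrite zy mulmxDl -!scalemxAl.
    by rewrite (mulmxKV Uu) !mulmxA.
  rewrite mxE [X in X + _]mxE [X in _ + X]mxE diag_mulmx.
  have [u uu ->] := vzP p_pr m_gt0 (d 0 i).
  rewrite -(dvd_vz p_pr m_gt0)//; apply/existsP.
  have [vn|vn] := leqP (vz (d 0%R i)) n.
    exists ((y *m L) 0 i * u + p%:R ^+ (n - vz (d 0 i)) * (y' *m invmx U) 0 i).
    rewrite /c (minn_idPl vn) mulrDr; apply/eqP; congr (_ + _).
      by rewrite exprD -mulrA; congr (_ * _); rewrite mulrCA.
    by rewrite mulrA -exprD; congr (_ ^+ _ * _); lia.
  exists ((y *m L) 0 i * u * p%:R ^+ (vz (d 0 i) - n) + (y' *m invmx U) 0 i).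
  rewrite /c (minn_idPr (ltnW vn)) mulrDr; apply/eqP; congr (_ + _).
    by rewrite -[in LHS](subnKC (ltnW vn)) !exprD; exact: mulr_shuffle.
  by rewrite mul2n addnn.
rewrite avg_dvd_rV// -expr_sum -exprD qX_le//.
rewrite /c big_split/= sum_nat_const card_ord leq_add2l.
move: nd; rewrite leq_min => /andP[nd _].
have [/existsP[i ni]|] := boolP [exists i, (n <= vz (d 0%R i))%N].
  by rewrite (bigD1 i)//= (minn_idPr ni) leq_addr.
rewrite negb_exists => /forallP h.
by under eq_bigr do rewrite (minn_idPl (ltnW _)) ?ltnNge ?h//.
Qed.

End lattice_index.

Section perturbed_image.
Context {F : realFieldType} (p : nat) (p_pr : prime p) (m : nat)
  (m_gt0 : (0 < m)%N).
Local Notation R := 'Z_(p ^ m).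
Local Notation q := (p%:R^-1 : F).
Local Notation zabs := (@zabs F p m).
Local Notation vz := (@vz p m).
Context (k n : nat) (J : 'M[R]_k) (Q : 'rV[R]_k -> 'rV[R]_k).
(** What the Hensel argument uses of the quadratic terms: Q is 1-Lipschitz for the p-adic
    distance. *)
Hypothesis congrQ : forall t y y' z, y - y' = p%:R ^+ t *: z ->
  exists z', Q y - Q y' = p%:R ^+ t *: z'.

(** On a finite set injectivity suffices. If two images agree, then y - y' is p times an image of Q
    y - Q y', so that its divisibility by p^t improves to p^(t+1), up to p^m = 0. *)
Lemma perturbation_bij (G : 'M[R]_k) :
  bijective (fun y => y + p%:R *: (Q y *m G)).
Proof.
apply: injF_bij => y y' /eqP; rewrite -subr_eq0 => /eqP e.
have {}e : y - y' = - (p%:R *: ((Q y - Q y') *m G)).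
  apply/eqP; rewrite -subr_eq0 opprK; apply/eqP; rewrite -[RHS]e.
  by rewrite mulmxBl scalerBr opprD addrACA.
have H t : exists z, y - y' = p%:R ^+ t *: z.
  elim: t => [|t [z /congrQ[z' QE]]]; first by exists (y - y'); rewrite expr0 scale1r.
  exists (- (z' *m G)); rewrite e QE -scalemxAl scalerA -exprS.
  by rewrite scalerN.
have [z yz] := H m.
by apply/eqP; rewrite -subr_eq0 yz (pXm0 p_pr m_gt0) scale0r.
Qed.

(* If [vz (\det J) < n] then p^n Q(y) is the image under J of a multiple of p,
   so that the quadratic term amounts to a change of variable y + p Q(y) G. *)
Lemma avg_perturbed_image : (k.+1 * n <= m)%N -> (0 < k)%N ->
  `|q ^- (k * n) * avg (fun z : 'rV[R]_k => [exists y,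
      z == p%:R ^+ n *: (y *m J) + p%:R ^+ (2 * n) *: Q y]%:R : F) -
    zabs (\det J)| <= q ^+ n.
Proof.
move=> knm k0; have q0 := @qX_gt0 F p p_pr.
have knm2 : (2 * n <= m)%N by rewrite (leq_trans _ knm)// leq_mul2r ltnS k0 orbT.
(* If [vz (\det J)] is at least n, both terms of the difference lie between 0 and q^n. *)
have [vn|vn] := ltnP (vz (\det J)) n; last first.
  have h : zabs (\det J) <= q ^+ n by apply: qX_le.
  have h0 := @zabs_ge0 F p p_pr m (\det J).
  set a := avg _; have a0 : 0 <= a by apply: avg_ge0 => z; rewrite ler0n.
  have : a <= q ^+ (k * n) * q ^+ n.
    apply: (avg_image_le p_pr m_gt0 vn knm2) => z /existsP[y /eqP ->].
    by exists y, (Q y).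
  rewrite -ler_pdivrMl// => ha.
  have : 0 <= q ^- (k * n) * a by rewrite mulr_ge0// invr_ge0 ltW.
  by move=> hb; rewrite ler_norml; lra.
have [u uu] := vzP p_pr m_gt0 (\det J).
set v := vz (\det J) in vn * => detJ.
(* G is p^(n-1) times the inverse of J, integral because v <= n - 1. The exponent n - 1 instead of n
   leaves over the factor p that makes [psi] bijective. *)
pose G := (u^-1 * p%:R ^+ (n.-1 - v)) *: \adj J.
have GJ : G *m J = (p%:R ^+ n.-1)%:M.
  rewrite -scalemxAl mul_adj_mx detJ scale_scalar_mx; congr _%:M.
  rewrite mulrA -[_ * p%:R ^+ v]mulrA -exprD subnK; last by lia.
  by rewrite mulrAC mulVr// mul1r.
pose psi y := y + p%:R *: (Q y *m G).
have psiE y : p%:R ^+ n *: (y *m J) + p%:R ^+ (2 * n) *: Q y =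
    psi y *m (p%:R ^+ n *: J).
  rewrite -scalemxAr mulmxDl scalerDr; congr (_ + _).
  rewrite -scalemxAl -mulmxA GJ mul_mx_scalar !scalerA -mulrA -exprS prednK; last by lia.
  by rewrite -exprD addnn mul2n.
have -> : avg (fun z : 'rV[R]_k => [exists y,
      z == p%:R ^+ n *: (y *m J) + p%:R ^+ (2 * n) *: Q y]%:R : F) =
    avg (fun z : 'rV[R]_k => [exists y : 'rV[R]_k, z == y *m (p%:R ^+ n *: J)]%:R).
  apply: eq_avg => z; congr (nat_of_bool _)%:R; apply/existsP/existsP => -[y /eqP ->].
    by exists (psi y); rewrite psiE.
  have [psi' _ psiK] := perturbation_bij G.
  by exists (psi' y); rewrite psiE -[in X in X == _](psiK y).
(* The bound (k + 1) n <= m keeps k n + v below the truncation, as v < n. *)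
have vJ : vz (\det (p%:R ^+ n *: J)) = (k * n + v)%N.
  rewrite detZ -exprM (vzM p_pr m_gt0) (vz_pX p_pr m_gt0).
  by move: knm; rewrite -/v mulSn mulnC; lia.
rewrite avg_image//; last by rewrite vJ; move: knm; rewrite mulSn; lia.
rewrite /zabs vJ exprD mulrA mulVf ?gt_eqF// mul1r subrr normr0 ltW//.
Qed.

End perturbed_image.

(* Laplace expansion in which [None] stands for a zero entry, so that the
   expansion of a sparse matrix can be computed with symbolic entries. *)
Section sparse_determinant.
Context (S : comPzRingType).

Definition oadd (x y : option S) : option S :=
  match x, y with
  | None, _ => y | _, None => x | Some x, Some y => Some (x + y)
  end.

Definition omul (x y : option S) : option S :=
  match x, y with Some x, Some y => Some (x * y) | _, _ => None end.

Definition osign (i : nat) (x : option S) : option S :=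
  match x with Some x => Some (if odd i then - x else x) | None => None end.

Fixpoint osum (n : nat) (f : nat -> option S) : option S :=
  if n is n'.+1 then oadd (osum n' f) (f n') else None.

(** [bump] in structurally recursive form, so that [cbv] evaluates it on numerals. *)
Fixpoint skip (i a : nat) : nat :=
  match i, a with 0, _ => a.+1 | i'.+1, 0 => 0 | i'.+1, a'.+1 => (skip i' a').+1 end.

Lemma skipE i a : skip i a = bump i a.
Proof.
elim: i a => [|i IH] [|a] //=; rewrite ?IH /bump ?leq0n ?ltn0 ?addn0 //.
by rewrite ltnS addnS.
Qed.

Fixpoint sdet (n : nat) (f : nat -> nat -> option S) : option S :=
  if n is n'.+1 then
    osum n (fun i => if f i 0%N is Some x then
      osign i (omul (Some x) (sdet n' (fun a b => f (skip i a) b.+1))) else None)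
  else Some 1.

Local Notation val0 := (odflt 0).

Lemma osumE n (f : nat -> option S) : val0 (osum n f) = \sum_(i < n) val0 (f i).
Proof.
elim: n => [|n IH]; first by rewrite big_ord0.
rewrite big_ord_recr/= -IH; case: (osum n f) => [x|]; case: (f n) => [y|] //=.
  by rewrite addr0.
all: by rewrite add0r.
Qed.

Lemma sdetE n (f : nat -> nat -> option S) :
  \det (\matrix_(i < n, j < n) val0 (f i j)) = val0 (sdet n f).
Proof.
elim: n f => [|n IH] f; first by rewrite det_mx00.
rewrite (expand_det_col _ 0) [sdet _ _]/= -/(osum n.+1 _) osumE.
apply: eq_bigr => i _; rewrite mxE /cofactor addn0.
rewrite -[sdet n _]/(sdet n _).
have -> : row' i (col' 0 (\matrix_(i, j) val0 (f i j))) =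
    \matrix_(a < n, b < n) val0 (f (skip i a) b.+1).
  by apply/matrixP => a b; rewrite !mxE skipE.
rewrite (IH (fun a b => f (skip i a) b.+1)); move: (sdet n _) => d.
case: (f i 0%N) => [x|] /=; last by rewrite mul0r.
case: d => [y|] /=; last by rewrite !mulr0.
by rewrite -signr_odd; case: (odd i); rewrite ?expr1 ?expr0 ?mul1r// mulN1r mulrN.
Qed.

End sparse_determinant.

(** * Restriction of two quadratic forms to planes *)

Section restriction.
Context (S : comPzRingType).

(** The coefficients at s^2, t^2 and s t of the binary quadratic forms with matrices E1 and E2,
    interleaved: the six equations for a plane to lie on both quadrics. *)
Definition bin_coefs (E1 E2 : 'M[S]_2) : 'rV[S]_6 :=
  \row_k [:: E1 0 0; E2 0 0; E1 1 1; E2 1 1;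
             E1 0 1 + E1 1 0; E2 0 1 + E2 1 0]`_k.

Lemma bin_coefs_lin a (E1 E2 E1' E2' : 'M[S]_2) :
  bin_coefs (a *: E1 + E1') (a *: E2 + E2') =
  a *: bin_coefs E1 E2 + bin_coefs E1' E2'.
Proof.
by apply/rowP => -[[|[|[|[|[|[|]]]]]] // ?];
  rewrite !mxE /= ?mxE // mulrDr addrACA.
Qed.

Lemma bin_coefs_tr (E1 E2 : 'M[S]_2) : bin_coefs E1^T E2^T = bin_coefs E1 E2.
Proof.
by apply/rowP => -[[|[|[|[|[|[|]]]]]] // ?]; rewrite !mxE /= ?mxE // addrC.
Qed.

Definition frame (y : 'rV[S]_6) : 'M[S]_(2, 3) :=
  \matrix_(i, j) y 0 (inord (3 * i + j)).

Lemma frame_lin a y y' : frame (a *: y + y') = a *: frame y + frame y'.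
Proof. by apply/matrixP => i j; rewrite !mxE. Qed.

Lemma frame_delta i k j : frame (delta_mx 0 i) k j = (3 * k + j == i)%N%:R.
Proof.
rewrite !mxE eqxx -val_eqE /= inordK//.
by case: k j => [[|[|]]] // ? [[|[|[|]]]] // ?.
Qed.

(** The linear part of these equations at the plane spanned by (1 | Y). The 2 x 3 matrix Y has six
    entries, as many as there are equations, whence a square Jacobian. *)
Definition jac_fun (M1 M2 : 'M[S]_(3, 2)) (y : 'rV[S]_6) : 'rV[S]_6 :=
  bin_coefs (frame y *m M1) (frame y *m M2).

Lemma jac_linear M1 M2 : linear (jac_fun M1 M2).
Proof.
move=> a y y'.
by rewrite /jac_fun frame_lin !mulmxDl -!scalemxAl bin_coefs_lin.
Qed.

Definition jac (M1 M2 : 'M[S]_(3, 2)) : 'M[S]_6 :=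
  \matrix_i jac_fun M1 M2 (delta_mx 0 i).

Lemma mul_jac M1 M2 y : y *m jac M1 M2 = jac_fun M1 M2 y.
Proof.
pose g := GRing.isLinear.Build _ _ _ _ (jac_fun M1 M2) (jac_linear M1 M2).
pose f : {linear 'rV[S]_6 -> 'rV[S]_6} := HB.pack (jac_fun M1 M2) g.
have -> : jac M1 M2 = lin1_mx f by apply/matrixP => i j; rewrite !mxE.
by rewrite mul_rV_lin1.
Qed.

Let e (M : 'M[S]_(3, 2)) (i j : nat) : S := M (inord i) (inord j).

Definition jac_entry (M1 M2 : 'M[S]_(3, 2)) (i k : nat) : option S :=
  let m1 := e M1 in let m2 := e M2 in
  match i, k with
  | 0, 0 | 1, 0 | 2, 0 => Some (m1 i 0%N)
  | 0, 1 | 1, 1 | 2, 1 => Some (m2 i 0%N)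
  | 0, 4 | 1, 4 | 2, 4 => Some (m1 i 1%N)
  | 0, 5 | 1, 5 | 2, 5 => Some (m2 i 1%N)
  | 3, 2 | 4, 2 | 5, 2 => Some (m1 i.-1.-1.-1 1)%N
  | 3, 3 | 4, 3 | 5, 3 => Some (m2 i.-1.-1.-1 1)%N
  | 3, 4 | 4, 4 | 5, 4 => Some (m1 i.-1.-1.-1 0)%N
  | 3, 5 | 4, 5 | 5, 5 => Some (m2 i.-1.-1.-1 0)%N
  | _, _ => None
  end.

Lemma frame_delta_mul (M : 'M[S]_(3, 2)) (i : 'I_6) (k j : 'I_2) :
  (frame (delta_mx 0 i) *m M) k j =
  if (i %/ 3 == k)%N then e M (i %% 3) j else 0.
Proof.
rewrite mxE; case: eqP => ik.
  have i3 : (i %% 3 < 3)%N by rewrite ltn_mod.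
  rewrite (bigD1 (inord (i %% 3)))//= big1 ?addr0 => [|l].
    rewrite frame_delta inordK// -ik mulnC -divn_eq eqxx mul1r.
    by rewrite /e inord_val.
  rewrite -val_eqE /= inordK// frame_delta => li.
  case: eqP => [il|]; last by rewrite mul0r.
  by rewrite -il mulnC modnMDl modn_small// eqxx in li.
rewrite big1// => l _; rewrite frame_delta; case: eqP => [il|]; last by rewrite mul0r.
by case: ik; rewrite -il mulnC divnMDl// divn_small ?addn0.
Qed.

Lemma jacE M1 M2 : jac M1 M2 = \matrix_(i, k) odflt 0 (jac_entry M1 M2 i k).
Proof.
apply/matrixP => i k; rewrite [LHS]mxE [RHS]mxE /jac_fun mxE.
rewrite !frame_delta_mul.
case: i => [[|[|[|[|[|[|]]]]]] // ?]; case: k => [[|[|[|[|[|[|]]]]]] // ?] /=;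
  by rewrite ?addr0 ?add0r.
Qed.

Definition minor_entry (M1 M2 : 'M[S]_(3, 2)) (l : nat) (i k : nat) : option S :=
  match i, k with
  | 0, k'.+2 | 1, k'.+2 | 2, k'.+2 => Some (e M2 i k')
  | 0, _ | 1, _ | 2, _ => Some (e M1 i k)
  | _, _ => if eqn k l then Some 1 else None
  end.

Lemma minorsE (M1 M2 : 'M[S]_(3, 2)) (l : nat) : (l < 4)%N ->
  minors (row_mx M1 M2 : 'M[_]_(3, 3 + 1)) (ix l) 0 =
  odflt 0 (sdet 4 (minor_entry M1 M2 l)).
Proof.
move=> l4; rewrite mxE -sdetE; congr (\det _); apply/matrixP => i j.
rewrite [RHS]mxE [LHS]mxE; case: splitP => i' ii'.
  rewrite mxE; case: splitP => j' jj'; rewrite ii' jj'.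
    case: i' j' {ii' jj'} => [[|[|[|]]]] // ? [[|[|]]] // ?;
      by rewrite /= /e; congr (M1 _ _); apply/val_inj; rewrite /= inordK.
  case: i' j' {ii' jj'} => [[|[|[|]]]] // ? [[|[|]]] // ?;
    by rewrite /= /e; congr (M2 _ _); apply/val_inj; rewrite /= inordK.
rewrite mxE (ord1 i') eqxx/= ii' -val_eqE/= ixK// ?addn0.
by rewrite /= -[eqn _ _]/((j : nat) == l); case: eqP.
Qed.

(** A polynomial identity, checked by expansion. Its shape is forced: replacing M1, M2 by g M1, g M2
    composes the linear map with Y -> Y g, of determinant (det g)^2, so the left side is an
    SL_3-invariant of degree 6 of (M1 | M2), that is, a quadratic form in its maximal minors. *)
Lemma det_jac M1 M2 :
  \det (jac M1 M2) = - quad (minors (row_mx M1 M2 : 'M[_]_(3, 3 + 1))).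
Proof.
rewrite jacE sdetE /quad !minorsE//.
rewrite /jac_entry /minor_entry; move: (e M1) (e M2) => m1 m2.
cbv [sdet osum osign omul oadd odflt oapp odd negb skip minor_entry eqn Nat.pred].
ring.
Qed.

End restriction.

Section vanishing.
Context (S : comNzRingType).

(* E is alternating: the quadratic form x E x^T is zero. *)
Definition alt2 (E : 'M[S]_2) : bool :=
  [&& E 0 0 == 0, E 0 1 + E 1 0 == 0 & E 1 1 == 0].

(* The quadratic form v C v^T is zero on the row space of B. *)
Definition vanish k (C : 'M[S]_k) (B : 'M[S]_(2, k)) : bool :=
  alt2 (B *m C *m B^T).

Lemma alt2_coefs (E1 E2 : 'M[S]_2) : alt2 E1 && alt2 E2 = (bin_coefs E1 E2 == 0).
Proof.
apply/andP/eqP => [[/and3P[/eqP a /eqP b /eqP c] /and3P[/eqP a' /eqP b' /eqP c']]|E].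
  by apply/rowP => -[[|[|[|[|[|[|]]]]]] // ?]; rewrite !mxE.
have h (k : 'I_6) : bin_coefs E1 E2 0 k = 0 by rewrite E mxE.
have := (h (inord 0), h (inord 1), h (inord 2), h (inord 3), h (inord 4), h (inord 5)).
by rewrite !mxE !inordK//= => -[[[[[a b] c] d] e] f]; rewrite /alt2 a b c d e f !eqxx.
Qed.

Definition chart (c : S) (Y : 'M[S]_(2, 3)) : 'M[S]_(2, 2 + 3) :=
  row_mx 1%:M (c *: Y).

Lemma chart_form c (Y : 'M[S]_(2, 3)) H P P' Q :
  chart c Y *m (block_mx H P P' Q : 'M[_]_(2 + 3)) *m (chart c Y)^T =
  H + c *: (Y *m P' + P *m Y^T) + c ^+ 2 *: (Y *m Q *m Y^T).
Proof.
rewrite /chart mul_row_block tr_row_mx mul_row_col trmx1 mulmx1 !mul1mx linearZ/=.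
rewrite -!scalemxAr mulmxDl -!scalemxAl !scalerDr scalerA -expr2.
by rewrite -!addrA; congr (_ + (_ + _)).
Qed.

Definition quad_part (Q1 Q2 : 'M[S]_3) (y : 'rV[S]_6) : 'rV[S]_6 :=
  bin_coefs (frame y *m Q1 *m (frame y)^T) (frame y *m Q2 *m (frame y)^T).

Lemma bin_coefsD (E1 E2 E1' E2' : 'M[S]_2) :
  bin_coefs (E1 + E1') (E2 + E2') = bin_coefs E1 E2 + bin_coefs E1' E2'.
Proof. by rewrite -[E1]scale1r -[E2]scale1r bin_coefs_lin !scale1r. Qed.

Lemma bin_coefs0 : bin_coefs (0 : 'M[S]_2) 0 = 0.
Proof. by apply/eqP; rewrite -alt2_coefs /alt2 !mxE addr0 eqxx. Qed.

Lemma bin_coefsZ a (E1 E2 : 'M[S]_2) :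
  bin_coefs (a *: E1) (a *: E2) = a *: bin_coefs E1 E2.
Proof. by rewrite -[a *: E1]addr0 -[a *: E2]addr0 bin_coefs_lin bin_coefs0 addr0. Qed.

(** [P *m Y^T] and its transpose define the same binary form, so the linear part depends on P' + P^T
    only; a uniform P' makes it uniform whatever P is. *)
Lemma vanish_chart c (y : 'rV[S]_6) H1 P1 P1' Q1 H2 P2 P2' Q2 :
  vanish (block_mx H1 P1 P1' Q1) (chart c (frame y)) &&
  vanish (block_mx H2 P2 P2' Q2) (chart c (frame y)) =
  (- bin_coefs H1 H2 ==
   c *: (y *m jac (P1' + P1^T) (P2' + P2^T)) + c ^+ 2 *: quad_part Q1 Q2 y).
Proof.
rewrite /vanish alt2_coefs !chart_form !bin_coefsD !bin_coefsZ !bin_coefsD.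
rewrite -[bin_coefs (P1 *m _) _]bin_coefs_tr !trmx_mul !trmxK -bin_coefsD.
rewrite -!mulmxDr -/(jac_fun (P1' + P1^T) (P2' + P2^T) y) mul_jac.
by rewrite -addrA addr_eq0 eqr_oppLR.
Qed.

Lemma quad_part_congr Q1 Q2 a y y' z : y - y' = a *: z ->
  exists z', quad_part Q1 Q2 y - quad_part Q1 Q2 y' = a *: z'.
Proof.
move=> /eqP; rewrite subr_eq => /eqP ->.
set U := frame (a *: z + y').
have UE : a *: frame z = U - frame y' by rewrite /U frame_lin addrK.
(* With V = [frame y']: U Q U^T - V Q V^T = (U - V) Q U^T + V Q (U - V)^T. *)
pose h Q := frame z *m Q *m U^T + frame y' *m Q *m (frame z)^T.
have hE Q : U *m Q *m U^T + -1 *: (frame y' *m Q *m (frame y')^T) = a *: h Q.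
  have -> : a *: h Q = (a *: frame z) *m Q *m U^T + frame y' *m Q *m (a *: frame z)^T.
    by rewrite /h scalerDr [(a *: frame z)^T]linearZ/= -!scalemxAl -scalemxAr.
  by rewrite UE linearB/= !mulmxBl mulmxBr addrA subrK scaleN1r.
exists (bin_coefs (h Q1) (h Q2)).
by rewrite -bin_coefsZ -!hE bin_coefsD -scaleN1r -bin_coefsZ.
Qed.

End vanishing.

Section solvability.
Context {F : realFieldType} (p : nat) (p_pr : prime p) (m : nat)
  (m_gt0 : (0 < m)%N).
Local Notation R := 'Z_(p ^ m).
Local Notation q := (p%:R^-1 : F).

Definition solvable (n : nat) (C1 C2 : 'M[R]_(2 + 3)) : bool :=
  [exists Y, vanish C1 (chart (p%:R ^+ n) Y) && vanish C2 (chart (p%:R ^+ n) Y)].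

Definition solvable_mean n : F :=
  avg (fun C1 => avg (fun C2 => (solvable n C1 C2)%:R)).

Lemma frame_bij : bijective (@frame R).
Proof.
exists (fun Y : 'M[R]_(2, 3) => \row_k Y (inord (k %/ 3)) (inord (k %% 3))) => [y|Y].
  apply/rowP => k; rewrite !mxE; congr (y _ _); apply/val_inj.
  by case: k => [[|[|[|[|[|[|]]]]]] // ?]; rewrite /= !inordK.
apply/matrixP => i j; rewrite !mxE inordK; last first.
  by case: i j => [[|[|]]] // ? [[|[|[|]]]] // ?.
have jj : (j < 3)%N by [].
by congr (Y _ _); apply/val_inj; rewrite /= inordK mulnC ?divnMDl ?modnMDl ?divn_small ?modn_small ?addn0.
Qed.

Lemma avg_bin_coefs (f : 'rV[R]_6 -> F) :
  avg (fun H1 => avg (fun H2 => f (- bin_coefs H1 H2))) = avg f.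
Proof.
rewrite -(avg_pair (fun H1 H2 => f (- bin_coefs H1 H2))).
rewrite -[RHS](avg_cst (0 : 'rV[R]_2)) -avg_swap.
rewrite -(avg_pair (fun z (t : 'rV[R]_2) => f z)).
pose o (k : nat) : 'I_6 := inord k.
(* The fibres of [bin_coefs] are parametrized by the lower left entries t of the two matrices; the
   upper right entry is the prescribed off-diagonal sum minus t. *)
pose mk (x : 'rV[R]_6) (t : 'rV[R]_2) (i : 'I_2) : 'M[R]_2 :=
  \matrix_(a, b) nth 0 (nth [::] [:: [:: - x 0 (o i); - x 0 (o (4 + i)%N) - t 0 i];
                     [:: t 0 i; - x 0 (o (2 + i)%N)]] a) b.
have gb : bijective (fun z : 'rV[R]_6 * 'rV[R]_2 => (mk z.1 z.2 0, mk z.1 z.2 1)).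
  exists (fun H : 'M[R]_2 * 'M[R]_2 => (- bin_coefs H.1 H.2,
     \row_(i < 2) [:: H.1 1 0; H.2 1 0]`_i)) => [[x t]|[H1 H2]] /=.
    congr pair; apply/rowP.
      move=> -[[|[|[|[|[|[|]]]]]] // k6]; rewrite !mxE /= ?subrK opprK;
        by congr (x _ _); apply/val_inj; rewrite /= inordK.
    by move=> -[[|[|]] // k2]; rewrite !mxE /=; congr (t _ _); apply/val_inj.
  congr pair; apply/matrixP => -[[|[|]] // a] [[|[|]] // b]; rewrite !mxE /= ?inordK//= ?opprK ?addrK;
    by congr (_ _ _); apply/val_inj.
rewrite -(avg_bij _ gb)/=; apply: eq_avg => -[x t] /=; congr (f _).
apply/rowP => -[[|[|[|[|[|[|]]]]]] // k6]; rewrite !mxE /= ?subrK opprK;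
  by congr (x _ _); apply/val_inj; rewrite /= inordK.
Qed.

Lemma avg_block (f : 'M[R]_(2 + 3) -> F) :
  avg f = avg (fun P => avg (fun Q => avg (fun P' => avg (fun H =>
    f (block_mx H P P' Q))))).
Proof.
pose g (z : 'M[R]_(2, 3) * ('M[R]_3 * ('M[R]_(3, 2) * 'M[R]_2))) :=
  block_mx z.2.2.2 z.1 z.2.2.1 z.2.1.
have gb : bijective g.
  exists (fun C => (ursubmx C, (drsubmx C, (dlsubmx C, ulsubmx C)))).
    by move=> [P [Q [P' H]]]; rewrite /g /= block_mxKur block_mxKdr block_mxKdl block_mxKul.
  by move=> C; rewrite /g /= submxK.
rewrite -(avg_bij f gb).
rewrite (avg_pair (fun P (z : 'M[R]_3 * ('M[R]_(3, 2) * 'M[R]_2)) => f (block_mx z.2.2 P z.2.1 z.1))).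
apply: eq_avg => P; rewrite (avg_pair (fun Q (z : 'M[R]_(3, 2) * 'M[R]_2) => f (block_mx z.2 P z.1 Q))).
apply: eq_avg => Q; by rewrite (avg_pair (fun P' H => f (block_mx H P P' Q))).
Qed.

Lemma minors_meanE (A1 A2 : 'M[R]_(3, 2)) : @minors_mean F p m =
  avg (fun M1 => avg (fun M2 => @zabs F p m (\det (jac (M1 + A1) (M2 + A2))))).
Proof.
have addb (A : 'M[R]_(3, 2)) : bijective (fun M => M + A).
  by exists (fun M => M - A) => M; rewrite ?addrK ?subrK.
rewrite (avg_bij (fun M1 => avg (fun M2 => @zabs F p m (\det (jac M1 (M2 + A2))))) (addb A1)).
under [RHS]eq_avg do rewrite (avg_bij (fun M2 => @zabs F p m (\det (jac _ M2))) (addb A2)).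
rewrite -(avg_pair (fun M1 M2 => @zabs F p m (\det (jac M1 M2)))).
rewrite /minors_mean -(avg_bij _ (row_mx_bij R 3 2 2)).
by apply: eq_avg => -[M1 M2] /=; rewrite det_jac zabsN.
Qed.

Lemma solvable_mean_dist n : (7 * n <= m)%N ->
  `|q ^- (6 * n) * solvable_mean n - @minors_mean F p m| <= q ^+ n.
Proof.
move=> nm; have q0 : 0 <= q ^+ n by exact/ltW/qX_gt0.
(* The order of averaging matters: for fixed P1, Q1, P2, Q2 the Jacobian is governed by the uniform
   P1', P2', and once these are fixed too the constant term is uniform in H1, H2. *)
have -> : solvable_mean n = avg (fun P1 => avg (fun Q1 => avg (fun P2 => avg (fun Q2 =>
    avg (fun P1' => avg (fun P2' => avg (fun H1 => avg (fun H2 =>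
      (solvable n (block_mx H1 P1 P1' Q1) (block_mx H2 P2 P2' Q2))%:R)))))))).
  rewrite /solvable_mean avg_block; apply: eq_avg => P1; apply: eq_avg => Q1.
  under eq_avg do under eq_avg do rewrite avg_block.
  under eq_avg do rewrite avg_swap.
  rewrite avg_swap; apply: eq_avg => P2.
  under eq_avg do rewrite avg_swap.
  rewrite avg_swap; apply: eq_avg => Q2.
  by apply: eq_avg => P1'; rewrite avg_swap.
rewrite -avgMl.
rewrite -[@minors_mean F p m](avg_cst (0 : 'M[R]_(2, 3))); apply: avg_dist => // P1.
rewrite -avgMl -[@minors_mean F p m](avg_cst (0 : 'M[R]_3)); apply: avg_dist => // Q1.
rewrite -avgMl -[@minors_mean F p m](avg_cst (0 : 'M[R]_(2, 3))); apply: avg_dist => // P2.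
rewrite -avgMl -[@minors_mean F p m](avg_cst (0 : 'M[R]_3)); apply: avg_dist => // Q2.
rewrite -avgMl (minors_meanE P1^T P2^T); apply: avg_dist => // P1'.
rewrite -avgMl; apply: avg_dist => // P2'.
(* There are k = 6 unknowns, whence the requirement (k + 1) n = 7 n <= m. *)
have := @avg_perturbed_image F p p_pr m m_gt0 6 n (jac (P1' + P1^T) (P2' + P2^T))
  (quad_part Q1 Q2) (fun t y y' z => @quad_part_congr _ Q1 Q2 (p%:R ^+ t) y y' z) nm isT.
congr (`|_ * _ - _| <= _).
rewrite -avg_bin_coefs; apply: eq_avg => H1; apply: eq_avg => H2.
congr (nat_of_bool _)%:R; have [fr _ frK] := frame_bij.
rewrite /solvable; apply/existsP/existsP => [[y]|[Y]].
  by rewrite (mulnC 2) exprM -vanish_chart; exists (frame y).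
by rewrite -[Y]frK vanish_chart -exprM (mulnC n); exists (fr Y).
Qed.

End solvability.

(** * p-adic integers *)

Section padic_ring.
Context (p : nat) (p_pr : prime p).
Local Notation Zp := (padic_int p_pr).
Implicit Types x y z : Zp.

Lemma pX_gt0 n : (0 < p ^ n)%N. Proof. by rewrite expn_gt0 prime_gt0. Qed.

Lemma residue_ge0 x n : 0 <= x n.
Proof. by rewrite -residue_modz modz_ge0// eqz_nat -lt0n pX_gt0. Qed.

Lemma residue_lt x n : x n < (p ^ n)%N.
Proof. by rewrite -residue_modz ltz_pmod// ltz_nat pX_gt0. Qed.

Lemma residueD x y n : (x + y) n = ((x n + y n) %% (p ^ n)%N)%Z.
Proof. by []. Qed.

Lemma residueM x y n : (x * y) n = ((x n * y n) %% (p ^ n)%N)%Z.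
Proof. by []. Qed.

Lemma residueN x n : (- x) n = ((- x n) %% (p ^ n)%N)%Z.
Proof. by []. Qed.

Lemma residue0 n : (0 : Zp) n = 0.
Proof. by rewrite /= mod0z. Qed.

Lemma residue1 n : (1 : Zp) n = (1 %% (p ^ n)%N)%Z.
Proof. by []. Qed.

Lemma residue_nat c n : (c%:R : Zp) n = (c%:Z %% (p ^ n)%N)%Z.
Proof.
elim: c => [|c IH]; first by rewrite residue0 mod0z.
by rewrite -addn1 natrD residueD IH residue1 modzDm -PoszD.
Qed.

Definition rho m (x : Zp) : 'Z_(p ^ m) := (x m)%:~R.

Section rho.
Context (m : nat) (m_gt0 : (0 < m)%N).

Lemma intr_modz (a : int) : ((a %% (p ^ m)%N)%Z)%:~R = a%:~R :> 'Z_(p ^ m).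
Proof.
rewrite [in RHS](divz_eq a (p ^ m)%N) [RHS]intrD [X in _ = X + _]intrM.
by rewrite -(pmulrn 1) pchar_Zp ?Zpm_gt1// mulr0 add0r.
Qed.

Lemma rho_is_zmod_morphism : zmod_morphism (@rho m).
Proof.
by move=> x y; rewrite /rho residueD intr_modz intrD residueN intr_modz intrN.
Qed.

Lemma rho_is_monoid_morphism : monoid_morphism (@rho m).
Proof.
split=> [|x y]; first by rewrite /rho residue1 intr_modz.
by rewrite /rho residueM intr_modz intrM.
Qed.

Lemma rho_inj x y : rho m x = rho m y -> x m = y m.
Proof.
have H z : z m = (rho m z : nat)%:Z.
  rewrite /rho -[z m in RHS]gez0_abs ?residue_ge0// -pmulrn val_Zp_nat ?Zpm_gt1//.
  rewrite modn_small ?gez0_abs ?residue_ge0//.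
  by rewrite -ltz_nat gez0_abs ?residue_ge0// residue_lt.
by move=> e; rewrite !H e.
Qed.

Lemma rhoP x y : rho m x = rho m y <-> x m = y m.
Proof. by split=> [/rho_inj//|e]; rewrite /rho e. Qed.

Lemma rho_nat (a : 'Z_(p ^ m)) : rho m (a : nat)%:R = a.
Proof.
rewrite /rho residue_nat intr_modz -pmulrn natr_Zp//.
Qed.

End rho.

(** The quotient modulo p^k is read off x modulo p^(n + k). *)
Lemma residue_dvd x n : x n = 0 -> exists y, x = p%:R ^+ n * y.
Proof.
move=> xn0.
have dv k : x (n + k)%N = (p ^ n)%N%:Z * (x (n + k)%N %/ (p ^ n)%N)%Z.
  rewrite [LHS](divz_eq _ (p ^ n)%N) residue_le ?leq_addr// xn0 addr0.
  by rewrite mulrC.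
have pn0 : (p ^ n)%N%:Z != 0 by rewrite eqz_nat -lt0n pX_gt0.
have F k : ((x (n + k)%N %/ (p ^ n)%N)%Z = (x (n + k.+1)%N %/ (p ^ n)%N)%Z %[mod (p ^ k)%N])%Z.
  apply/eqP; rewrite eqz_mod_dvd -(dvdz_mul2l pn0).
  rewrite mulrBr -!dv addnS -PoszM -expnD -eqz_mod_dvd residue_modz.
  by rewrite residue_le ?leqnSn.
exists (padic_reduce p_pr F).
apply: padic_int_eqP => k.
rewrite residueM -natrX residue_nat /= modzMm -dv.
by rewrite -[LHS](residue_le x (leq_addl n k)).
Qed.

Lemma residue_mulp x n : (p%:R ^+ n * x) n = 0.
Proof.
by rewrite residueM -natrX residue_nat modzMml modzMr.
Qed.

Lemma residue_eq_dvd x y n : x n = y n -> exists z, x = y + p%:R ^+ n * z.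
Proof.
move=> xy; have [|z xz] := @residue_dvd (x - y) n.
  by rewrite residueD residueN xy modzDmr subrr mod0z.
by exists z; rewrite -xz addrC subrK.
Qed.

(** Bezout coefficients invert the residue at each level; they are coherent because inverses modulo
    p^k are unique. *)
Lemma residue1_unit x : x 1%N != 0 -> x \is a GRing.unit.
Proof.
move=> x1.
have cop k : coprimez (x k) (p ^ k)%N.
  case: k => [|k]; first by rewrite expn0 /coprimez gcdz1.
  rewrite coprimezE/= coprimeXr// coprime_sym prime_coprime//.
  apply: contra x1 => pxk; rewrite -(residue_le x (ltn0Sn k)) expn1.
  by apply/eqP/dvdz_mod0P; rewrite dvdzE.
pose f k := (egcdz (x k) (p ^ k)%N).1.
have fx k : (f k * x k = 1 %[mod (p ^ k)%N])%Z.
  rewrite /f; case: egcdzP => u v /= uv _.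
  move: uv; have /eqP -> := cop k => /(canRL (addrK _)) ->.
  by rewrite -mulNr addrC modzMDl.
have F k : (f k = f k.+1 %[mod (p ^ k)%N])%Z.
  have h : (f k.+1 * x k = 1 %[mod (p ^ k)%N])%Z.
    rewrite (residueP x k) modzMmr.
    by rewrite -(modz_expS p (f k.+1 * x k.+1)) fx modz_expS.
  apply/eqP; rewrite eqz_mod_dvd -(@Gauss_dvdzl _ _ (x k)) 1?coprimez_sym//.
  by rewrite mulrBl -eqz_mod_dvd fx h.
apply: (padic_unitP (y := padic_reduce p_pr F)).
by apply: padic_int_eqP => k; rewrite residueM /= modzMml fx.
Qed.

Lemma p_adic_decomp x : x != 0 ->
  exists t, exists2 u, u \is a GRing.unit & x = p%:R ^+ t * u.
Proof.
move=> x0; have : exists n, x n != 0 by exact: residue_neq0.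
case/ex_minnP => -[|n]; first by rewrite (residueP x 0) expn0 modz1.
move=> xn nmin; have /residue_dvd[u xu] : x n = 0.
  by apply/eqP/negPn/negP => /nmin; rewrite ltnn.
exists n, u => //; apply: residue1_unit; apply: contra xn => /eqP/residue_dvd[z uz].
by rewrite xu uz mulrA expr1 -exprSr residue_mulp.
Qed.

End padic_ring.

(** The exponent is m.+1 because ['Z_(p ^ 0)] is ['Z_1], which has two elements; the map [rho 0] is
    zero and does not preserve 1. *)
HB.instance Definition _ p (p_pr : prime p) m := GRing.isZmodMorphism.Build _ _
  (@rho p p_pr m.+1) (rho_is_zmod_morphism (ltn0Sn m)).
HB.instance Definition _ p (p_pr : prime p) m := GRing.isMonoidMorphism.Build _ _
  (@rho p p_pr m.+1) (rho_is_monoid_morphism p_pr (ltn0Sn m)).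

(** * Compactness of matrices over Z_p *)

Section koenig.
Context (p : nat) (p_pr : prime p) (a b : nat).
Local Notation Zp := (padic_int p_pr).
Implicit Types Y : 'M[Zp]_(a, b).

Definition eqmod n Y Y' : Prop := forall i j, Y i j n = Y' i j n.

Lemma eqmodP n Y Y' : (0 < n)%N ->
  eqmod n Y Y' <-> map_mx (@rho p p_pr n) Y = map_mx (@rho p p_pr n) Y'.
Proof.
move=> n0; split=> [e|/matrixP e i j].
  by apply/matrixP => i j; rewrite !mxE; apply/rhoP.
by have := e i j; rewrite !mxE => /(rho_inj n0).
Qed.

Lemma eqmod_le n k Y Y' : (n <= k)%N -> eqmod k Y Y' -> eqmod n Y Y'.
Proof. by move=> nk e i j; rewrite -!(residue_le _ nk) e. Qed.

(** A class modulo p^n that meets every G j splits into finitely many classes modulo p^(n+1); as G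
    decreases, one of these meets every G j too. The limit of a chain of such classes is in every G
    n, since G n is a union of classes modulo p^n. *)
Lemma koenig (G : nat -> 'M[Zp]_(a, b) -> Prop) :
  (forall n Y Y', eqmod n Y Y' -> G n Y -> G n Y') ->
  (forall n Y, G n.+1 Y -> G n Y) ->
  (forall n, exists Y, G n Y) -> exists Y, forall n, G n Y.
Proof.
move=> Gmod GS Gex.
have Gle n k Y : (n <= k)%N -> G k Y -> G n Y.
  by move=> /subnK <-; elim: (k - n)%N => // l IH; rewrite addSn => /GS.
pose good n Y := forall j, exists2 Y', eqmod n Y' Y & G j Y'.
have step n Y : good n Y -> exists2 Y1, eqmod n Y1 Y & good n.+1 Y1.
  move=> gY; apply: contrapT => H.
  have /fin_all_exists[j Hj] (c : 'M['Z_(p ^ n.+1)]_(a, b)) : exists j, forall Y',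
      map_mx (@rho p p_pr n.+1) Y' = c -> eqmod n Y' Y -> ~ G j Y'.
    apply: contrapT => Hc; apply: H.
    have {}Hc j : exists Y', [/\ map_mx (@rho p p_pr n.+1) Y' = c, eqmod n Y' Y & G j Y'].
      apply: contrapT => Hj; apply: Hc; exists j => Y' Yc YY GY.
      by apply: Hj; exists Y'.
    have [Y1 [Y1c Y1Y _]] := Hc 0%N.
    exists Y1 => // j; have [Y' [Yc _ GY]] := Hc j.
    by exists Y' => //; apply/eqmodP => //; rewrite Yc Y1c.
  (* If every finer class c missed some G (j c), the maximum of these levels would contradict
     [gY]. *)
  have [Y' YY GY] := gY (\max_c j c).
  by apply: (Hj _ _ erefl YY); apply: Gle GY; exact: leq_bigmax.
pose T := {nY : nat * 'M[Zp]_(a, b) | good nY.1 nY.2}.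
have good0 : good 0%N 0.
  move=> j; have [Y GY] := Gex j; exists Y => // i k.
  by rewrite [LHS]residueP [RHS]residueP expn0 !modz1.
have next (s : T) : {s' : T | (sval s').1 = (sval s).1.+1 &
    eqmod (sval s).1 (sval s').2 (sval s).2}.
  case: s => -[n Y] gY /=; apply: cid2.
  by have [Y1 Y1Y gY1] := step n Y gY; exists (exist _ (n.+1, Y1) gY1).
pose seq n : T := iter n (fun s => s2val (next s)) (exist _ (0%N, 0) good0).
have seq1 n : (sval (seq n)).1 = n.
  by elim: n => //= n IH; rewrite (s2valP (next (seq n))) IH.
pose Ys n := (sval (seq n)).2.
have YsS n : eqmod n (Ys n.+1) (Ys n).
  by have : eqmod (sval (seq n)).1 (Ys n.+1) (Ys n) := s2valP' (next (seq n));
    rewrite seq1.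
have F i j n : (Ys n i j n = Ys n.+1 i j n.+1 %[mod (p ^ n)%N])%Z.
  by rewrite residue_modz -YsS (residueP (Ys n.+1 i j)).
exists (\matrix_(i, j) padic_reduce p_pr (F i j)) => n.
have : good (sval (seq n)).1 (Ys n) := svalP (seq n).
rewrite seq1 => /(_ n)[Y' YY GY].
apply: Gmod GY => i j; rewrite mxE YY /=.
by rewrite residue_modz.
Qed.

End koenig.

(** * Quadratic forms and planes *)

Section quadratic_monomials.
Context (n : nat).

Definition quad_mnm (i j : 'I_n) : multinom n := mnm_add (mnm1 i) (mnm1 j).

Lemma mdeg_quad_mnm i j : mdeg (quad_mnm i j) == 2%N.
Proof. by rewrite mdegD !mdeg1. Qed.

Lemma quad_mnmC i j : quad_mnm i j = quad_mnm j i.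
Proof. by apply/mnmP => k; rewrite !mnmDE addnC. Qed.

Lemma quad_mnmP (m : multinom n) : mdeg m = 2%N ->
  exists i j : 'I_n, (i <= j)%N /\ m = quad_mnm i j.
Proof.
move=> m2; have /existsP[i mi] : [exists i, m i != 0%N].
  apply/existsPn => H; move: m2; rewrite mdegE big1// => i _.
  by have /negPn/eqP := H i.
have mE : mnm_add (mnm_sub m (mnm1 i)) (mnm1 i) = m by rewrite submK ?lep1mP.
have /mdeg1P[j /eqP mj] : mdeg (mnm_sub m (mnm1 i)) == 1%N.
  by rewrite -(eqn_add2r 1) -(mdeg1 i) -mdegD mE m2 mdeg1.
rewrite mj in mE; have [ij|/ltnW ji] := leqP i j.
  by exists i, j; rewrite quad_mnmC.
by exists j, i.
Qed.

Lemma quad_mnm_inj (i j k l : 'I_n) : (i <= j)%N -> (k <= l)%N ->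
  quad_mnm i j = quad_mnm k l -> i = k /\ j = l.
Proof.
move=> ij kl /mnmP e.
have E x := e x; move: E => /= E.
have {}E x : ((i == x) + (j == x) = (k == x) + (l == x))%N.
  by have := E x; rewrite !mnmDE !mnm1E.
have ik : i = k.
  apply/val_inj/eqP; rewrite eqn_leq; apply/andP; split; rewrite leqNgt; apply/negP => h.
    have := E k; rewrite eqxx -(inj_eq val_inj) gtn_eqF//.
    by rewrite -(inj_eq val_inj) gtn_eqF// (leq_trans h).
  have := E i; rewrite eqxx -!(inj_eq val_inj) (gtn_eqF h).
  by rewrite (gtn_eqF (leq_trans h kl)).
split=> //; apply/eqP; have := E l; rewrite ik eqxx => /addnI.
by case: (j == l).
Qed.

Lemma meval_quad (K : comNzRingType) (g : mpoly n K) (v : 'I_n -> K) :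
  (forall m, m \in msupp g -> mdeg m = 2%N) ->
  meval v g =
  \sum_(i < n) \sum_(j < n | (i <= j)%N) mcoeff (quad_mnm i j) g * (v i * v j).
Proof.
move=> g2; rewrite mevalE.
transitivity (\sum_(m <- msupp g) \sum_(i < n) \sum_(j < n | (i <= j)%N)
    (if m == quad_mnm i j then mcoeff m g * (v i * v j) else 0)).
  rewrite !big_seq; apply: eq_bigr => m /g2/quad_mnmP[i [j [ij ->]]].
  rewrite [RHS](bigD1 i)//= [X in _ = X + _](bigD1 j)//= eqxx [X in _ = _ + X + _]big1 ?[X in _ = _ + X]big1 ?addr0.
  - congr (_ * _); rewrite -/(mmap1 v _) /quad_mnm.
    rewrite -[v i](mmap1U v) -[v j](mmap1U v) /mmap1 -big_split/=.
    by apply: eq_bigr => k _; rewrite mnmDE exprD.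
  - move=> k ki; rewrite big1// => l kl; case: eqP => // /quad_mnm_inj[]// ik.
    by rewrite ik eqxx in ki.
  - move=> l /andP[il lj]; case: eqP => // /quad_mnm_inj[]// _ jl.
    by rewrite jl eqxx in lj.
rewrite exchange_big/=; apply: eq_bigr => i _.
rewrite exchange_big/=; apply: eq_bigr => j ij.
rewrite -big_mkcond/= -big_filter.
have [ms|ms] := boolP (quad_mnm i j \in msupp g).
  rewrite (_ : [seq m <- msupp g | m == quad_mnm i j] = [:: quad_mnm i j]) ?big_seq1//.
  by rewrite filter_pred1_uniq.
rewrite memN_msupp_eq0// mul0r big_seq big1// => m.
by rewrite mem_filter => /andP[/eqP ->]; rewrite (negbTE ms).
Qed.

End quadratic_monomials.

Section upper_matrix.
Context (p : nat) (p_pr : prime p) (n : nat).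
Local Notation Zp := (padic_int p_pr).

Definition quad_monomial (i j : 'I_n) : monomial n 2 :=
  exist (fun m : multinom n => mdeg m == 2%N) _ (mdeg_quad_mnm i j).

Definition upper_mx (f : quantic p_pr n 2) : 'M[Zp]_n :=
  \matrix_(i, j) if (i <= j)%N then form_coef (quad_monomial i j) f else 0.

Lemma form_evalE (f : quantic p_pr n 2) (v : 'rV[padic p_pr]_n) :
  form_eval f v = (v *m map_mx (@tofrac Zp) (upper_mx f) *m v^T) 0 0.
Proof.
rewrite /form_eval meval_quad => [|m].
  rewrite -mulmxA mxE; apply: eq_bigr => i _; rewrite mxE mulr_sumr big_mkcond.
  apply: eq_bigr => j _; rewrite !mxE; case: ifP => _.
    by rewrite mcoeff_map_mpoly mulrCA.
  by rewrite rmorph0 mul0r mulr0.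
rewrite mcoeff_msupp mcoeff_map_mpoly => fm.
have /dhomogP H := dhomog_is_dhomog f; apply: H.
by rewrite mcoeff_msupp; apply: contra fm => /eqP ->; rewrite raddf0.
Qed.

End upper_matrix.

Lemma frac_decomp (D : idomainType) (x : {fraction D}) :
  exists n d : D, d != 0 /\ x * tofrac d = tofrac n.
Proof.
exists (repr x).1, (repr x).2; split; first exact: denom_ratioP.
rewrite -{1}[x]reprK; move: (repr x) (denom_ratioP (repr x)) => r d0.
unlock tofrac; rewrite -[LHS]FracField.pi_mul.
apply/eqP; rewrite FracField.equivf_def /FracField.mulf.
by rewrite !numden_Ratio ?oner_neq0 ?mulr1// mulrC.
Qed.

Section row_space.
Context (K : fieldType) (n : nat).

Definition rowsp (b : 'M[K]_(2, n)) : {vspace 'rV[K]_n} := limg (linfun (mulmxr b)).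

Lemma rowspP (b : 'M[K]_(2, n)) v :
  reflect (exists x : 'rV_2, v = x *m b) (v \in rowsp b).
Proof.
apply: (iffP memv_imgP) => [[x _ ->]|[x ->]]; exists x; rewrite ?memvf ?lfunE//.
Qed.

Lemma dim_rowsp (b : 'M[K]_(2, n)) : (forall x : 'rV_2, x *m b = 0 -> x = 0) ->
  \dim (rowsp b) = 2%N.
Proof.
move=> inj; rewrite /rowsp limg_dim_eq ?dimvf//.
apply/eqP; rewrite -subv0; apply/subvP => x; rewrite memv_cap => /andP[_].
by rewrite memv_ker lfunE/= => /eqP/inj ->; rewrite mem0v.
Qed.

Lemma rowsp_ex (L : {vspace 'rV[K]_n}) : \dim L = 2%N ->
  exists2 b : 'M[K]_(2, n), L = rowsp b & forall x : 'rV_2, x *m b = 0 -> x = 0.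
Proof.
move=> L2; have [X XL] : exists X : 2.-tuple 'rV[K]_n, basis_of L X.
  by exists (tcast L2 (vbasis L)); rewrite val_tcast vbasisP.
pose b : 'M[K]_(2, n) := \matrix_i X`_i.
have mulb (x : 'rV_2) : x *m b = \sum_(i < 2) x 0 i *: X`_i.
  by rewrite mulmx_sum_row; apply: eq_bigr => i _; rewrite rowK.
exists b.
  apply/vspaceP => v; apply/idP/rowspP => [vL|[x ->]].
    exists (\row_i coord X i v); rewrite mulb [LHS](coord_basis XL vL).
    by apply: eq_bigr => i _; rewrite mxE.
  rewrite mulb; apply: memv_suml => i _; apply: memvZ; apply: (basis_mem XL).
  by rewrite mem_nth// size_tuple.
move=> x; rewrite mulb => x0; apply/rowP => i; rewrite mxE.
by have /freeP/(_ (fun i => x 0 i) x0) := basis_free XL; apply.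
Qed.

(** A Plucker coordinate of the row space of b. *)
Definition plu (K : comPzRingType) n (b : 'M[K]_(2, n)) k l :=
  b 0 k * b 1 l - b 0 l * b 1 k.

Lemma plu_neq0 (b : 'M[K]_(2, n)) : (forall x : 'rV_2, x *m b = 0 -> x = 0) ->
  exists k l, plu b k l != 0.
Proof.
move=> inj; apply/not_existsP => H.
have {}H k l : b 0 k * b 1 l = b 0 l * b 1 k.
  apply/eqP; rewrite -subr_eq0; apply/negPn/negP => kl.
  by apply: (H k); exists l.
have mulb (x : 'rV_2) k : (x *m b) 0 k = x 0 0 * b 0 k + x 0 1 * b 1 k.
  rewrite mxE !big_ord_recl big_ord0 addr0.
  by congr (_ + x _ _ * b _ _); apply/val_inj.
pose vec (s t : K) : 'rV[K]_2 := \row_i (if i == 0 then s else t).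
have [b0|/existsP[k bk]] := boolP [forall k, b 0 k == 0].
  have /rowP/(_ 0) : vec 1 0 = 0.
    by apply: inj; apply/rowP => k; rewrite mulb !mxE/= (eqP (forallP b0 k)); ring.
  by rewrite !mxE/= => /eqP; rewrite oner_eq0.
have /rowP/(_ 1) : vec (b 1 k) (- b 0 k) = 0.
  apply: inj; apply/rowP => l; rewrite mulb !mxE/=.
  by rewrite mulNr (H k l); ring.
by rewrite !mxE/= => /eqP; rewrite oppr_eq0 (negbTE bk).
Qed.

End row_space.

Section alternation.
Context (p : nat) (p_pr : prime p).
Local Notation Zp := (padic_int p_pr).
Local Notation K := (padic p_pr).
Local Notation phi := (@tofrac Zp).

Lemma sum_form2 (S : comPzRingType) (E : 'M[S]_2) (x : 'rV[S]_2) :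
  (x *m E *m x^T) 0 0 = x 0 0 ^+ 2 * E 0 0 + x 0 0 * x 0 1 * (E 0 1 + E 1 0) +
    x 0 1 ^+ 2 * E 1 1.
Proof.
rewrite !mxE !big_ord_recl !big_ord0 !mxE !big_ord_recl !big_ord0 ?mxE.
rewrite (_ : lift ord0 ord0 = 1); last exact/val_inj.
by rewrite (_ : ord0 = 0)//; ring.
Qed.

Lemma alt2P (E : 'M[Zp]_2) :
  alt2 E <-> forall x : 'rV[K]_2, (x *m map_mx phi E *m x^T) 0 0 = 0.
Proof.
split=> [/and3P[/eqP E00 /eqP E01 /eqP E11] x|H].
  rewrite sum_form2 !mxE -rmorphD/= E00 E01 E11 rmorph0.
  by rewrite !mulr0 !addr0.
pose vec (s t : K) : 'rV[K]_2 := \row_i (if i == 0 then s else t).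
have E0 : E 0 0 = 0.
  apply/eqP; rewrite -tofrac_eq0; have := H (vec 1 0); rewrite sum_form2 !mxE/=.
  by rewrite expr1n expr0n/= mulr0 !mul0r !addr0 mul1r => ->.
have E1 : E 1 1 = 0.
  apply/eqP; rewrite -tofrac_eq0; have := H (vec 0 1); rewrite sum_form2 !mxE/=.
  by rewrite expr1n expr0n/= !mul0r !add0r mul1r => ->.
apply/and3P; rewrite E0 E1; split=> //.
rewrite -tofrac_eq0 rmorphD/=; have := H (vec 1 1); rewrite sum_form2 !mxE/=.
by rewrite E0 E1 !expr1n rmorph0 !mulr0 addr0 add0r !mul1r => ->.
Qed.

Lemma vanish_rowsp (n : nat) (f : quantic p_pr n 2) (B : 'M[Zp]_(2, n)) :
  (forall v, v \in rowsp (map_mx phi B) -> form_eval f v = 0) <->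
  vanish (upper_mx f) B.
Proof.
rewrite /vanish; split=> [H|/alt2P H v /rowspP[x ->]].
  apply/alt2P => x; have := H (x *m map_mx phi B) (introT (rowspP _ _) (ex_intro _ x erefl)).
  by rewrite form_evalE !map_mxM -map_trmx trmx_mul !mulmxA.
by have := H x; rewrite form_evalE !map_mxM -map_trmx trmx_mul !mulmxA.
Qed.

End alternation.

(* Membership of x at (r, k) in a reduced echelon matrix with pivot columns i
   and j; [pd] stands for divisibility by p. *)
Definition ech_entry (S : comNzRingType) (pd : pred S) n (i j : 'I_n)
    (r : 'I_2) (k : 'I_n) (x : S) : bool :=
  if r == 0 then if k == i then x == 1 else if k == j then x == 0
                 else (k < i)%N ==> pd x
  else if k == i then x == 0 else if k == j then x == 1
       else (k < j)%N ==> pd x.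

Definition ech (S : comNzRingType) (pd : pred S) n (i j : 'I_n)
    (B : 'M[S]_(2, n)) : bool :=
  [forall r, forall k, ech_entry pd i j r k (B r k)].

Lemma exists_max (T : finType) (K : Type) (le : K -> K -> Prop) (f : T -> K) :
  (forall x, le x x) ->
  (forall x y z, le x y -> le y z -> le x z) -> (forall x y, le x y \/ le y x) ->
  forall t : T, exists x, forall y, le (f y) (f x).
Proof.
move=> refl trans total t.
have H (s : seq T) : exists x, forall y, y \in s -> le (f y) (f x).
  elim: s => [|y s [x IH]]; first by exists t.
  have [yx|xy] := total (f y) (f x).
    by exists x => z; rewrite inE => /orP[/eqP ->//|/IH].
  exists y => z; rewrite inE => /orP[/eqP ->//|/IH zx]; exact: trans zx xy.
have [x Hx] := H (enum T); exists x => y; apply: Hx; exact: mem_enum.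
Qed.

Lemma det_form2 (S : comPzRingType) (h : 'M[S]_2) n (b : 'M[S]_(2, n)) k l :
  plu (h *m b) k l = \det h * plu b k l.
Proof.
rewrite det_mx22 /plu !mxE !big_ord_recl !big_ord0.
rewrite (_ : lift ord0 ord0 = 1); last exact/val_inj.
by rewrite (_ : ord0 = 0)//; ring.
Qed.

Lemma cross_mul (S : comPzRingType) (x y b d z : S) :
  x * b * d = z * (y * d * b) -> x * (b * d) = z * y * (b * d).
Proof. by move=> e; rewrite [LHS]mulrA e; ring. Qed.

(** * Reduced echelon matrices *)

Section echelon.
Context (p : nat) (p_pr : prime p) (n : nat).
Local Notation Zp := (padic_int p_pr).
Local Notation K := (padic p_pr).
Local Notation phi := (@tofrac Zp).
Implicit Types (i j k l : 'I_n).

Definition pdiv1 : pred Zp := fun x => x 1%N == 0.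

Lemma pdiv1M x y : pdiv1 x -> pdiv1 (x * y).
Proof. by rewrite /pdiv1 residueM => /eqP ->; rewrite mul0r mod0z. Qed.

Lemma pdiv1B x y : pdiv1 x -> pdiv1 y -> pdiv1 (x - y).
Proof.
rewrite /pdiv1 residueD residueN => /eqP -> /eqP ->.
by rewrite oppr0 mod0z addr0 mod0z.
Qed.

Lemma pdiv1_1 : pdiv1 1 = false.
Proof.
by rewrite /pdiv1 residue1 expn1 modz_small//= ltz_nat prime_gt1.
Qed.

Lemma pdiv1_unit x : ~~ pdiv1 x -> x \is a GRing.unit.
Proof. exact: residue1_unit. Qed.

Local Notation ech := (ech pdiv1).

Lemma ech_minor1 i j B : (i < j)%N -> ech i j B -> plu B i j = 1.
Proof.
move=> ij /forallP e; have := (e 0, e 1) => -[/forallP e0 /forallP e1].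
have ji : j == i = false by apply/negbTE; rewrite -val_eqE gtn_eqF.
have := (e0 i, e0 j, e1 i, e1 j); rewrite /ech_entry !eqxx ji /=.
move=> [[[/eqP a /eqP b] /eqP c] /eqP d].
by rewrite /plu a b c d mulr1 mul0r subr0.
Qed.

Lemma ech_minor_lt i j k l B : (i < j)%N -> (k < l)%N -> ech i j B ->
  (k < i)%N || (k == i) && (l < j)%N -> pdiv1 (plu B k l).
Proof.
move=> ij kl /forallP e; have := (e 0, e 1) => -[/forallP e0 /forallP e1].
case/orP => [ki|/andP[/eqP ki lj]]; last subst k.
  have k1 : k == i = false by apply/negbTE; rewrite -val_eqE ltn_eqF.
  have kj := ltn_trans ki ij.
  have k2 : k == j = false by apply/negbTE; rewrite -val_eqE ltn_eqF.
  have := (e0 k, e1 k); rewrite /ech_entry k1 k2 ki kj /= => -[p0 p1].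
  by rewrite /plu; apply: pdiv1B; [|rewrite mulrC]; apply: pdiv1M.
have li : l == i = false by apply/negbTE; rewrite -val_eqE gtn_eqF.
have l2 : l == j = false by apply/negbTE; rewrite -val_eqE ltn_eqF.
have := (e0 i, e1 i, e1 l); rewrite /ech_entry !eqxx li l2 lj /=.
by move=> [[/eqP a /eqP b] c]; rewrite /plu a b mul1r mulr0 subr0.
Qed.

Lemma plu_map k l (B : 'M[Zp]_(2, n)) : plu (map_mx phi B) k l = phi (plu B k l).
Proof. by rewrite /plu !mxE rmorphB !rmorphM. Qed.

Lemma rowsp_mul (b b' : 'M[K]_(2, n)) : rowsp b = rowsp b' ->
  exists h : 'M[K]_2, b' = h *m b.
Proof.
move=> e; have /fin_all_exists[x xE] (r : 'I_2) : exists x : 'rV[K]_2, row r b' = x *m b.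
  by apply/rowspP; rewrite e; apply/rowspP; exists (delta_mx 0 r); rewrite -rowE.
exists (\matrix_r x r); apply/row_matrixP => r.
by rewrite xE row_mul rowK.
Qed.

(** If B' = h B, comparing the minors at the two pivot pairs gives 1 = [plu B' i j * plu B i' j'].
    For (i', j') lexicographically before (i, j) the second factor would be divisible by p. *)
Lemma ech_inj_lt i j B i' j' B' : (i < j)%N -> (i' < j')%N ->
  ech i j B -> ech i' j' B' -> rowsp (map_mx phi B) = rowsp (map_mx phi B') ->
  ~~ ((i' < i)%N || (i' == i) && (j' < j)%N).
Proof.
move=> ij ij' eB eB' /rowsp_mul[h hE]; apply/negP => lt.
have := det_form2 h (map_mx phi B) i' j'; have := det_form2 h (map_mx phi B) i j.
rewrite -hE !plu_map (ech_minor1 ij eB) (ech_minor1 ij' eB') rmorph1 mulr1 => <-.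
rewrite -(tofrac1 Zp) -tofracM => /eqP; rewrite tofrac_eq => /eqP e.
have := pdiv1M (plu B' i j) (ech_minor_lt ij ij' eB lt).
by rewrite mulrC -e pdiv1_1.
Qed.

Lemma ech_inj i j B i' j' B' : (i < j)%N -> (i' < j')%N ->
  ech i j B -> ech i' j' B' -> rowsp (map_mx phi B) = rowsp (map_mx phi B') ->
  [/\ i = i', j = j' & B = B'].
Proof.
move=> ij ij' eB eB' e.
have := ech_inj_lt ij ij' eB eB' e; have := ech_inj_lt ij' ij eB' eB (esym e).
rewrite -!val_eqE !negb_or !negb_and => /andP[l1 l2] /andP[l3 l4].
have ii : i = i' by apply/val_inj => /=; move: l1 l3; lia.
have jj : j = j' by apply/val_inj => /=; move: l2 l4; rewrite ii eqxx /=; lia.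
split=> //; subst i' j'.
have [h hE] := rowsp_mul e.
(* Columns i and j form the identity both in B and in B' = h B. *)
have h1 : h = 1%:M.
  have ji : j == i = false by apply/negbTE; rewrite -val_eqE gtn_eqF.
  have hc k r : (h *m map_mx phi B) r k = h r 0 * phi (B 0 k) + h r 1 * phi (B 1 k).
    rewrite mxE !big_ord_recl big_ord0 addr0 !mxE.
    by congr (_ + h _ _ * phi (B _ _)); apply/val_inj.
  apply/matrixP => r c.
  move/forallP: eB => e1; have := (e1 0, e1 1) => -[/forallP e10 /forallP e11].
  move/forallP: eB' => e2; have := (e2 0, e2 1) => -[/forallP e20 /forallP e21].
  have := (e10 i, e10 j, e11 i, e11 j); rewrite /ech_entry !eqxx ji /=.
  move=> [[[/eqP a1 /eqP b1] /eqP c1] /eqP d1].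
  have := (e20 i, e20 j, e21 i, e21 j); rewrite /ech_entry !eqxx ji /=.
  move=> [[[/eqP a2 /eqP b2] /eqP c2] /eqP d2].
  have hi := hc i r; have hj := hc j r.
  move: hi hj; rewrite -hE !mxE a1 b1 c1 d1 rmorph1 rmorph0 !mulr1 !mulr0 addr0 add0r.
  case: r c => [[|[|]]] // r2 [[|[|]]] // c2'.
  - rewrite (_ : Ordinal r2 = 0); last exact/val_inj.
    rewrite (_ : Ordinal c2' = 0); last exact/val_inj.
    by rewrite a2 rmorph1 eqxx mulr1n => <-.
  - rewrite (_ : Ordinal r2 = 0); last exact/val_inj.
    rewrite (_ : Ordinal c2' = 1); last exact/val_inj.
    by rewrite b2 rmorph0 => _ <-.
  - rewrite (_ : Ordinal r2 = 1); last exact/val_inj.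
    rewrite (_ : Ordinal c2' = 0); last exact/val_inj.
    by rewrite c2 rmorph0 => <-.
  - rewrite (_ : Ordinal r2 = 1); last exact/val_inj.
    rewrite (_ : Ordinal c2' = 1); last exact/val_inj.
    by rewrite d2 rmorph1 eqxx mulr1n => _ <-.
apply/matrixP => r k; move/matrixP/(_ r k): hE.
by rewrite h1 mul1mx !mxE => /eqP; rewrite tofrac_eq => /eqP.
Qed.

(** The order |x| <= |y| of p-adic absolute values, expressed by divisibility in Z_p. *)
Definition integral_le (x y : K) : Prop := exists z : Zp, x = phi z * y.

Lemma integral_le_total x y : integral_le x y \/ integral_le y x.
Proof.
have dvd_total (a b : Zp) : (exists c, a = c * b) \/ (exists c, b = c * a).
  have [->|a0] := eqVneq a 0; first by left; exists 0; rewrite mul0r.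
  have [->|b0] := eqVneq b 0; first by right; exists 0; rewrite mul0r.
  have [s [u uu ->]] := p_adic_decomp a0; have [t [v vu ->]] := p_adic_decomp b0.
  have [st|/ltnW ts] := leqP s t.
    right; exists (p%:R ^+ (t - s) * (v / u)).
    by rewrite mulrACA -exprD subnK// divrK.
  left; exists (p%:R ^+ (s - t) * (u / v)).
  by rewrite mulrACA -exprD subnK// divrK.
have [a [b [b0 xb]]] := frac_decomp x; have [c [d [d0 yd]]] := frac_decomp y.
have bd0 : phi b * phi d != 0 by rewrite mulf_neq0 ?tofrac_eq0.
case: (dvd_total (a * d) (c * b)) => -[z zE]; [left|right]; exists z.
  apply: (mulIf bd0); apply: cross_mul; rewrite xb yd -!tofracM.
  by rewrite zE.
apply: (mulIf bd0); rewrite [phi b * _]mulrC; apply: cross_mul.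
by rewrite xb yd -!tofracM zE.
Qed.

Lemma ech_ex (L : {vspace 'rV[K]_n}) : \dim L = 2%N ->
  exists i j B, [/\ (i < j)%N, ech i j B & L = rowsp (map_mx phi B)].
Proof.
move=> /rowsp_ex[b -> binj].
have le_refl x : integral_le x x by exists 1; rewrite rmorph1 mul1r.
have le_trans x y z : integral_le x y -> integral_le y z -> integral_le x z.
  by move=> [u ->] [v ->]; exists (u * v); rewrite rmorphM mulrA.
pose D (kl : 'I_n * 'I_n) := plu b kl.1 kl.2.
pose mx := [pred kl | `[< forall kl', integral_le (D kl') (D kl) >]].
have [k0 [l0 D0]] := plu_neq0 binj.
have [t tmax] := exists_max D le_refl le_trans integral_le_total (k0, l0).
have tmx : mx t by apply/asboolP.
(* The number n k + l is the rank of (k, l) in the lexicographic order. *)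
case: (@arg_minnP _ t mx (fun kl => n * kl.1 + kl.2)%N tmx) => -[i j] /asboolP ijmax ijmin.
have Dij : D (i, j) != 0.
  apply: contra D0 => /eqP Dij; have [z] := ijmax (k0, l0).
  by rewrite Dij mulr0 => e; apply/eqP.
have minimal (kl : 'I_n * 'I_n) : (n * kl.1 + kl.2 < n * i + j)%N -> forall u : Zp,
    D kl = phi u * D (i, j) -> pdiv1 u.
  move=> lt u Du; apply: contraTT lt => /pdiv1_unit uu; rewrite -leqNgt.
  apply: (ijmin kl); apply/asboolP => kl'; apply: le_trans (ijmax kl') _.
  by exists u^-1; rewrite Du mulrA -rmorphM/= mulVr// rmorph1 mul1r.
(* The pair (j, i) has the opposite minor, which is maximal as well, so that minimality excludes j <
   i. *)
have ij : (i < j)%N.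
  rewrite ltn_neqAle; apply/andP; split.
    apply: contra Dij => /eqP/val_inj ->; rewrite /D /plu/=.
    by rewrite subrr.
  rewrite leqNgt; apply/negP => ji.
  have : pdiv1 (-1).
    apply: (minimal (j, i)); first by have := ltn_ord i; have := ltn_ord j; move=> /=; nia.
    by rewrite /D /plu/= rmorphN rmorph1 mulN1r opprB.
  by move=> /(pdiv1M (-1)); rewrite mulrNN mulr1 pdiv1_1.
(* Cramer's rule: column k of the reduced matrix has the entries D(k, j) / D(i, j) and D(i, k) /
   D(i, j), integral because D(i, j) is maximal. *)
have /fin_all_exists[z0 z0E] k := ijmax (k, j).
have /fin_all_exists[z1 z1E] k := ijmax (i, k).
pose B : 'M[Zp]_(2, n) := \matrix_(r, k) if r == 0 then z0 k else z1 k.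
have eB : ech i j B.
  have phi_inj z c : phi c * D (i, j) = phi z * D (i, j) -> z = c.
    by move=> /(mulIf Dij)/eqP; rewrite tofrac_eq => /eqP.
  apply/forallP => r; apply/forallP => k; rewrite mxE /ech_entry.
  case: (r == 0).
    case: eqP => [->|/eqP ki].
      by apply/eqP/phi_inj; rewrite rmorph1 mul1r; exact: z0E.
    case: eqP => [->|/eqP kj].
      by apply/eqP/phi_inj; rewrite rmorph0 mul0r -z0E /D /plu subrr.
    apply/implyP => lt; apply: (minimal (k, j)) => //.
    by have := ltn_ord j; move=> /=; nia.
  case: eqP => [->|/eqP ki].
    by apply/eqP/phi_inj; rewrite rmorph0 mul0r -z1E /D /plu subrr.
  case: eqP => [->|/eqP kj].
    by apply/eqP/phi_inj; rewrite rmorph1 mul1r; exact: z1E.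
  apply/implyP => lt; apply: (minimal (i, k)) => //=.
  by rewrite ltn_add2l.
exists i, j, B; split=> //.
(* The inverse of the block of b in columns i and j. *)
pose h : 'M[K]_2 := \matrix_(r, c) ((D (i, j))^-1 *
  (if r == 0 then if c == 0 then b 1 j else - b 0 j
   else if c == 0 then - b 1 i else b 0 i)).
have hE : map_mx phi B = h *m b.
  apply/matrixP => r k; rewrite mxE mxE [RHS]mxE !big_ord_recl big_ord0 addr0.
  rewrite (_ : lift ord0 ord0 = 1); last exact/val_inj.
  rewrite (_ : ord0 = 0)// !mxE/= -!mulrA -mulrDr.
  apply: (mulIf Dij); rewrite mulrAC mulVf// mul1r.
  case: (r == 0).
    by rewrite -z0E /D /plu/= mulNr mulrC [b 0 j * _]mulrC.
  by rewrite -z1E /D /plu/= mulNr [RHS]addrC [b 1 i * _]mulrC.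
have hdet : \det h != 0.
  apply/eqP => h0; have := det_form2 h b i j.
  by rewrite h0 mul0r -hE plu_map (ech_minor1 ij eB) => /eqP; rewrite tofrac_eq0 oner_eq0.
apply/vspaceP => v; apply/rowspP/rowspP => -[x ->]; last first.
  by exists (x *m h); rewrite hE mulmxA.
exists (x *m invmx h); rewrite hE mulmxA mulmxKV// unitmxE unitfE//.
Qed.

End echelon.

Lemma perm_to_pair (T : finType) (a b i j : T) : a != b -> i != j ->
  exists s : {perm T}, s a = i /\ s b = j.
Proof.
move=> ab ij; exists (tperm b (tperm a i j) * tperm a i)%g; rewrite !permM.
rewrite tpermL tpermK; split=> //.
rewrite [tperm b _ a]tpermD ?tpermL 1?eq_sym//.
by rewrite eq_sym (can2_eq (tpermK _ _) (tpermK _ _)) tpermL eq_sym.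
Qed.

(** * Classes of planes as charts, and solvability modulo all powers of p *)

Section cells.
Context (p : nat) (p_pr : prime p).
Local Notation Zp := (padic_int p_pr).
Local Notation ech := (ech (@pdiv1 p p_pr)).
Implicit Types (i j k : 'I_(2 + 3)).

Lemma vanish_mul (S : comNzRingType) a b (C : 'M[S]_b) (B : 'M[S]_(2, a))
  (g : 'M[S]_(a, b)) :
  vanish C (B *m g) = vanish (g *m C *m g^T) B.
Proof. by rewrite /vanish trmx_mul !mulmxA. Qed.

(** The permutation s moves the first two columns to the pivot columns, and u supplies the entries
    of B0 outside them, so that Y = 0 gives B0. As n > 0, congruence to B0 preserves its
    divisibility conditions by p. *)
Lemma cell_frame n i j (B0 : 'M[Zp]_(2, 2 + 3)) : (0 < n)%N -> (i < j)%N -> ech i j B0 ->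
  exists2 g : 'M[Zp]_(2 + 3), g \in unitmx & forall B,
    ech i j B /\ eqmod n B B0 <-> exists Y, B = chart (p%:R ^+ n) Y *m g.
Proof.
move=> n0 ij eB0.
have ji : j == i = false by apply/negbTE; rewrite -val_eqE gtn_eqF.
have [||s [s0 s1]] := @perm_to_pair _ (lshift 3 (0 : 'I_2)) (lshift 3 1) i j => //.
  by rewrite eq_sym ji.
have echi B : ech i j B -> forall r : 'I_2, B r i = (r == 0)%:R /\ B r j = (r == 1)%:R.
  move=> /forallP e r; have := e r => /forallP er; have := (er i, er j).
  rewrite /ech_entry !eqxx ji.
  by case: r {er} => [[|[|]]] //= ? [/eqP -> /eqP ->].
have colp B : ech i j B -> col_perm s B = row_mx 1%:M (rsubmx (col_perm s B)).
  move=> /echi e; rewrite -[LHS]hsubmxK; congr row_mx.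
  apply/matrixP => r c; rewrite !mxE; have [ei ej] := e r.
  case: c => [[|[|]]] // c2.
    rewrite (_ : Ordinal c2 = 0) ?s0 ?ei; last exact/val_inj.
    by case: r {ei ej} => [[|[|]]].
  rewrite (_ : Ordinal c2 = 1) ?s1 ?ej; last exact/val_inj.
  by case: r {ei ej} => [[|[|]]].
pose A0 := rsubmx (col_perm s B0 : 'M[Zp]_(2, 2 + 3)).
pose u : 'M[Zp]_(2 + 3) := block_mx 1%:M A0 0 1%:M.
have chu Y : chart (p%:R ^+ n) Y *m u = row_mx 1%:M (A0 + p%:R ^+ n *: Y).
  by rewrite /chart /u mul_row_block !mulmx1 mul1mx mulmx0 addr0.
have permE (W : 'M[Zp]_(2, 2 + 3)) r k : (W *m perm_mx s) r (s k) = W r k.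
  by rewrite -[s in perm_mx s]invgK -col_permE mxE permK.
exists (u *m perm_mx s).
  by rewrite unitmx_mul unitmx_perm andbT unitmxE det_ublock !det1 mulr1 unitr1.
have charte Y : chart (p%:R ^+ n) Y *m (u *m perm_mx s) =
    B0 + p%:R ^+ n *: (row_mx 0 Y *m perm_mx s).
  apply/matrixP => r k; rewrite -[k](permKV s); move: (s^-1%g k) => {}k.
  rewrite mulmxA (permE (chart _ Y *m u)) chu [RHS]mxE [X in _ = _ + X]mxE (permE (row_mx 0 Y)).
  rewrite -[B0 r _](_ : col_perm s B0 r k = _); last by rewrite mxE.
  rewrite (colp _ eB0) -/A0 -[RHS](_ : (row_mx 1%:M A0 + p%:R ^+ n *: row_mx 0 Y) r k = _);
    last by rewrite mxE [X in _ + X]mxE.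
  by rewrite scale_row_mx add_row_mx scaler0 addr0.
move=> B; split=> [[eB BB0]|[Y ->]].
  have /fin_all_exists[Y YE] (rc : 'I_2 * 'I_3) : exists y,
      B rc.1 (s (rshift 2 rc.2)) = B0 rc.1 (s (rshift 2 rc.2)) + p%:R ^+ n * y.
    exact: residue_eq_dvd (BB0 _ _).
  exists (\matrix_(r, c) Y (r, c)); apply/matrixP => r k.
  rewrite -[k](permKV s); move: (s^-1%g k) => {}k; rewrite mulmxA permE chu.
  rewrite -[LHS](_ : col_perm s B r k = _); last by rewrite mxE.
  rewrite (colp _ eB); congr (row_mx _ _ r k); apply/matrixP => {}r c.
  by rewrite !mxE (YE (r, c)).
have ne k : exists y : 'I_2 -> Zp, forall r, (chart (p%:R ^+ n) Y *m (u *m perm_mx s)) r k =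
    B0 r k + p%:R ^+ n * y r /\ (k = i \/ k = j -> y r = 0).
  exists (fun r => (row_mx 0 Y *m perm_mx s) r k) => r.
  rewrite charte mxE [X in _ + X]mxE; split=> //.
  by move=> [->|->]; rewrite -?s0 -?s1 permE mxE; case: splitP => // c /= ?; rewrite mxE.
have res k r : (chart (p%:R ^+ n) Y *m (u *m perm_mx s)) r k n = B0 r k n.
  have [y yE] := ne k; have [-> _] := yE r.
  by rewrite residueD residue_mulp addr0 residue_modz.
split; last by move=> r k; exact: res.
apply/forallP => r; apply/forallP => k.
have pd : pdiv1 ((chart (p%:R ^+ n) Y *m (u *m perm_mx s)) r k) = pdiv1 (B0 r k).
  by rewrite /pdiv1 -!(residue_le _ n0) res.
have [y yE] := ne k; have [e e0] := yE r.
move/forallP/(_ r)/forallP/(_ k): eB0; rewrite /ech_entry pd.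
case: (r == 0); (case: eqP => [ki|_]; first by rewrite e (e0 (or_introl ki)) mulr0 addr0);
  by case: eqP => [kj|_] //; rewrite e (e0 (or_intror kj)) mulr0 addr0.
Qed.

Section residual.
Context (a b : nat).

(** Residues, instead of [vanish] over Z/p^m, make sense at m = 0 too, where the condition is
    vacuous; [koenig] starts there. *)
Definition resvanish m (C : 'M[Zp]_b) (B : 'M[Zp]_(2, b)) : bool :=
  let E := B *m C *m B^T in
  [&& E 0 0 m == 0, (E 0 1 + E 1 0) m == 0 & E 1 1 m == 0].

Lemma rho_eq0 m (x : Zp) : (@rho p p_pr m.+1 x == 0) = (x m.+1 == 0).
Proof.
rewrite -(rmorph0 (@rho p p_pr m.+1)) -[in RHS](residue0 p_pr m.+1).
by apply/eqP/eqP => /rhoP; [exact|move=> h; apply: h].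
Qed.

Lemma resvanishE m C B : resvanish m.+1 C B =
  vanish (map_mx (@rho p p_pr m.+1) C) (map_mx (@rho p p_pr m.+1) B).
Proof.
rewrite /vanish map_trmx -!map_mxM /alt2 !mxE -rmorphD /= !rho_eq0.
by rewrite /resvanish !mxE.
Qed.

Lemma resvanishS m C B : resvanish m.+1 C B -> resvanish m C B.
Proof.
move=> /and3P[/eqP x /eqP y /eqP z].
by apply/and3P; split; rewrite residueP ?x ?y ?z mod0z.
Qed.

Lemma vanishP C B : vanish C B <-> forall m, resvanish m C B.
Proof.
split=> [/and3P[/eqP x /eqP y /eqP z] m|H].
  by apply/and3P; rewrite x y z residue0.
have pt (x : Zp) : (forall m, x m == 0) -> x == 0.
  by move=> x0; apply/eqP/padic_int_eqP => m; rewrite residue0; exact/eqP.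
by apply/and3P; split; apply: pt => m; case/and3P: (H m).
Qed.

End residual.

Lemma chart_map m n (Y : 'M[Zp]_(2, 3)) :
  map_mx (@rho p p_pr m.+1) (chart (p%:R ^+ n) Y) =
  chart (p%:R ^+ n) (map_mx (@rho p p_pr m.+1) Y).
Proof.
by rewrite /chart map_row_mx map_mx1 map_mxZ rmorphXn/= rmorph_nat.
Qed.

Lemma map_rho_surj m k l (Y : 'M['Z_(p ^ m.+1)]_(k, l)) :
  exists Y' : 'M[Zp]_(k, l), map_mx (@rho p p_pr m.+1) Y' = Y.
Proof.
exists (map_mx (fun x : 'Z_(p ^ m.+1) => (x : nat)%:R) Y).
by apply/matrixP => i j; rewrite !mxE rho_nat.
Qed.

Definition res_solvable n m (C1 C2 : 'M[Zp]_(2 + 3)) : bool :=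
  @solvable p m.+1 n (map_mx (@rho p p_pr m.+1) C1) (map_mx (@rho p p_pr m.+1) C2).

Lemma res_solvableP n m C1 C2 : res_solvable n m C1 C2 <->
  exists Y, resvanish m.+1 C1 (chart (p%:R ^+ n) Y) &&
            resvanish m.+1 C2 (chart (p%:R ^+ n) Y).
Proof.
split=> [/existsP[Y]|[Y]].
  by have [Y' <-] := @map_rho_surj m 2 3 Y; rewrite -chart_map -!resvanishE; exists Y'.
by rewrite !resvanishE chart_map => YY; apply/existsP; exists (map_mx (@rho p p_pr m.+1) Y).
Qed.

Lemma res_solvable_le n m m' C1 C2 : (m <= m')%N ->
  res_solvable n m' C1 C2 -> res_solvable n m C1 C2.
Proof.
move=> /subnK <-; elim: (m' - m)%N => // k IH.
move=> /res_solvableP[Y /andP[/resvanishS y1 /resvanishS y2]].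
by apply: IH; apply/res_solvableP; exists Y; rewrite y1 y2.
Qed.

(** By [koenig]. It turns an event on p-adic coefficients into a countable intersection of events on
    residues, whose probabilities are finite averages. *)
Lemma solvableP n C1 C2 :
  (exists Y, vanish C1 (chart (p%:R ^+ n) Y) && vanish C2 (chart (p%:R ^+ n) Y)) <->
  forall m, res_solvable n m C1 C2.
Proof.
split=> [[Y /andP[/vanishP y1 /vanishP y2]] m|H].
  by apply/res_solvableP; exists Y; rewrite y1 y2.
pose G m (Y : 'M[Zp]_(2, 3)) := resvanish m C1 (chart (p%:R ^+ n) Y) &&
  resvanish m C2 (chart (p%:R ^+ n) Y).
have G0 Y : G 0%N Y.
  have r0 C B : resvanish 0 C B by apply/and3P; split; rewrite residueP expn0 modz1.
  by rewrite /G !r0.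
have [||m|Y GY] := @koenig p p_pr 2 3 (fun m Y => G m Y).
- case=> [|m] Y Y' e; first by rewrite !G0.
  rewrite /G !resvanishE !chart_map.
  by have /(eqmodP _ _ (ltn0Sn m)) -> := e.
- by move=> m Y /andP[/resvanishS y1 /resvanishS y2]; rewrite /G y1 y2.
- case: m => [|m]; first by exists 0.
  by have /res_solvableP := H m.
exists Y; apply/andP; split; apply/vanishP => m; by case/andP: (GY m).
Qed.

Lemma res_solvable_mul n m (g C1 C2 : 'M[Zp]_(2 + 3)) :
  res_solvable n m (g *m C1 *m g^T) (g *m C2 *m g^T) =
  let g' := map_mx (@rho p p_pr m.+1) g in
  let r := map_mx (@rho p p_pr m.+1) in
  solvable n (g' *m r C1 *m g'^T) (g' *m r C2 *m g'^T).
Proof. by rewrite /res_solvable !map_mxM -!map_trmx. Qed.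

End cells.

(** * Residues of echelon matrices and of forms *)

Section residue_charts.
Context {F : realFieldType} (p : nat) (p_pr : prime p) (m : nat).
Local Notation Zp := (padic_int p_pr).
Local Notation R := 'Z_(p ^ m.+1).
Local Notation q := (p%:R^-1 : F).
Local Notation rho := (@rho p p_pr m.+1).

Definition rdiv : pred R := fun x => (1 <= vz x)%N.

Lemma rdiv_rho (x : Zp) : rdiv (rho x) = pdiv1 x.
Proof.
rewrite /rdiv -(dvd_vz p_pr (ltn0Sn m))// /pdiv1; apply/existsP/eqP => [[y /eqP]|].
  rewrite -(rho_nat p_pr (ltn0Sn m) y) expr1 -(rmorph_nat (rho : {rmorphism Zp -> R})) -rmorphM.
  move=> /(rho_inj (ltn0Sn m)) e; rewrite -(residue_le x (ltn0Sn m)) e residue_le//.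
  by rewrite -[p%:R]expr1 residue_mulp.
move=> /residue_dvd[y ->]; exists (rho y).
by rewrite expr1 rmorphM rmorph_nat.
Qed.

Lemma ech_rho n (i j : 'I_n) (B : 'M[Zp]_(2, n)) :
  ech (@pdiv1 p p_pr) i j B -> ech rdiv i j (map_mx rho B).
Proof.
move=> /forallP e; apply/forallP => r; apply/forallP => k.
move: (e r) => /forallP/(_ k); rewrite mxE /ech_entry rdiv_rho.
by case: (r == 0); (case: (k == i); [|case: (k == j)]) => // /eqP ->; rewrite ?rmorph1 ?rmorph0.
Qed.

Lemma ech_lift n (i j : 'I_n) (c : 'M[R]_(2, n)) : ech rdiv i j c ->
  exists2 B : 'M[Zp]_(2, n), ech (@pdiv1 p p_pr) i j B & map_mx rho B = c.
Proof.
move=> /forallP e; exists (map_mx (fun x : R => (x : nat)%:R) c); last first.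
  by apply/matrixP => r k; rewrite !mxE rho_nat.
apply/forallP => r; apply/forallP => k; move: (e r) => /forallP/(_ k).
rewrite mxE /ech_entry -rdiv_rho rho_nat//.
by case: (r == 0); (case: (k == i); [|case: (k == j)]) => // /eqP ->.
Qed.

Lemma avg_eq (a : R) : avg (fun x : R => (x == a)%:R : F) = q ^+ m.+1.
Proof. by rewrite avg_indic card1 card_Zpm// mul1r exprVn natrX. Qed.

Lemma avg_ech_entry n (i j : 'I_n) r k : avg (fun x : R => (ech_entry rdiv i j r k x)%:R) =
  if r == 0 then if k == i then q ^+ m.+1 else if k == j then q ^+ m.+1
                 else if (k < i)%N then q else 1
  else if k == i then q ^+ m.+1 else if k == j then q ^+ m.+1
       else if (k < j)%N then q else 1.
Proof.
rewrite /ech_entry; case: (r == 0).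
  case: (k == i); first exact: avg_eq.
  case: (k == j); first exact: avg_eq.
  case: (k < i)%N => /=; last by rewrite (avg_cst (0 : R)).
  by rewrite avg_dvd ?expr1.
case: (k == i); first exact: avg_eq.
case: (k == j); first exact: avg_eq.
case: (k < j)%N => /=; last by rewrite (avg_cst (0 : R)).
by rewrite avg_dvd ?expr1.
Qed.

Lemma avg_ech (i j : 'I_5) : avg (fun c : 'M[R]_(2, 5) => (ech rdiv i j c)%:R : F) =
  \prod_r \prod_k avg (fun x : R => (ech_entry rdiv i j r k x)%:R).
Proof.
rewrite -avg_prod_mx; apply: eq_avg => c.
by rewrite natr_forall; apply: eq_bigr => r _; rewrite natr_forall.
Qed.

Lemma sum_avg_ech : \sum_(i < 5) \sum_(j < 5 | (i < j)%N)
    avg (fun c : 'M[R]_(2, 5) => (ech rdiv i j c)%:R : F) =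
  q ^+ m.+1 ^+ 4 * (1 + q + 2 * q ^+ 2 + 2 * q ^+ 3 + 2 * q ^+ 4 + q ^+ 5 + q ^+ 6).
Proof.
(* The four entries in the pivot columns are prescribed. Divisibility by p is imposed on i entries
   of row 0 and on j - 1 entries of row 1, column i being a pivot column, whence the exponent i + j
   - 1. *)
rewrite (eq_bigr (fun i : 'I_5 => \sum_(j < 5 | (i < j)%N) q ^+ m.+1 ^+ 4 * q ^+ (i + j).-1)).
  move: (q ^+ m.+1) q => Q x.
  under eq_bigr do rewrite big_mkcond.
  by rewrite !big_ord_recl !big_ord0 /=; ring.
move=> i _; apply: eq_bigr => j ij; rewrite avg_ech.
under eq_bigr do under eq_bigr do rewrite avg_ech_entry.
move: (q ^+ m.+1) q => Q x.
case: i ij => [[|[|[|[|[|]]]]] // ?]; case: j => [[|[|[|[|[|]]]]] // ?] //= _;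
  by rewrite !big_ord_recl !big_ord0 /=; ring.
Qed.

(* A quadratic form corresponds to an upper triangular matrix of coefficients.
   The mean over these is the mean over all matrices C, on which C -> g C g^T is
   a bijection, also for p = 2 where symmetric matrices would not do. *)
Definition upper (V : 'M[R]_5) : 'M[R]_5 :=
  \matrix_(i, j) if (i <= j)%N then V i j else 0.

Lemma upperD V W : upper (V + W) = upper V + upper W.
Proof.
by apply/matrixP => i j; rewrite !mxE; case: (i <= j)%N; rewrite ?mxE ?addr0.
Qed.

Lemma upper_idem V : upper (upper V) = upper V.
Proof. by apply/matrixP => i j; rewrite !mxE; case: (i <= j)%N; rewrite ?mxE. Qed.

Lemma card_upper_fiber V : upper V = V ->
  #|[pred C | upper C == V]| = #|[pred C | upper C == 0]|.
Proof.
move=> VV; rewrite -[RHS](card_imset _ (addIr V)); apply: eq_card => C; rewrite [LHS]inE.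
apply/eqP/imsetP => [CV|[D]].
  exists (C - V); last by rewrite subrK.
  rewrite inE; apply/eqP/(addIr V); rewrite add0r.
  by rewrite -[X in _ + X]VV -upperD subrK.
by rewrite inE => /eqP D0 ->; rewrite upperD D0 add0r VV.
Qed.

Lemma avg_upper (h : 'M[R]_5 -> F) :
  avg (fun C => h (upper C)) =
  (\sum_(V | upper V == V) h V) / #|[pred V | upper V == V]|%:R.
Proof.
set N := #|[pred C | upper C == 0]|.
have H (g : 'M[R]_5 -> F) : \sum_C g (upper C) = (\sum_(V | upper V == V) g V) * N%:R.
  rewrite (partition_big upper (fun V => upper V == V)) /=; last first.
    by move=> C _; rewrite upper_idem.
  rewrite mulr_suml; apply: eq_bigr => V /eqP VV.
  rewrite (eq_bigr (fun=> g V)) => [|C /eqP -> //].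
  rewrite sumr_const mulr_natr /N -(card_upper_fiber VV).
  by congr (_ *+ _); apply: eq_card => C; rewrite !inE.
have N0 : N%:R != 0 :> F.
  rewrite pnatr_eq0 -lt0n; apply/card_gt0P; exists 0; rewrite inE.
  by apply/eqP/matrixP => i j; rewrite !mxE; case: (i <= j)%N; rewrite ?mxE.
have := H (fun=> 1); rewrite !sumr_const => cE.
by rewrite /avg H cE -mulf_div divff ?mulr1.
Qed.

(** [upper (fold_upper C)] is the coefficient matrix of the quadratic form of C; the lower entries
    are kept so that the map is bijective. *)
Definition fold_upper (C : 'M[R]_5) : 'M[R]_5 :=
  \matrix_(i, j) if (i < j)%N then C i j + C j i else C i j.

Lemma fold_upper_bij : bijective fold_upper.
Proof.
exists (fun C : 'M[R]_5 => \matrix_(i, j)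
    if (i < j)%N then C i j - C j i else C i j) => C;
  by apply/matrixP => i j; rewrite !mxE; case: ltngtP => ij; rewrite ?addrK ?subrK.
Qed.

(** The two matrices differ by L - L^T, which is alternating. *)
Lemma vanish_fold (C : 'M[R]_5) (B : 'M[R]_(2, 5)) :
  vanish (upper (fold_upper C)) B = vanish C B.
Proof.
pose L : 'M[R]_5 := \matrix_(i, j) if (i < j)%N then C j i else 0.
have -> : upper (fold_upper C) = C + (L - L^T).
  apply/matrixP => i j; rewrite !mxE; case: ltngtP => ij.
  - by rewrite subr0.
  - by rewrite add0r addrN.
  - by rewrite subr0 addr0.
rewrite /vanish mulmxDr mulmxDl mulmxBr mulmxBl.
have -> : B *m L^T *m B^T = (B *m L *m B^T)^T by rewrite !trmx_mul trmxK mulmxA.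
move: (B *m C *m B^T) (B *m L *m B^T) => E D.
rewrite /alt2 !mxE !subrr !addr0; congr [&& _, _ & _].
by rewrite addrACA -[D 0 1 - D 1 0]opprB addNr addr0.
Qed.

End residue_charts.

(** * Uniform law of the residues of the coefficients *)

Section law_of_residues.
Local Open Scope classical_set_scope.
Context (p : nat) (p_pr : prime p) (R : realType)
  (d : measure_display) (Omega : measurableType d) (P : probability Omega R) (m : nat).
Local Notation Zp := (padic_int p_pr).
Local Notation Rm := ('Z_(p ^ m.+1)).
Local Notation rho := (@rho p p_pr m.+1).
Local Notation quantic52 := (quantic p_pr 5 2).

Definition rball (a : Rm) : set Zp := [set x | rho x = a].

Lemma measurable_rball a : measurable (rball a).
Proof.
have o : padic_open (rball a).
  by move=> x xa; exists m.+1 => y yx; rewrite /rball/= -xa; apply/rhoP.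
exact: (@sub_sigma_algebra _ setT (@open Zp) _ o).
Qed.

Definition residue_mx (f : quantic52) : 'M[Rm]_5 := map_mx rho (upper_mx f).

Lemma residue_mxP (f : quantic52) (V : 'M[Rm]_5) : upper V = V ->
  residue_mx f = V <-> forall i j : 'I_5, (i <= j)%N ->
    rball (V i j) (form_coef (quad_monomial i j) f).
Proof.
move=> VV; split=> [<- i j ij|H]; first by rewrite /rball/= !mxE ij.
apply/matrixP => i j; rewrite !mxE; case: ifP => ij; first exact: H.
by rewrite rmorph0 -VV mxE ij.
Qed.

Lemma upper_residue_mx f : upper (residue_mx f) = residue_mx f.
Proof.
apply/matrixP => i j; rewrite !mxE; case: (i <= j)%N => //; by rewrite rmorph0.
Qed.

Lemma measurable_residue_mx V : measurable [set f | residue_mx f = V].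
Proof.
have [VV|VV] := eqVneq (upper V) V; last first.
  rewrite (_ : [set f | _] = set0); first exact: measurable0.
  apply/seteqP; split=> f //= fV; move: VV.
  by rewrite -fV upper_residue_mx eqxx.
have -> : [set f | residue_mx f = V] = \bigcap_(ij in [set ij : 'I_5 * 'I_5 | (ij.1 <= ij.2)%N])
    (form_coef (quad_monomial ij.1 ij.2) @^-1` rball (V ij.1 ij.2)).
  apply/seteqP; split=> [f /(residue_mxP _ VV) H [i j] /= ij|f H]; first exact: H.
  by apply/(residue_mxP _ VV) => i j ij; exact: (H (i, j)).
apply: fin_bigcap_measurable => [|ij _]; first exact: finite_finset.
rewrite -[X in measurable X]setTI.
exact: (measurable_form_coef _ measurableT (measurable_rball _)).
Qed.

Section one_form.
Context (f : {RV P >-> quantic52}) (fU : uniform_form f).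

(** Translation by an integer lift of a carries the ball of 0 to that of a. This is the one place
    where the Haar property enters. *)
Lemma prob_rball mn (a : Rm) :
  P (coef_rv f mn @^-1` rball a) = P (coef_rv f mn @^-1` rball 0).
Proof.
have := fU.1 mn (a : nat)%:R (rball 0) (measurable_rball 0).
suff -> : [set (a : nat)%:R + x | x in rball 0] = rball a by [].
apply/esym/seteqP; split=> [x /= xa|_ [x /= x0 <-]].
  exists (x - (a : nat)%:R); last by rewrite addrC subrK.
  by rewrite /rball/= rmorphB/= xa rho_nat// subrr.
by rewrite /rball/= rmorphD/= x0 addr0 rho_nat.
Qed.

Lemma prob_residue_mx : exists c : \bar R, forall V, upper V = V ->
  P (f @^-1` [set g | residue_mx g = V]) = c.
Proof.
pose qm (ij : 'I_5 * 'I_5) := quad_monomial ij.1 ij.2.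
pose ups := [seq ij : 'I_5 * 'I_5 <- enum {: 'I_5 * 'I_5} | (ij.1 <= ij.2)%N].
pose J := seq_fset tt [seq qm ij | ij <- ups].
exists (\prod_(mn <- enum_fset J) P (coef_rv f mn @^-1` rball 0%R))%E => V VV.
(* Independence asks for an event for each monomial; [pick] recovers the unique pair i <= j from
   which the monomial is built. *)
pose A (mn : monomial 5 2) : set Zp :=
  if [pick ij : 'I_5 * 'I_5 | (ij.1 <= ij.2)%N && (qm ij == mn)] is Some ij
  then rball (V ij.1 ij.2) else setT.
have mA mn : measurable (A mn).
  by rewrite /A; case: pickP => // *; exact: measurable_rball.
have AE (i j : 'I_5) : (i <= j)%N -> A (quad_monomial i j) = rball (V i j).
  move=> ij; rewrite /A; case: pickP => [[k l] /= /andP[kl /eqP/(congr1 val)/=]|].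
    by move=> /(quad_mnm_inj kl ij)[-> ->].
  by move=> /(_ (i, j)); rewrite /= ij eqxx.
have memJ mn : mn \in J -> exists i j : 'I_5, (i <= j)%N /\ mn = quad_monomial i j.
  rewrite seq_fsetE => /mapP[[i j]]; rewrite mem_filter /= => /andP[ij _] ->.
  by exists i, j.
have := fU.2 J A mA.
rewrite [RHS](eq_big_seq (fun mn => P (coef_rv f mn @^-1` rball 0))); last first.
  by move=> mn /memJ[i [j [ij ->]]]; rewrite AE// prob_rball.
move=> <-; congr (P _); apply/seteqP; split=> [w /= /(residue_mxP _ VV) H mn /= /memJ|w H].
  by move=> [i [j [ij ->]]]; rewrite AE//; exact: H.
apply/(residue_mxP _ VV) => i j ij; rewrite -AE//; apply: H.
rewrite /= seq_fsetE; apply/mapP; exists (i, j) => //.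
by rewrite mem_filter /= ij mem_enum.
Qed.

End one_form.
End law_of_residues.

Section two_forms.
Local Open Scope classical_set_scope.
Context (p : nat) (p_pr : prime p) (R : realType)
  (d : measure_display) (Omega : measurableType d) (P : probability Omega R).
Context (f1 f2 : {RV P >-> quantic p_pr 5 2}) (U1 : uniform_form f1)
  (U2 : uniform_form f2) (ind : independent_pair f1 f2) (m : nat).
Local Notation Rm := ('Z_(p ^ m.+1)).

Definition residue_atom (V : 'M[Rm]_5 * 'M[Rm]_5) : set Omega :=
  [set w | residue_mx m (f1 w) = V.1 /\ residue_mx m (f2 w) = V.2].

Lemma measurable_residue_atom V : measurable (residue_atom V).
Proof.
have -> : residue_atom V = (f1 @^-1` [set g | residue_mx m g = V.1]) `&`
                 (f2 @^-1` [set g | residue_mx m g = V.2]) by [].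
by apply: measurableI; apply: measurable_funPTI; exact: measurable_residue_mx.
Qed.

Definition upper_pair (V : 'M[Rm]_5 * 'M[Rm]_5) := (upper V.1 == V.1) && (upper V.2 == V.2).

Lemma prob_residue_atom : exists c : R, forall V, P (residue_atom V) = (c *+ upper_pair V)%:E.
Proof.
have [c1 h1] := prob_residue_mx m U1; have [c2 h2] := prob_residue_mx m U2.
have u0 : upper (0 : 'M[Rm]_5) = 0.
  by apply/matrixP => i j; rewrite !mxE; case: (i <= j)%N; rewrite ?mxE.
exists (fine (P (residue_atom (0, 0)))) => V.
have AtE W : P (residue_atom W) = (P (f1 @^-1` [set g | residue_mx m g = W.1]) *
    P (f2 @^-1` [set g | residue_mx m g = W.2]))%E.
  by rewrite -ind//; exact: measurable_residue_mx.
have [/andP[/eqP v1 /eqP v2]|nu] := boolP (upper_pair V).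
  rewrite mulr1n fineK; last by apply: fin_num_measure; exact: measurable_residue_atom.
  by rewrite !AtE !h1// !h2.
rewrite mulr0n (_ : residue_atom V = set0) ?measure0//.
apply/seteqP; split=> // w [/= w1 w2]; move/negP: nu; apply.
by rewrite /upper_pair -w1 -w2 !upper_residue_mx !eqxx.
Qed.

Definition residue_event (X : pred ('M[Rm]_5 * 'M[Rm]_5)) : set Omega :=
  [set w | X (residue_mx m (f1 w), residue_mx m (f2 w))].

Lemma residue_eventE X : residue_event X = \bigcup_(V in [set` X]) residue_atom V.
Proof.
apply/seteqP; split=> [w Xw|w [[V1 V2] /= XV [/= e1 e2]]]; last by rewrite /residue_event/= e1 e2.
by exists (residue_mx m (f1 w), residue_mx m (f2 w)).
Qed.

Lemma measurable_residue_event X : measurable (residue_event X).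
Proof.
rewrite residue_eventE; apply: fin_bigcup_measurable => [|V _]; last exact: measurable_residue_atom.
exact: finite_finset.
Qed.

Lemma prob_residue_event_sum X : P (residue_event X) = (\sum_(V | X V) P (residue_atom V))%E.
Proof.
rewrite residue_eventE measure_fin_bigcup.
- rewrite [RHS]bigfs//; first exact: index_enum_uniq.
  by move=> V _; rewrite mem_index_enum.
- exact: finite_finset.
- move=> V W _ _ [w [[v1 v2] [w1 w2]]].
  by rewrite [V]surjective_pairing [W]surjective_pairing -v1 -v2 -w1 -w2.
- by move=> V _; exact: measurable_residue_atom.
Qed.

Theorem prob_residue_event X : P (residue_event X) =
  (avg (fun C1 => avg (fun C2 => (X (upper C1, upper C2))%:R)))%:E.
Proof.
have [c PAt] := prob_residue_atom.
have sumE Y : P (residue_event Y) = (c * (\sum_(V | upper_pair V) (Y V)%:R))%:E.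
  rewrite prob_residue_event_sum (eq_bigr (fun V => (c *+ upper_pair V)%:E)) => [|V _]; last exact: PAt.
  rewrite sumEFin; congr _%:E; rewrite mulr_sumr big_mkcond [RHS]big_mkcond/=.
  apply: eq_bigr => V _.
  by case: (Y V); case: (upper_pair V); rewrite ?mulr1 ?mulr0 ?mulr0n ?mulr1n.
pose u : R := (#|[pred V : 'M[Rm]_5 | upper V == V]|)%:R.
have pairE (g : 'M[Rm]_5 -> 'M[Rm]_5 -> R) : \sum_(V | upper_pair V) g V.1 V.2 =
    \sum_(V1 | upper V1 == V1) \sum_(V2 | upper V2 == V2) g V1 V2.
  by rewrite pair_big.
(* The total mass 1 determines c, the u^2 pairs of upper triangular matrices being equally
   likely. *)
have cu : c * (u * u) = 1.
  have := sumE predT; rewrite (_ : residue_event predT = setT) ?probability_setT; last exact/seteqP.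
  move=> [->]; congr (_ * _); rewrite (pairE (fun _ _ => 1)) !sumr_const/=.
  rewrite -mulr_natr; congr (_ * _).
have u0 : u != 0 by apply: contra_eq_neq cu => ->; rewrite mul0r mulr0 eq_sym oner_eq0.
rewrite sumE (eq_bigr (fun V => (X (V.1, V.2))%:R)) => [|[]//].
rewrite (pairE (fun V1 V2 => (X (V1, V2))%:R)); congr _%:E.
rewrite (avg_upper (fun V1 => avg (fun C2 => (X (V1, upper C2))%:R))).
rewrite -/u; under [X in X / u]eq_bigr do rewrite (avg_upper (fun V2 => (X (_, V2))%:R)) -/u.
rewrite -mulr_suml -mulrA -invfM mulrC; congr (_ * _).
by apply: (mulIf (mulf_neq0 u0 u0)); rewrite cu mulVf// mulf_neq0.
Qed.

End two_forms.

(** * Counting lines *)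

Section counting_limit.
Local Open Scope classical_set_scope.
Context (R : realType) (T : choiceType) (A : set T) (C : nat -> finType)
  (r : forall n, T -> C n).
Hypothesis r_coarser : forall n x y, r n.+1 x = r n.+1 y -> r n x = r n y.
Hypothesis r_separates : forall x y, A x -> A y -> (forall n, r n x = r n y) -> x = y.

Definition classes n : {set C n} := finset (fun c => `[< exists2 x, A x & r n x = c >]).

Lemma classesP n c : reflect (exists2 x, A x & r n x = c) (c \in classes n).
Proof. by rewrite finset.in_set; exact: asboolP. Qed.

(** Choosing in each class a point of A and taking its finer class is injective, as the finer class
    determines the coarser one. *)
Lemma card_classesS n : (#|classes n| <= #|classes n.+1|)%N.
Proof.
have [-> |[_ /classesP[x0 Ax0 _]]] := set_0Vmem (classes n); first by rewrite cards0.
have /fin_all_exists[h hE] (c : C n) : exists c', c \in classes n ->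
    exists x, [/\ A x, r n x = c & r n.+1 x = c'].
  have [/classesP[x Ax xc]|] := boolP (c \in classes n); last by exists (r n.+1 x0).
  by exists (r n.+1 x) => _; exists x.
rewrite -(card_in_imset (f := h)).
  apply: subset_leq_card; apply/fintype.subsetP => _ /imsetP[c cn ->].
  by have [x [Ax _ xc]] := hE _ cn; apply/classesP; exists x.
move=> c c' cn cn' hh; have [x [_ xc xh]] := hE _ cn; have [y [_ yc yh]] := hE _ cn'.
by rewrite -xc -yc; apply: r_coarser; rewrite xh yh; exact: hh.
Qed.

Lemma separate_seq (s : seq T) : uniq s -> {in s, forall x, A x} ->
  exists n0, forall n, (n0 <= n)%N -> uniq (map (r n) s).
Proof.
have coarser n k x y : (n <= k)%N -> r k x = r k y -> r n x = r n y.
  by move=> /subnK <-; elim: (k - n)%N => // l IH; rewrite addSn => /r_coarser.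
have sep2 x y : A x -> A y -> x != y -> exists n0, forall n, (n0 <= n)%N -> r n x != r n y.
  move=> Ax Ay xy; apply: contrapT => H; move/eqP: xy; apply; apply: r_separates => // n.
  apply: contrapT => rn; apply: H; exists n => k nk.
  by apply/eqP => /(coarser _ _ _ _ nk).
have sep1 x (t : seq T) : A x -> {in t, forall y, A y} -> x \notin t ->
    exists n0, forall n, (n0 <= n)%N -> r n x \notin map (r n) t.
  move=> Ax; elim: t => [|y t IH] At; first by exists 0%N.
  rewrite inE negb_or => /andP[xy xt].
  have [n1 h1] := IH (fun z zt => At z (mem_behead (s := y :: t) zt)) xt.
  have [n2 h2] := sep2 x y Ax (At y (mem_head _ _)) xy.
  exists (maxn n1 n2) => n; rewrite geq_max => /andP[l1 l2] /=.
  by rewrite inE negb_or h2// h1.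
elim: s => [|x s IH]; first by exists 0%N.
move=> /andP[xs us] As.
have As' : {in s, forall x, A x} by move=> z zs; apply: As; rewrite inE zs orbT.
have [n1 h1] := IH us As'; have [n2 h2] := sep1 x s (As x (mem_head _ _)) As' xs.
exists (maxn n1 n2) => n; rewrite geq_max => /andP[l1 l2] /=.
by rewrite h2// h1.
Qed.

Lemma leq_size_classes (s : seq T) : uniq s -> {in s, forall x, A x} ->
  exists n0, forall n, (n0 <= n)%N -> (size s <= #|classes n|)%N.
Proof.
move=> us As; have [n0 h] := separate_seq us As; exists n0 => n /h un.
rewrite -(size_map (r n)) cardE; apply: uniq_leq_size => // c /mapP[x xs ->].
by rewrite mem_enum; apply/classesP; exists x => //; exact: As.
Qed.

(** Any finite set of points of A is eventually separated, so the number of classes eventually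
    reaches its size. For finite A this is also an upper bound; for infinite A it forces the limit
    +oo. *)
Lemma cvg_card_classes :
  (fun n => (#|classes n|%:R : R)%:E) @ \oo --> (counting A : \bar R).
Proof.
rewrite /counting; case: asboolP => [finA|infA].
  have As : {in enum_fset (fset_set A), forall x, A x}.
    by move=> x; rewrite in_fset_set// inE.
  have [n0 h] := leq_size_classes (fset_uniq _) As.
  apply: cvg_near_cst; exists n0 => // n /= /h le.
  congr (_%:R%:E); apply/eqP; rewrite eqn_leq {}le andbT.
  rewrite -(size_map (r n)) cardE; apply: uniq_leq_size; first exact: enum_uniq.
  move=> c; rewrite mem_enum => /classesP[x Ax <-]; apply: map_f.
  by rewrite in_fset_set// inE.
apply/cvgeyPge => M.
have [B BA Bn] := infinite_set_fset (Num.truncn M).+1 infA.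
have [n0 h] := leq_size_classes (fset_uniq B) BA.
exists n0 => // n /= /h le; rewrite lee_fin (le_trans (ltW (truncnS_gt M)))// ler_nat.
exact: leq_trans Bn le.
Qed.

Lemma nd_card_classes : nondecreasing_seq (fun n => (#|classes n|%:R : R)%:E).
Proof.
apply/nondecreasing_seqP => n; rewrite lee_fin ler_nat.
exact: card_classesS.
Qed.

End counting_limit.

Lemma cramer2 (S : comPzRingType) (x y a b c d : S) :
  x * a + y * b = 0 -> x * c + y * d = 0 -> a * d - c * b = 1 -> x = 0 /\ y = 0.
Proof.
move=> e1 e2 D; split.
  have -> : x = x * (a * d - c * b) by rewrite D mulr1.
  have -> : x * (a * d - c * b) = (x * a + y * b) * d - (x * c + y * d) * b by ring.
  by rewrite e1 e2 !mul0r subr0.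
have -> : y = y * (a * d - c * b) by rewrite D mulr1.
have -> : y * (a * d - c * b) = (x * c + y * d) * a - (x * a + y * b) * c by ring.
by rewrite e1 e2 !mul0r subr0.
Qed.

Section line_classes.
Local Open Scope classical_set_scope.
Context (p : nat) (p_pr : prime p).
Local Notation Zp := (padic_int p_pr).
Local Notation phi := (@tofrac Zp).
Local Notation line := {vspace 'rV[padic p_pr]_5}.
Implicit Types (f g : quantic p_pr 5 2) (L : line).

Definition is_code L (z : ('I_5 * 'I_5) * 'M[Zp]_(2, 5)) : Prop :=
  [/\ (z.1.1 < z.1.2)%N, ech (@pdiv1 p p_pr) z.1.1 z.1.2 z.2 & L = rowsp (map_mx phi z.2)].

(** The default value is reached only if [\dim L] is not 2. *)
Definition line_code L := xget ((ord0, ord0), 0) (is_code L).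

Lemma line_codeP L : \dim L = 2%N -> is_code L (line_code L).
Proof.
move=> /(@ech_ex p p_pr 5)[i [j [B [ij eB LB]]]].
rewrite /line_code; case: xgetP => [z _ //|H].
by have := H ((i, j), B); case.
Qed.

Lemma is_code_inj L z z' : is_code L z -> is_code L z' -> z = z'.
Proof.
case: z z' => [[i j] B] [[i' j'] B'] [/= ij eB LB] [/= ij' eB' LB'].
by have [-> -> ->] := ech_inj ij ij' eB eB' (etrans (esym LB) LB').
Qed.

Definition line_class n L : ('I_5 * 'I_5) * 'M['Z_(p ^ n.+1)]_(2, 5) :=
  ((line_code L).1, map_mx (@rho p p_pr n.+1) (line_code L).2).

Lemma line_class_coarser n L L' :
  line_class n.+1 L = line_class n.+1 L' -> line_class n L = line_class n L'.
Proof.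
rewrite /line_class; case: (line_code L) (line_code L') => [ij B] [ij' B'] /= [-> e].
congr pair; apply/(eqmodP _ _ (ltn0Sn n)).
by apply: (@eqmod_le _ _ _ _ n.+1 n.+2) => //; apply/eqmodP.
Qed.

Lemma line_class_separates L L' : \dim L = 2%N -> \dim L' = 2%N ->
  (forall n, line_class n L = line_class n L') -> L = L'.
Proof.
move=> /line_codeP[_ _ LE] /line_codeP[_ _ LE'] e; rewrite LE LE'.
congr (rowsp (map_mx _ _)); apply/matrixP => i j; apply: padic_int_eqP => -[|n].
  by rewrite [LHS]residueP [RHS]residueP expn0 !modz1.
by have [_ /(eqmodP _ _ (ltn0Sn n))] := e n; apply.
Qed.

Lemma lines_on_code L f g z : is_code L z -> lines_on f g L <->
  vanish (upper_mx f) z.2 && vanish (upper_mx g) z.2.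
Proof.
case: z => [[i j] B] [/= ij eB ->]; split=> [[_ H]|/andP[/vanish_rowsp F /vanish_rowsp G]].
  by apply/andP; split; apply/vanish_rowsp => v /H[].
split; last by move=> v vL; split; [exact: F|exact: G].
apply: dim_rowsp => x xB.
have [plu1 _] := (ech_minor1 ij eB, tt).
have e k : x 0 0 * phi (B 0 k) + x 0 1 * phi (B 1 k) = 0.
  have := congr1 (fun y : 'rV_5 => y 0 k) xB; rewrite !mxE !big_ord_recl big_ord0 addr0 !mxE.
  by rewrite (_ : lift ord0 ord0 = 1); last exact/val_inj.
(* The minor 1 at the pivots makes the rows of B independent. *)
have D1 : phi (B 0 i) * phi (B 1 j) - phi (B 0 j) * phi (B 1 i) = 1.
  by rewrite -!tofracM -tofracB -/(plu B i j) plu1 tofrac1.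
have [h0 h1] := cramer2 (e i) (e j) D1.
apply/rowP => -[[|[|]] // k2]; rewrite mxE.
  by rewrite -h0; congr (x _ _); apply/val_inj.
by rewrite -h1; congr (x _ _); apply/val_inj.
Qed.

Local Notation lclasses f g := (classes (lines_on f g) line_class).

Lemma line_classesP f g n (i j : 'I_5) c : ((i, j), c) \in lclasses f g n <->
  (i < j)%N /\ exists B, [/\ ech (@pdiv1 p p_pr) i j B, map_mx (@rho p p_pr n.+1) B = c &
    vanish (upper_mx f) B && vanish (upper_mx g) B].
Proof.
split=> [/classesP[L Ll [cij cB]]|[ij [B [eB Bc v]]]].
  have [/= ij eB LE] := line_codeP Ll.1; rewrite cij /= in ij eB.
  split=> //; exists (line_code L).2; split=> //.
  exact/(lines_on_code _ _ (line_codeP Ll.1)).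
apply/classesP; exists (rowsp (map_mx phi B)).
  by apply/(@lines_on_code _ _ _ ((i, j), B)).
have Bcode : is_code (rowsp (map_mx phi B)) ((i, j), B) by [].
have ll : lines_on f g (rowsp (map_mx phi B)) by apply/(lines_on_code _ _ Bcode).
by rewrite /line_class (is_code_inj (line_codeP ll.1) Bcode) /= Bc.
Qed.

End line_classes.

(** * Probability that a class of planes contains a line *)

Section cell_probability.
Local Open Scope classical_set_scope.
Context (p : nat) (p_pr : prime p) (R : realType)
  (d : measure_display) (Omega : measurableType d) (P : probability Omega R).
Context (f1 f2 : {RV P >-> quantic p_pr 5 2}) (U1 : uniform_form f1)
  (U2 : uniform_form f2) (ind : independent_pair f1 f2).
Local Notation Zp := (padic_int p_pr).
Local Notation q := (p%:R^-1 : R).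

Definition cell_event n t : set Omega :=
  [set w | t \in classes (lines_on (f1 w) (f2 w)) (@line_class p p_pr) n].
Arguments cell_event : clear implicits.

Definition moved_solvable n m (g : 'M[Zp]_(2 + 3)) :
    pred ('M['Z_(p ^ m.+1)]_5 * 'M['Z_(p ^ m.+1)]_5) :=
  fun V => let g' := map_mx (@rho p p_pr m.+1) g in
    solvable n (g' *m V.1 *m g'^T) (g' *m V.2 *m g'^T).

(** [cell_frame] writes the class as a chart around the first coordinate plane, moved by g;
    [vanish_mul] lets g act on the forms instead. *)
Lemma cell_eventP n (i j : 'I_5) c : (i < j)%N -> ech (@rdiv p n) i j c ->
  exists2 g : 'M[Zp]_(2 + 3), g \in unitmx &
    forall w, cell_event n ((i, j), c) w <->
      forall m, residue_event f1 f2 (moved_solvable n.+1 (m := m) g) w.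
Proof.
move=> ij /(ech_lift p_pr)[B0 eB0 B0c].
have [g gu gP] := cell_frame (ltn0Sn n) ij eB0; exists g => // w.
rewrite /cell_event /= line_classesP.
have -> : (forall m, residue_event f1 f2 (moved_solvable n.+1 (m := m) g) w) <->
    forall m, res_solvable n.+1 m (g *m upper_mx (f1 w) *m g^T) (g *m upper_mx (f2 w) *m g^T).
  by split=> H m; have := H m; rewrite res_solvable_mul.
rewrite -solvableP; split=> [[_ [B [eB Bc v]]]|[Y]].
  have [|Y BY] := (gP B).1; first by split=> //; apply/eqmodP => //; rewrite Bc B0c.
  by exists Y; rewrite -!vanish_mul -BY.
rewrite -!vanish_mul => v; split=> //; exists (chart (p%:R ^+ n.+1) Y *m g).
have [eB /(eqmodP _ _ (ltn0Sn n)) e] := (gP (chart (p%:R ^+ n.+1) Y *m g)).2 (ex_intro _ Y erefl).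
by split=> //; rewrite e B0c.
Qed.

(** Two changes of variable: [fold_upper] replaces the coefficient matrix by C itself, after which C
    -> g C g^T removes g. This is the invariance under GL_5(Z_p) at the level of residues. *)
Lemma avg_moved_solvable n m (g : 'M[Zp]_(2 + 3)) : g \in unitmx ->
  avg (fun C1 => avg (fun C2 => (moved_solvable n (m := m) g (upper C1, upper C2))%:R)) =
  solvable_mean p m.+1 n :> R.
Proof.
move=> gu; rewrite /solvable_mean.
set g' := map_mx (@rho p p_pr m.+1) g.
have gu' : g' \in unitmx by rewrite unitmxE det_map_mx rmorph_unit// -unitmxE.
have gb : bijective (fun C : 'M['Z_(p ^ m.+1)]_(2 + 3) => g' *m C *m g'^T).
  have gut : g'^T \in unitmx by rewrite unitmx_tr.
  exact: (bij_comp (mulmxr_bij (2 + 3) gut) (mulmx_bij (2 + 3) gu')).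
have fb := fold_upper_bij p m.
pose h C1 C2 : R := (moved_solvable n (m := m) g (upper C1, upper C2))%:R.
pose k (C1 C2 : 'M['Z_(p ^ m.+1)]_(2 + 3)) : R := (solvable n C1 C2)%:R.
rewrite -/(avg (fun C1 => avg (k C1))) -/(avg (fun C1 => avg (h C1))).
transitivity (avg (fun C1 => avg (k (g' *m C1 *m g'^T)))); last exact: avg_bij gb.
transitivity (avg (fun C1 => avg (h (fold_upper C1)))).
  exact/esym/(avg_bij (fun C1 => avg (h C1)) fb).
apply: eq_avg => C1.
transitivity (avg (fun C2 => h (fold_upper C1) (fold_upper C2))).
  exact/esym/(avg_bij (h (fold_upper C1)) fb).
transitivity (avg (fun C2 => k (g' *m C1 *m g'^T) (g' *m C2 *m g'^T))); last exact: avg_bij gb.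
apply: eq_avg => C2.
rewrite /h /k /moved_solvable.
rewrite -/g'.
suff -> : solvable n (g' *m (upper (fold_upper C1), upper (fold_upper C2)).1 *m g'^T)
    (g' *m (upper (fold_upper C1), upper (fold_upper C2)).2 *m g'^T) =
  solvable n (g' *m C1 *m g'^T) (g' *m C2 *m g'^T) by [].
rewrite /solvable.
apply: eq_existsb => Y.
rewrite -!vanish_mul.
by rewrite (vanish_fold C1) (vanish_fold C2).
Qed.

(** The limit of [minors_mean], that is, E|det J| over Z_p. *)
Definition limit_density : R :=
  (1 - q) * (1 - q ^+ 2) / ((1 - q ^+ 4) * (1 - q ^+ 5)).

Lemma cell_event_bigcap n (i j : 'I_5) c : (i < j)%N -> ech (@rdiv p n) i j c ->
  exists2 g : 'M[Zp]_(2 + 3), g \in unitmx &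
    cell_event n ((i, j), c) =
      \bigcap_m residue_event f1 f2 (moved_solvable n.+1 (m := m) g).
Proof.
move=> ij ec; have [g gu gP] := cell_eventP ij ec; exists g => //.
by apply/seteqP; split=> w => [/gP H m _|H]; [exact: H|apply/gP => m; exact: H].
Qed.

Lemma cell_event0 n (i j : 'I_5) c : ~~ ((i < j)%N && ech (@rdiv p n) i j c) ->
  cell_event n ((i, j), c) = set0.
Proof.
move=> H; apply/seteqP; split=> // w /line_classesP[ij [B [/(ech_rho n) eB Bc _]]].
by move: H; rewrite ij -Bc eB.
Qed.

Lemma measurable_cell_event n t : measurable (cell_event n t).
Proof.
case: t => [[i j] c]; case: (boolP ((i < j)%N && ech (@rdiv p n) i j c)) => [/andP[ij ec]|H].
  have [g _ ->] := cell_event_bigcap ij ec.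
  by apply: bigcapT_measurable => m; exact: measurable_residue_event.
by rewrite cell_event0//; exact: measurable0.
Qed.

(** For fixed n the event is a decreasing intersection over m, so its probability is a limit of
    values of [solvable_mean]. The distance of [minors_mean] to its limit vanishes as m grows; only
    the error of [solvable_mean_dist], which depends on n, remains. *)
Lemma prob_cell_event n (i j : 'I_5) c : (i < j)%N -> ech (@rdiv p n) i j c ->
  `|q ^- (6 * n.+1) * fine (P (cell_event n ((i, j), c))) - limit_density| <= q ^+ n.+1.
Proof.
move=> ij ec; have [g gu ->] := cell_event_bigcap ij ec.
set E := fun m => residue_event f1 f2 (moved_solvable n.+1 (m := m) g).
have mE m : measurable (E m) by exact: measurable_residue_event.
have niE : nonincreasing_seq E.
  have EP m w : E m w <-> res_solvable n.+1 m (g *m upper_mx (f1 w) *m g^T)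
      (g *m upper_mx (f2 w) *m g^T) by rewrite res_solvable_mul.
  apply/nonincreasing_seqP => m; apply/subsetPset => w /EP h; apply/EP.
  exact: res_solvable_le h.
have : P \o E @ \oo --> P (\bigcap_m E m).
  apply: nonincreasing_cvg_mu => //; last exact: bigcapT_measurable.
  by rewrite (le_lt_trans (probability_le1 _ (mE 0%N)))// ltry.
rewrite -[P (\bigcap_m E m)]fineK; last by apply: fin_num_measure; exact: bigcapT_measurable.
move=> /fine_cvgP[_]; set r := fine _ => Er.
have PE m : P (E m) = (solvable_mean p m.+1 n.+1)%:E.
  by rewrite /E (prob_residue_event U1 U2 ind) avg_moved_solvable.
have EE m : (fine \o (P \o E)) m = solvable_mean p m.+1 n.+1 := congr1 fine (PE m).
have [C C0 hC] := minors_mean_lim R p_pr.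
have q1 : `|q| < 1 by rewrite ger0_norm ?q_lt1// ltW ?q_gt0.
have c1 : `|q ^- (6 * n.+1) * (fine \o (P \o E)) m - limit_density| @[m --> \oo] -->
    `|q ^- (6 * n.+1) * r - limit_density|.
  exact: (cvg_norm (cvgB (cvgM (cvg_cst _) Er) (cvg_cst _))).
have c2 : q ^+ n.+1 + C * q ^+ m @[m --> \oo] --> q ^+ n.+1.
  rewrite -[X in _ --> X]addr0 -(mulr0 C); apply: cvgD; first exact: cvg_cst.
  by apply: cvgM; [exact: cvg_cst|exact: cvg_expr].
apply: (ler_cvg_to c1 c2).
exists (7 * n.+1)%N => // m /= nm.
have h1 := solvable_mean_dist (F := R) p_pr (ltn0Sn m) (leqW nm).
have h2 := hC m.+1 (ltn0Sn m); rewrite -/limit_density in h2.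
have h3 : C * q ^+ m.+1 <= C * q ^+ m by rewrite ler_wpM2l// qX_le.
rewrite [fine _](EE m) -[_ - limit_density](subrKA (@minors_mean R p m.+1)).
by rewrite (le_trans (ler_normD _ _))// lerD// (le_trans h2).
Qed.

End cell_probability.

Arguments cell_event {p p_pr R d Omega P} f1 f2 n t.

Section expected_cells.
Local Open Scope classical_set_scope.
Context (p : nat) (p_pr : prime p) (R : realType)
  (d : measure_display) (Omega : measurableType d) (P : probability Omega R).
Context (f1 f2 : {RV P >-> quantic p_pr 5 2}) (U1 : uniform_form f1)
  (U2 : uniform_form f2) (ind : independent_pair f1 f2).
Local Notation q := (p%:R^-1 : R).
Local Notation cell n := (('I_5 * 'I_5) * 'M['Z_(p ^ n.+1)]_(2, 5))%type.

(* The sum over i < j of the Haar measures of the sets of 2 x 3 blocks allowed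
   outside the pivot columns i and j. *)
Definition grassmann_volume : R :=
  1 + q + 2 * q ^+ 2 + 2 * q ^+ 3 + 2 * q ^+ 4 + q ^+ 5 + q ^+ 6.

Lemma grassmann_volume_density : grassmann_volume * limit_density p R = 1.
Proof.
have nz k : 1 - q ^+ k.+1 != 0.
  rewrite gt_eqF// subr_gt0 (le_lt_trans (y := q ^+ 1))//; first exact: qX_le.
  by rewrite expr1 q_lt1.
rewrite /grassmann_volume /limit_density; have := nz 3; have := nz 4.
by move: q => x n5 n4; field; rewrite n4 n5.
Qed.

Definition good_cell n (t : cell n) : bool :=
  (t.1.1 < t.1.2)%N && ech (@rdiv p n) t.1.1 t.1.2 t.2.

Lemma sum_good_cell n :
  \sum_t (@good_cell n t)%:R = q ^- (6 * n.+1) * grassmann_volume.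
Proof.
have p0 : p%:R != 0 :> R by rewrite pnatr_eq0 -lt0n prime_gt0.
have := @sum_avg_ech R p p_pr n; rewrite -/grassmann_volume => H.
transitivity ((#|{: 'M['Z_(p ^ n.+1)]_(2, 5)}|)%:R * (\sum_(i < 5) \sum_(j < 5 | (i < j)%N)
    avg (fun c : 'M['Z_(p ^ n.+1)]_(2, 5) => (ech (@rdiv p n) i j c)%:R : R))).
  rewrite mulr_sumr -(pair_bigA _ (fun ij c => (@good_cell n (ij, c))%:R))/=.
  rewrite -(pair_bigA _ (fun i j => \sum_c (@good_cell n ((i, j), c))%:R))/=.
  apply: eq_bigr => i _; rewrite mulr_sumr [RHS]big_mkcond; apply: eq_bigr => j _.
  rewrite /good_cell /=; case: ifP => ij; last by rewrite big1.
  rewrite /avg mulrCA divff ?mulr1// pnatr_eq0 -lt0n.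
  by apply/card_gt0P; exists 0.
rewrite H card_mx card_Zpm// mulrA; congr (_ * _).
rewrite natrX natrX -!exprM !exprVn invrK.
(* Of the ten entries of a 2 x 5 matrix the four in the pivot columns are prescribed, which leaves
   six. *)
rewrite (_ : n.+1 * (2 * 5) = 6 * n.+1 + n.+1 * 4)%N; last by lia.
by rewrite exprD mulfK// expf_neq0.
Qed.

(** K times each probability is known up to q^(n+1), and the number of good classes is K times
    [grassmann_volume], so the factors K cancel in the sum. *)
Lemma sum_prob_cell_event n :
  `|\sum_t fine (P (cell_event f1 f2 n t)) - 1| <= grassmann_volume * q ^+ n.+1.
Proof.
set K := q ^- (6 * n.+1).
have K0 : 0 < K by rewrite invr_gt0 qX_gt0.
have H t : `|K * fine (P (cell_event f1 f2 n t)) - (@good_cell n t)%:R * limit_density p R| <=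
    (@good_cell n t)%:R * q ^+ n.+1.
  case: t => [[i j] c]; rewrite /good_cell /=.
  case: (boolP ((i < j)%N && ech (@rdiv p n) i j c)) => [/andP[ij ec]|ng].
    by rewrite !mul1r; apply: prob_cell_event.
  by rewrite cell_event0// measure0 mulr0 !mul0r subr0 normr0.
have : `|K * \sum_t fine (P (cell_event f1 f2 n t)) - K * grassmann_volume * limit_density p R| <=
    K * grassmann_volume * q ^+ n.+1.
  rewrite -sum_good_cell !mulr_suml mulr_sumr -sumrB.
  by apply: (le_trans (ler_norm_sum _ _ _)); apply: ler_sum.
rewrite -!mulrA grassmann_volume_density -mulrBr normrM gtr0_norm// ler_pM2l//.
Qed.

End expected_cells.

Local Open Scope classical_set_scope.
Local Open Scope ereal_scope.

Theorem theorem16 (p : nat) (p_pr : prime p) (R : realType)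
    (d : measure_display) (Omega : measurableType d) (P : probability Omega R)
    (f1 f2 : {RV P >-> quantic p_pr 5 2}) :
  uniform_form f1 -> uniform_form f2 -> independent_pair f1 f2 ->
  let N := fun w => counting (lines_on (f1 w) (f2 w)) : \bar R in
  measurable_fun setT N /\ \int[P]_w N w = 1.
Proof.
move=> U1 U2 ind N.
pose cls w n := classes (lines_on (f1 w) (f2 w)) (@line_class p p_pr) n.
pose g n w : \bar R := (#|cls w n|%:R)%:E.
have gN w : g ^~ w @ \oo --> N w.
  apply: cvg_card_classes => [n L L'|L L' [dL _] [dL' _]].
    exact: line_class_coarser.
  exact: line_class_separates.
have g_nd w : {homo g^~ w : n m / (n <= m)%N >-> n <= m}.
  by apply: nd_card_classes => n L L'; exact: line_class_coarser.
(* Finite sums of indicators give both the measurability of [g n] and its mean. *)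
have gE n w : g n w = \sum_t (\1_(cell_event f1 f2 n t) w)%:E.
  rewrite /g sumEFin -sum1_card natr_sum big_mkcond; congr _%:E.
  apply: eq_bigr => t _; rewrite indicE.
  have -> : (w \in cell_event f1 f2 n t) = (t \in cls w n).
    by apply/idP/idP => [/set_mem|h]; [exact|exact: mem_set].
  by case: (t \in cls w n).
have mg n : measurable_fun setT (g n).
  rewrite (_ : g n = fun w => \sum_t (\1_(cell_event f1 f2 n t) w)%:E); last exact/funext/gE.
  apply: emeasurable_sum => t; apply/measurable_EFinP; apply: measurable_indic.
  exact: measurable_cell_event.
have mN : measurable_fun setT N by apply: (@emeasurable_fun_cvg _ _ _ setT g) => // w _; exact: gN.
split=> //.
have int_g n : \int[P]_w g n w = (\sum_t fine (P (cell_event f1 f2 n t)))%:E.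
  under eq_integral do rewrite gE.
  rewrite ge0_integral_sum//.
  - rewrite -sumEFin; apply: eq_bigr => t _.
    rewrite integral_indic//; last exact: measurable_cell_event.
    by rewrite setIT fineK// fin_num_measure//; exact: measurable_cell_event.
  - move=> t; apply/measurable_EFinP; apply: measurable_indic.
    exact: measurable_cell_event.
have lim1 : \int[P]_w g n w @[n --> \oo] --> 1.
  under eq_fun do rewrite int_g.
  apply: cvg_EFin; first exact: nearW.
  have c0 : (grassmann_volume p R * p%:R^-1 ^+ n.+1)%R @[n --> \oo] --> (0%R : R).
    rewrite -[X in _ --> X](mulr0 (grassmann_volume p R)); apply: cvgM; first exact: cvg_cst.
    rewrite (cvg_shiftS (fun n => (p%:R^-1 : R) ^+ n)%R); apply: cvg_expr.
    by rewrite ger0_norm ?q_lt1// ltW ?q_gt0.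
  apply/cvgrPdist_le => e e0.
  have /cvgrPdist_le/(_ e e0) := c0; apply: filterS => n.
  rewrite sub0r normrN => h; rewrite distrC.
  apply: le_trans h; apply: le_trans (sum_prob_cell_event U1 U2 ind n) _.
  exact: ler_norm.
have := @cvg_monotone_convergence _ _ _ P setT measurableT g mg _ _.
have -> : \int[P]_w N w = \int[P]_w limn (g^~ w).
  by apply: eq_integral => w _; apply/esym/cvg_lim => //; exact: gN.
move=> h; apply: (cvg_unique _ (h _ _) lim1) => [//|n w _|w _ n m nm].
  by rewrite lee_fin ler0n.
exact: g_nd.
Qed.
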